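(* For every $A\subset\overline\Omega$, $$\mathrm{Cap}_{p,\Omega}(A)=\inf\{\|u\|^p_{W^{1,p}(\Omega)}: u\in\tilde W^{1,p}(\Omega),\ \tilde u\ge1 \ \mathrm{Cap}_{p,\Omega}\text{-quasi everywhere on } A\}.$$
   Context: Throughout, $\Omega\subset\mathbb{R}^N$ is a nonempty open set and $p\in(1,\infty)$. $W^{1,p}(\Omega)$ is the usual Sobolev space with norm $\|u\|^p_{W^{1,p}(\Omega)}=\int_\Omega |u|^p+|\nabla u|^p\,dx$; $\tilde W^{1,p}(\Omega)$ is the closure in $W^{1,p}(\Omega)$ of $\{u|_\Omega: u\in C_c(\overline\Omega),\ u|_\Omega\in W^{1,p}(\Omega)\}$; for $A\subset\overline\Omega$, $\mathcal{Y}_{p,\Omega}(A)=\{u\in\tilde W^{1,p}(\Omega):\ \exists\, O \text{ open in } \overline\Omega \text{ (relative topology) with } A\subset O,\ u\ge 1 \text{ a.e. on } O\cap\Omega\}$ and $\mathrm{Cap}_{p,\Omega}(A)=\inf\{\|u\|^p_{W^{1,p}(\Omega)}: u\in\mathcal{Y}_{p,\Omega}(A)\}$ ($\inf\emptyset=\infty$). A set $P\subset\overline\Omega$ is $\mathrm{Cap}_{p,\Omega}$-polar if $\mathrm{Cap}_{p,\Omega}(P)=0$; ''quasi everywhere'' means outside a polar set. A function $f$ on $D\subset\overline\Omega$ is $\mathrm{Cap}_{p,\Omega}$-quasi continuous if for every $\varepsilon>0$ there is $V$ open in $\overline\Omega$ with $\mathrm{Cap}_{p,\Omega}(V)<\varepsilon$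 and $f|_{D\setminus V}$ continuous. For $u\in\tilde W^{1,p}(\Omega)$, $\tilde u:\overline\Omega\to\mathbb{R}$ denotes a $\mathrm{Cap}_{p,\Omega}$-quasi continuous function equal to $u$ a.e. on $\Omega$; such a function exists and is unique up to a polar set. *)

(* Defs.v *)
From HB Require Import structures.
From mathcomp Require Import all_boot all_order all_algebra.
From mathcomp Require Import all_classical all_reals all_analysis.
Set Implicit Arguments. Unset Strict Implicit. Unset Printing Implicit Defensive.
Import Order.TTheory GRing.Theory Num.Theory.
Import numFieldNormedType.Exports.
Local Open Scope classical_set_scope.
Local Open Scope ring_scope.

Definition Borel (R : realType) (N : nat) :=
  g_sigma_algebraType (@open ('rV[R]_N)).

Definition box (R : realType) (N : nat) (a b : 'rV[R]_N) : set 'rV[R]_N :=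
  [set x | forall i : 'I_N, a ord0 i <= x ord0 i <= b ord0 i].

(* mu is Lebesgue measure on the Borel sets of R^N: it gives every box its
   volume (this determines mu uniquely). *)
Definition is_lebesgue (R : realType) (N : nat)
  (mu : {measure set (Borel R N) -> \bar R}) : Prop :=
  forall a b : 'rV[R]_N, (forall i, a ord0 i <= b ord0 i) ->
    mu (box a b : set (Borel R N)) = (\prod_(i < N) (b ord0 i - a ord0 i))%:E.

Definition ebasis (R : realType) (N : nat) (i : 'I_N) : 'rV[R]_N :=
  delta_mx ord0 i.
Definition partial (R : realType) (N : nat) (i : 'I_N)
  (f : 'rV[R]_N -> R) : 'rV[R]_N -> R :=
  fun x => derive f x (ebasis R i).
Fixpoint iter_partial (R : realType) (N : nat) (s : seq 'I_N)
  (f : 'rV[R]_N -> R) : 'rV[R]_N -> R :=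
  match s with
  | [::] => f
  | i :: s' => partial i (iter_partial s' f)
  end.

Definition test_fun (R : realType) (N : nat) (Om : set 'rV[R]_N)
  (phi : 'rV[R]_N -> R) : Prop :=
  (forall (s : seq 'I_N) (i : 'I_N) (x : 'rV[R]_N),
      derivable (iter_partial s phi) x (ebasis R i)) /\
  (forall s : seq 'I_N, continuous (iter_partial s phi)) /\
  (exists K : set 'rV[R]_N, compact K /\ K `<=` Om /\
      forall x, ~ K x -> phi x = 0).

Definition is_weak_grad (R : realType) (N : nat)
  (mu : {measure set (Borel R N) -> \bar R}) (Om : set 'rV[R]_N) (p : R)
  (u : 'rV[R]_N -> R) (g : 'I_N -> 'rV[R]_N -> R) : Prop :=
  measurable_fun (Om : set (Borel R N)) (u : Borel R N -> R) /\
  (\int[mu]_(x in (Om : set (Borel R N))) (`|u x| `^ p)%:E < +oo)%E /\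
  (forall i, measurable_fun (Om : set (Borel R N)) (g i : Borel R N -> R) /\
     (\int[mu]_(x in (Om : set (Borel R N))) (`|g i x| `^ p)%:E < +oo)%E) /\
  (forall phi, test_fun Om phi -> forall i : 'I_N,
     (\int[mu]_(x in (Om : set (Borel R N))) (u x * partial i phi x)%:E =
      - \int[mu]_(x in (Om : set (Borel R N))) (g i x * phi x)%:E)%E).

Definition inW (R : realType) (N : nat)
  (mu : {measure set (Borel R N) -> \bar R}) (Om : set 'rV[R]_N) (p : R)
  (u : 'rV[R]_N -> R) : Prop :=
  exists g, is_weak_grad mu Om p u g.

Definition Wnormp (R : realType) (N : nat)
  (mu : {measure set (Borel R N) -> \bar R}) (Om : set 'rV[R]_N) (p : R)
  (u : 'rV[R]_N -> R) (g : 'I_N -> 'rV[R]_N -> R) : \bar R :=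
  \int[mu]_(x in (Om : set (Borel R N)))
     ((`|u x| `^ p) + (Num.sqrt (\sum_(i < N) g i x ^+ 2)) `^ p)%:E.

Definition Cc_closure (R : realType) (N : nat) (Om : set 'rV[R]_N)
  (v : 'rV[R]_N -> R) : Prop :=
  {within closure Om, continuous v} /\
  exists K : set 'rV[R]_N, compact K /\ K `<=` closure Om /\
    forall x, closure Om x -> ~ K x -> v x = 0.

Definition inWtilde (R : realType) (N : nat)
  (mu : {measure set (Borel R N) -> \bar R}) (Om : set 'rV[R]_N) (p : R)
  (u : 'rV[R]_N -> R) : Prop :=
  inW mu Om p u /\
  forall eps : R, 0 < eps ->
    exists v, Cc_closure Om v /\
      exists g h, is_weak_grad mu Om p u g /\ is_weak_grad mu Om p v h /\
        (Wnormp mu Om p (fun x => (u x - v x)%R) (fun i x => (g i x - h i x)%R)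
           < eps%:E)%E.

Definition rel_open (R : realType) (N : nat) (Om : set 'rV[R]_N)
  (O : set 'rV[R]_N) : Prop :=
  exists U : set 'rV[R]_N, open U /\ O = U `&` closure Om.

Definition Yset (R : realType) (N : nat)
  (mu : {measure set (Borel R N) -> \bar R}) (Om : set 'rV[R]_N) (p : R)
  (A : set 'rV[R]_N) (u : 'rV[R]_N -> R) : Prop :=
  inWtilde mu Om p u /\
  exists O, rel_open Om O /\ A `<=` O /\
    {ae mu, forall x : Borel R N, (O `&` Om) x -> 1 <= u x}.

Definition Cap (R : realType) (N : nat)
  (mu : {measure set (Borel R N) -> \bar R}) (Om : set 'rV[R]_N) (p : R)
  (A : set 'rV[R]_N) : \bar R :=
  ereal_inf [set y | exists u g, Yset mu Om p A u /\
                        is_weak_grad mu Om p u g /\ y = Wnormp mu Om p u g].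

Definition quasi_continuous (R : realType) (N : nat)
  (mu : {measure set (Borel R N) -> \bar R}) (Om : set 'rV[R]_N) (p : R)
  (D : set 'rV[R]_N) (f : 'rV[R]_N -> R) : Prop :=
  forall eps : R, 0 < eps ->
    exists V, rel_open Om V /\ (Cap mu Om p V < eps%:E)%E /\
      {within D `\` V, continuous f}.

Definition qc_rep (R : realType) (N : nat)
  (mu : {measure set (Borel R N) -> \bar R}) (Om : set 'rV[R]_N) (p : R)
  (u f : 'rV[R]_N -> R) : Prop :=
  quasi_continuous mu Om p (closure Om) f /\
  {ae mu, forall x : Borel R N, Om x -> f x = u x}.

Definition qe_ge1 (R : realType) (N : nat)
  (mu : {measure set (Borel R N) -> \bar R}) (Om : set 'rV[R]_N) (p : R)
  (A : set 'rV[R]_N) (f : 'rV[R]_N -> R) : Prop :=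
  exists P : set 'rV[R]_N, P `<=` closure Om /\ Cap mu Om p P = 0%E /\
    forall x, A x -> ~ P x -> 1 <= f x.

(* Main.v *)
Require Import Defs.
From HB Require Import structures.
From mathcomp Require Import all_boot all_order all_algebra.
From mathcomp Require Import all_classical all_reals all_analysis.
From mathcomp Require Import measurable_realfun.
From mathcomp Require Import ring lra.
Set Implicit Arguments. Unset Strict Implicit. Unset Printing Implicit Defensive.
Import Order.TTheory GRing.Theory Num.Theory.
Import numFieldNormedType.Exports.
Local Open Scope classical_set_scope.
Local Open Scope ring_scope.

(** A function u in the capacity class of A is at least 1 almost everywhere on a relatively
    open set O containing A. If f is its quasi-continuous version and V a set of small capacity
    off which f is continuous, then (O meet {f < 1}) union V is relatively open and, up to a null
    set, the part of it inside Omega lies in V; so O meet {f < 1} has the same small capacity as V,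
    and f >= 1 quasi everywhere on A. Conversely, if f >= 1 on A outside a polar set P and k > 1,
    the maximum of k u, a competitor for V and a competitor for P is at least 1 on a relatively
    open set containing A; since the energy density of a maximum is the energy density of one of
    the functions, its energy is at most k^p times that of u plus a small error.

    Quasi-continuous versions are limits of v_n in C_c converging fast to u: the set where
    2^n |v_(n+1) - v_n| > 1 for some n >= m has small capacity because the supremum of these
    functions belongs to the space, the running maxima being almost everywhere stationary.

    The gradient of a maximum is obtained from difference quotients. For a weak derivative g,
    u (x + h e_i) - u x is almost everywhere the integral of g over the segment, hence the
    quotients converge almost everywhere to g (Lebesgue differentiation along lines and Fubini),
    and so do, for each c, those of (u - c)^+ to an explicit limit; averages of |g| dominate them
    and have constant integral, so one may pass to the limit in the integrals. Letting c tend to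
    0 from above and from below gives the gradient of u^+ and its vanishing on {u = 0}. *)

(** * Smooth bump functions *)

(** Every test function constructed here is a product of one-dimensional bumps. This class suffices:
    such products converge pointwise to indicators of open boxes, boxes form a pi-system generating
    the Borel sets, and averaging a product over a segment in direction e_i changes only its i-th
    factor, so the average is again a test function and its i-th derivative is an exact difference.
    No mollification of u enters. Truncations (u - c)^+ with c < 0 may fail to be p-integrable on a
    set of infinite measure, so weak derivatives are first studied for locally integrable functions.
    The vanishing of the gradient on {u = 0} is what makes u -> u^+ continuous along approximating
    sequences, hence W-tilde stable under maxima. The factor k > 1 is there because {f >= 1} need
    not be relatively open, whereas {f > 1/k} becomes so once V is added. Stationarity of the
    running maxima takes the place of weak compactness: the supremum inherits its gradient and its
    energy bound pointwise, from functions that stay in C_c. *)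

Lemma scaleRE (R : realType) (a b : R) : a *: b = a * b. Proof. by []. Qed.

(** A whole sequence of successive derivatives is asked for, so that iterated partial derivatives of
    products can be written down by indexing into it. *)
Definition smooth (R : realType) (f : R -> R) : Prop :=
  exists F : nat -> R -> R, F 0%N = f /\
    forall n (x : R), is_derive x (1 : R) (F n) (F n.+1 x).

(** Coinduction: choice turns the closure of [S] under differentiation into a map on functions,
    whose iterates are the successive derivatives. No closed formula for an n-th derivative is ever
    needed. *)
Lemma smooth_coind (R : realType) (S : set (R -> R)) :
  (forall g, S g -> exists2 g', S g' & forall x : R, is_derive x (1 : R) g (g' x)) ->
  forall g, S g -> smooth g.
Proof.
move=> HS g Sg.
have /choice[d dP] : forall g : R -> R, exists g' : R -> R,
    S g -> S g' /\ forall x : R, is_derive x (1 : R) g (g' x).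
  move=> h; have [Sh|nSh] := pselect (S h); last by exists h.
  by have [g' Sg' dg'] := HS h Sh; exists g'.
have SI n : S (iter n d g) by elim: n => //= n /dP[].
by exists (fun n => iter n d g); split=> // n x; have [_] := dP _ (SI n); exact.
Qed.

Lemma smooth_continuous (R : realType) (f : R -> R) : smooth f -> continuous f.
Proof.
move=> [F [<- HF]] x; apply/differentiable_continuous/derivable1_diffP.
by case: (HF 0%N x).
Qed.

(** Derivatives of a product stay among the finite sums of terms [F m * G n], so the Leibniz
    coefficients never appear. *)
Inductive prodspan (R : realType) (F G : nat -> R -> R) : (R -> R) -> Prop :=
| prodspan_mul m n : prodspan F G (fun x => F m x * G n x)
| prodspan_add f g : prodspan F G f -> prodspan F G g ->
    prodspan F G (fun x => f x + g x).

Lemma smoothM (R : realType) (f g : R -> R) :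
  smooth f -> smooth g -> smooth (fun x => f x * g x).
Proof.
move=> [F [<- HF]] [G [<- HG]].
apply: (@smooth_coind _ (prodspan F G)); last exact: prodspan_mul.
move=> h; elim=> {h} [m n|h k Hh [h' Sh' dh'] Hk [k' Sk' dk']].
  exists (fun x => (F m x * G n.+1 x) + (F m.+1 x * G n x)).
    by apply: prodspan_add; exact: prodspan_mul.
  move=> x; have dF := HF m x; have dG := HG n x.
  apply: (@is_derive_eq _ _ _ (F m * G n : R -> R)).
  by rewrite !scaleRE mulrC addrC [X in X + _ = _]mulrC addrC; ring.
exists (fun x => h' x + k' x); first exact: prodspan_add.
by move=> x; have dF := dh' x; have dG := dk' x; exact: is_deriveD.
Qed.

Lemma smooth_affine (R : realType) (f : R -> R) (a b : R) :
  smooth f -> smooth (fun x => f (a * x + b)).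
Proof.
move=> [F [<- HF]]; exists (fun n x => a ^+ n * F n (a * x + b)); split.
  by apply/funext => x; rewrite expr0 mul1r.
move=> n x.
have d1 : is_derive x (1 : R) (fun x => a * x + b) a.
  apply: (@is_derive_eq _ _ _ (a *: (id : R -> R) + cst b)).
  by rewrite addr0 scaleRE mulr1.
have d2 := @is_derive1_comp R (F n) (fun x => a * x + b) x _ _ (HF n (a * x + b)) d1.
apply: (@is_derive_eq _ _ _ ((a ^+ n) *: (F n \o (fun x => a * x + b)))).
by rewrite scaleRE exprS; ring.
Qed.

Lemma smoothD (R : realType) (f g : R -> R) :
  smooth f -> smooth g -> smooth (fun x => f x + g x).
Proof.
move=> [F [<- HF]] [G [<- HG]]; exists (fun n x => F n x + G n x); split=> // n x.
by have dF := HF n x; have dG := HG n x; exact: is_deriveD.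
Qed.

Lemma smooth_primitive (R : realType) (f g : R -> R) :
  (forall x : R, is_derive x (1 : R) f (g x)) -> smooth g -> smooth f.
Proof.
move=> Hf [G [G0 HG]].
exists (fun n => if n is m.+1 then G m else f); split=> // -[|n] x //=.
by rewrite G0.
Qed.

(** The functions p(1/t) e^(-1/t), extended by 0 to t <= 0, are stable under differentiation once p
    ranges over all polynomials: p becomes X^2 (p - p'). *)
Definition flat_exp (R : realType) (p : {poly R}) (t : R) : R :=
  if 0 < t then p.[t^-1] * expR (- t^-1) else 0.

(** The estimate y^n / n! <= e^y is applied to each monomial; the added 1 only makes the constant
    positive. *)
Lemma poly_expR_bounded (R : realType) (p : {poly R}) :
  exists2 C : R, 0 < C & forall y : R, 0 <= y -> `|p.[y]| * expR (- y) <= C.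
Proof.
have mono (n : nat) (y : R) : 0 <= y -> y ^+ n * expR (- y) <= n`!%:R.
  move=> y0; rewrite expRN ler_pdivrMr ?expR_gt0//.
  case: n => [|n].
    by rewrite expr0 fact0 mul1r (le_trans _ (expR_ge1Dx y))// lerDl.
  rewrite -ler_pdivrMl ?ltr0n ?fact_gt0// mulrC.
  by apply: le_trans (expR_ge1Dxn n y0); rewrite lerDr.
exists (1 + \sum_(i < size p) `|p`_i| * i`!%:R).
  by apply: ltr_pwDl => //; apply: sumr_ge0 => i _; rewrite mulr_ge0.
move=> y y0; rewrite horner_coef.
apply: (@le_trans _ _ (\sum_(i < size p) `|p`_i| * i`!%:R)); last by rewrite lerDr.
apply: (@le_trans _ _ ((\sum_(i < size p) `|p`_i * y ^+ i|) * expR (- y))).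
  by rewrite ler_wpM2r ?expR_ge0// ler_norm_sum.
rewrite mulr_suml; apply: ler_sum => i _.
rewrite normrM -mulrA ler_wpM2l// ger0_norm ?exprn_ge0//; exact: mono.
Qed.

Lemma is_derive_flat (R : realType) (f : R -> R) (C : R) :
  (forall t, `|f t| <= C * t ^+ 2) -> is_derive (0 : R) (1 : R) f 0.
Proof.
move=> Hf.
have f0 : f 0 = 0.
  by have := Hf 0; rewrite expr0n mulr0 normr_le0 => /eqP.
have C0 : 0 <= C by have := Hf 1; rewrite expr1n mulr1; exact: le_trans.
have H : h^-1 *: ((f \o shift (0 : R)) (h *: (1 : R)) - f 0) @[h --> (0 : R)^'] --> (0 : R).
  apply/cvgrPdist_le => e e0.
  have C1 : 0 < C + 1 by rewrite ltr_wpDl.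
  near=> h.
  have h0 : h != 0 by near: h; exact: nbhs_dnbhs_neq.
  rewrite sub0r normrN /= f0 subr0 addr0 !scaleRE mulr1 normrM normfV.
  have nh : 0 < `|h| by rewrite normr_gt0.
  rewrite ler_pdivrMl// (le_trans (Hf h))// -(real_normK (num_real h)) expr2.
  rewrite mulrCA ler_pM2l//.
  apply: (@le_trans _ _ ((C + 1) * `|h|)); first by rewrite ler_wpM2r// lerDl.
  rewrite -ler_pdivlMl//.
  near: h; apply: dnbhs0_le. by rewrite mulr_gt0 ?invr_gt0.
apply: DeriveDef; first by apply/cvg_ex; exists 0.
by apply/cvg_lim => //.
Unshelve. all: by end_near. Qed.

Lemma is_derive_flat_exp (R : realType) (p : {poly R}) (t : R) :
  is_derive t (1 : R) (flat_exp p) (flat_exp ('X ^+ 2 * (p - p^`())) t).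
Proof.
have [t0|t0|<-] := ltgtP 0 t.
- have -> : flat_exp ('X ^+ 2 * (p - p^`())) t =
     p.[t^-1] * (expR (- t^-1) * t^-1 ^+ 2) - p^`().[t^-1] * t^-1 ^+ 2 * expR (- t^-1).
    by rewrite /flat_exp t0 hornerM hornerXn hornerD hornerN; ring.
  have tn0 : t != 0 by rewrite gt_eqF.
  have dV : is_derive t (1 : R) (fun y : R => y^-1) (- t^-1 ^+ 2).
    have := @is_deriveV R id t 1 1 tn0 (@is_derive_id _ _ _ _).
    by rewrite scaleRE mulr1 exprVn.
  have dNV : is_derive t (1 : R) (fun y : R => - y^-1) (t^-1 ^+ 2).
    by have := is_deriveN dV; rewrite opprK.
  have d1 := @is_derive1_comp R expR (fun y : R => - y^-1) t _ _ (is_derive_expR (- t^-1)) dNV.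
  have d2 := @is_derive1_comp R (horner p) (fun y : R => y^-1) t _ _ (is_derive_poly p t^-1) dV.
  have d3 := is_deriveM d2 d1.
  apply: (near_eq_is_derive _ (is_derive_eq d3 _)).
    near=> x; rewrite /flat_exp /= ifT//.
    by near: x; exact: lt_nbhsr.
  by rewrite /= !scaleRE; ring.
- have -> : flat_exp ('X ^+ 2 * (p - p^`())) t = 0.
    by rewrite /flat_exp ltNge (ltW t0).
  apply: (near_eq_is_derive _ (is_derive_cst 0 t (1:R))).
  near=> x; rewrite /flat_exp ifF//; apply/negbTE; rewrite -leNgt ltW//.
  by near: x; exact: lt_nbhsl.
- have -> : flat_exp ('X ^+ 2 * (p - p^`())) (0 : R) = 0 by rewrite /flat_exp ltxx.
  (* Bounding X^2 p instead of p gives |p(1/y)| e^(-1/y) <= C y^2, the flatness that yields the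
     derivative 0 at the origin. *)
  have [C C0 HC] := poly_expR_bounded ('X ^+ 2 * p).
  apply: (@is_derive_flat _ _ C) => y; rewrite /flat_exp.
  case: ifPn => y0; last by rewrite normr0 mulr_ge0 ?sqr_ge0// ltW.
  rewrite normrM (ger0_norm (expR_ge0 _)).
  have yV : 0 <= y^-1 by rewrite invr_ge0 ltW.
  have := HC _ yV; rewrite hornerM hornerXn normrM -mulrA ger0_norm ?exprn_ge0//.
  rewrite exprVn ler_pdivrMl ?exprn_gt0// [C * _]mulrC.
Unshelve. all: by end_near. Qed.

Definition theta (R : realType) : R -> R := flat_exp 1.

Lemma thetaE (R : realType) (t : R) :
  theta t = if 0 < t then expR (- t^-1) else 0.
Proof. by rewrite /theta /flat_exp hornerC mul1r. Qed.

Lemma smooth_theta (R : realType) : smooth (@theta R).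
Proof.
apply: (@smooth_coind _ (range (@flat_exp R))); last by exists 1.
move=> _ [p _ <-]; exists (flat_exp ('X ^+ 2 * (p - p^`()))); first by exists ('X ^+ 2 * (p - p^`())).
by move=> x; exact: is_derive_flat_exp.
Qed.

Lemma theta_ge0 (R : realType) (t : R) : 0 <= theta t.
Proof. by rewrite thetaE; case: ifP => // _; exact: expR_ge0. Qed.

Lemma theta_le1 (R : realType) (t : R) : theta t <= 1.
Proof.
by rewrite thetaE; case: ifP => // t0; rewrite expR_le1 oppr_le0 invr_ge0 ltW.
Qed.

Lemma theta_le0 (R : realType) (t : R) : t <= 0 -> theta t = 0.
Proof. by rewrite thetaE leNgt => /negbTE ->. Qed.

Lemma theta_cvg1 (R : realType) (t : R) : 0 < t ->
  theta (k.+1%:R * t) @[k --> \oo] --> (1 : R).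
Proof.
move=> t0.
have -> : (fun k : nat => theta (k.+1%:R * t)) = (fun k => expR (- (k.+1%:R^-1 * t^-1))).
  by apply/funext => k; rewrite thetaE mulr_gt0// invfM.
have H : - (k.+1%:R^-1 * t^-1) @[k --> \oo] --> (0 : R).
  have := cvgN (cvgM (@cvg_harmonic R) (@cvg_cst _ t^-1 nat \oo _)).
  by rewrite mul0r oppr0; apply.
have /= := cvg_comp _ _ H (@continuous_expR R 0); rewrite expR0; exact.
Qed.

(** Not normalised: as [k] grows, these bumps approximate the indicator of the open interval ]a, b[,
    and they never exceed it. *)
Definition bump (R : realType) (a b : R) (k : nat) (t : R) : R :=
  theta (k.+1%:R * (t - a)) * theta (k.+1%:R * (b - t)).

Lemma smooth_bump (R : realType) (a b : R) (k : nat) : smooth (bump a b k).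
Proof.
have h1 := smooth_affine k.+1%:R (- (k.+1%:R * a)) (smooth_theta R).
have h2 := smooth_affine (- k.+1%:R) (k.+1%:R * b) (smooth_theta R).
have := smoothM h1 h2; congr smooth; apply/funext => t; rewrite /bump.
by congr (theta _ * theta _); ring.
Qed.

Lemma bump_ge0 (R : realType) (a b : R) (k : nat) t : 0 <= bump a b k t.
Proof. by rewrite mulr_ge0 ?theta_ge0. Qed.

Lemma bump_le1 (R : realType) (a b : R) (k : nat) t : bump a b k t <= 1.
Proof. by rewrite mulr_ile1 ?theta_ge0 ?theta_le1. Qed.

Lemma bump_out (R : realType) (a b : R) (k : nat) t :
  ~~ (a < t < b) -> bump a b k t = 0.
Proof.
rewrite negb_and -!leNgt => /orP[ta|bt]; rewrite /bump.
  by rewrite theta_le0 ?mul0r// pmulr_rle0// subr_le0.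
by rewrite [X in _ * X]theta_le0 ?mulr0// pmulr_rle0// subr_le0.
Qed.

Lemma bump_cvg (R : realType) (a b t : R) :
  bump a b k t @[k --> \oo] --> (if a < t < b then 1 else 0 : R).
Proof.
case: ifPn => [/andP[at_ tb]|/bump_out H].
  rewrite -(mulr1 1); apply: cvgM; apply: theta_cvg1; by rewrite subr_gt0.
by rewrite (_ : (fun _ => _) = cst 0); [exact: cvg_cst|apply/funext => k; exact: H].
Qed.

(** * Borel sets, boxes and Lebesgue measure *)

Section BorelSpace.
Context {R : realType} {N : nat}.
Notation E := 'rV[R]_N.
Implicit Types (a b x v : E) (U : set E).

Lemma open_measurableB U : open U -> measurable (U : set (Borel R N)).
Proof. by move=> oU; apply: sub_sigma_algebra. Qed.

Lemma closed_measurableB U : closed U -> measurable (U : set (Borel R N)).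
Proof.
move=> cU; rewrite -(setCK U); apply: (@measurableC _ (Borel R N)).
apply: open_measurableB. exact: closed_openC.
Qed.

Lemma continuous_measurableB (f : E -> R) : continuous f ->
  measurable_fun (setT : set (Borel R N)) (f : Borel R N -> R).
Proof.
move=> cf; apply: (measurability _ (measurable_realfun.RGenOpens.measurableE R)) => _ [_ [x [y ->]] <-].
rewrite setTI; apply: open_measurableB.
by move/continuousP : cf; apply; exact: interval_open.
Qed.

Lemma measurable_coord (i : 'I_N) :
  measurable_fun (setT : set (Borel R N)) (fun x : Borel R N => (x : E) ord0 i).
Proof. by apply: continuous_measurableB; exact: coord_continuous. Qed.

Lemma box_compact a b : compact (box a b).
Proof.
rewrite (_ : box a b = [set x : E | forall i, `[a ord0 i, b ord0 i]%classic (x ord0 i)]).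
  exact: (@rV_compact R N (fun i => `[a ord0 i, b ord0 i]%classic)
    (fun i => @segment_compact R _ _)).
by apply/seteqP; split=> x h i; have := h i; rewrite /= in_itv.
Qed.

Lemma box_closed a b : closed (box a b).
Proof. by apply: compact_closed; [exact: norm_hausdorff|exact: box_compact]. Qed.

Lemma measurable_box a b : measurable (box a b : set (Borel R N)).
Proof. by apply: closed_measurableB; exact: box_closed. Qed.

Lemma box_setI a b c d : box a b `&` box c d =
  box (\row_i Num.max (a ord0 i) (c ord0 i)) (\row_i Num.min (b ord0 i) (d ord0 i)).
Proof.
apply/seteqP; split=> x.
  move=> [h1 h2] i; rewrite !mxE ge_max le_min.
  by have /andP[-> ->] := h1 i; have /andP[-> ->] := h2 i.
move=> h; split=> i; have := h i; rewrite !mxE ge_max le_min;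
  by move=> /andP[/andP[h1 h2] /andP[h3 h4]]; apply/andP.
Qed.

Lemma box_empty a b i : b ord0 i < a ord0 i -> box a b = set0.
Proof.
move=> h; apply/seteqP; split=> // x /(_ i) /andP[h1 h2].
by have := lt_le_trans h (le_trans h1 h2); rewrite ltxx.
Qed.

(* The index set [P] is needed because no box is empty when [N = 0]. *)
Lemma open_bigcup_box U : open U ->
  exists (P : set nat) (a b : nat -> E), U = \bigcup_(k in P) box (a k) (b k).
Proof.
move=> oU.
pose q (k : nat) : 'rV[rat]_N * 'rV[rat]_N := odflt (0, 0) (unpickle k).
pose a k : E := map_mx ratr (q k).1; pose b k : E := map_mx ratr (q k).2.
exists [set k | box (a k) (b k) `<=` U], a, b.
apply/seteqP; split; last by move=> x [k]; exact.
move=> x Ux.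
have /nbhs_ballP[e /= e0 He] := open_nbhs_nbhs (conj oU Ux).
have ratlt (s t : R) : s < t -> exists r : rat, s < ratr r < t.
  by move=> /rat_in_itvoo[r]; rewrite in_itv /=; exists r.
have /choice[l Hl] : forall i : 'I_N, exists r : rat, x ord0 i - e < ratr r < x ord0 i.
  by move=> i; apply: ratlt; rewrite gtrBl.
have /choice[u Hu] : forall i : 'I_N, exists r : rat, x ord0 i < ratr r < x ord0 i + e.
  by move=> i; apply: ratlt; rewrite ltrDl.
exists (pickle (\row_i l i, \row_i u i)).
  rewrite /= /a /b /q pickleK /= => y Hy; apply: He; split=> // i0 i.
  rewrite (ord1 i0) /ball /= ltr_distl; have := Hy i; rewrite !mxE => /andP[h1 h2].
  have /andP[h3 _] := Hl i; have /andP[_ h4] := Hu i.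
  by apply/andP; split; lra.
rewrite /a /b /q pickleK /= => i; rewrite !mxE.
by have /andP[_ /ltW ->] := Hl i; have /andP[/ltW -> _] := Hu i.
Qed.

Definition boxes : set (set (Borel R N)) := [set A | exists a b, A = box a b].

Lemma borel_boxes : @measurable _ (Borel R N) = <<s boxes >>.
Proof.
apply/seteqP; split.
  apply: smallest_sub; first exact: smallest_sigma_algebra.
  move=> U /open_bigcup_box[P [a [b ->]]].
  apply: (@bigcup_measurable _ (g_sigma_algebraType boxes)) => k _.
  by apply: sub_sigma_algebra; exists (a k), (b k).
apply: smallest_sub; first exact: (@sigma_algebra_measurable _ (Borel R N)).
by move=> _ [a [b ->]]; exact: measurable_box.
Qed.

Lemma setI_closed_boxes : setI_closed boxes.
Proof. by move=> _ _ [a [b ->]] [c [d ->]]; rewrite box_setI; do 2 eexists. Qed.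

Definition cube (k : nat) : set E := box (const_mx (- k%:R)) (const_mx k%:R).

Lemma cube_cover : \bigcup_k cube k = setT.
Proof.
apply/seteqP; split=> // x _.
have [k Hk] : exists k : nat, forall i : 'I_N, `|x ord0 i| <= k%:R.
  exists (\max_(i < N) Num.bound `|x ord0 i|)%N => i.
  apply: (@le_trans _ _ (Num.bound `|x ord0 i|)%:R).
    by rewrite ltW// archi_boundP.
  by rewrite ler_nat; exact: (@leq_bigmax _ (fun i : 'I_N => Num.bound `|x ord0 i|)).
by exists k => // i; rewrite !mxE -ler_norml.
Qed.

(** Boxes form a pi-system generating the Borel sets and the cubes exhaust the space, so the
    uniqueness theorem for measures applies. *)
Lemma boxes_measure_eq (m1 m2 : {measure set (Borel R N) -> \bar R}) :
  (forall a b, m1 (box a b) = m2 (box a b)) ->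
  (forall a b, m1 (box a b) < +oo)%E ->
  forall A : set (Borel R N), measurable A -> m1 A = m2 A.
Proof.
move=> H12 Hoo A mA; apply: (measure_unique boxes (fun k => cube k : set (Borel R N))) => //.
- exact: borel_boxes.
- exact: setI_closed_boxes.
- by move=> k; do 2 eexists.
- exact: cube_cover.
- by move=> _ [a [b ->]].
- by move=> k; exact: Hoo.
Qed.

Lemma measurable_fun_Borel d (T : measurableType d) (f : T -> Borel R N) :
  (forall i, measurable_fun setT (fun t => (f t : E) ord0 i)) ->
  measurable_fun setT f.
Proof.
move=> mf; apply: (measurability _ borel_boxes) => _ [_ [a [b ->]] <-].
rewrite setTI (_ : f @^-1` _ = \bigcap_(i in [set: 'I_N])
    ((fun t => (f t : E) ord0 i) @^-1` `[a ord0 i, b ord0 i]%classic)).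
  apply: fin_bigcap_measurable => // i _; rewrite -[X in measurable X]setTI.
  exact: mf.
apply/seteqP; split=> t.
  by move=> h i _; have := h i; rewrite /= in_itv.
by move=> h i; have := h i I; rewrite /= in_itv.
Qed.

End BorelSpace.

(** * Translation invariance and sigma-finiteness of Lebesgue measure *)

Section Lebesgue.
Context {R : realType} {N : nat}.
Notation E := 'rV[R]_N.
Notation B := (Borel R N).
Context (mu : {measure set B -> \bar R}) (Hmu : is_lebesgue mu).
Implicit Types (a b x v : E).
Local Open Scope ereal_scope.

Definition shift_by v : B -> B := fun x : E => (x + v)%R.

Lemma measurable_shift v : measurable_fun setT (shift_by v).
Proof.
apply: measurable_fun_Borel => i.
rewrite (_ : (fun _ => _) = (fun t : E => (t ord0 i + v ord0 i)%R)).
  by apply: measurable_funD => //; exact: measurable_coord.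
by apply/funext => t; rewrite mxE.
Qed.

Lemma mu_box_lty a b : mu (box a b) < +oo.
Proof.
have [/forallP h|/forallPn[i]] := boolP [forall i, a ord0 i <= b ord0 i]%R.
  by rewrite Hmu// ltry.
by rewrite -ltNge => /box_empty ->; rewrite measure0.
Qed.

Lemma shift_box v a b : shift_by v @^-1` (box a b) = box (a - v) (b - v).
Proof.
apply/seteqP; split=> x h i; have := h i; rewrite !mxE;
  by rewrite lerBlDr lerBrDr.
Qed.

(** The measure transported by a translation gives every box the same volume, hence agrees with
    [mu]. Empty boxes are treated apart, since [is_lebesgue] speaks of ordered corners only. *)
Lemma mu_shift v (A : set B) : measurable A -> mu (shift_by v @^-1` A) = mu A.
Proof.
move=> mA; rewrite -[LHS]/(pushforward mu (shift_by v) A).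
apply: boxes_measure_eq => //; first exact: measurable_shift.
  move=> ms a b; rewrite /= /pushforward shift_box.
  have [/forallP h|/forallPn[i]] := boolP [forall i, a ord0 i <= b ord0 i]%R.
    rewrite !Hmu//; last by move=> i; rewrite !mxE lerD2r.
    by congr (_%:E); apply: eq_bigr => i _; rewrite !mxE; ring.
  rewrite -ltNge => h; rewrite (box_empty h) (@box_empty _ _ _ _ i) ?measure0//.
  by rewrite !mxE ltrD2r.
by move=> ms a b; rewrite /= /pushforward shift_box; exact: mu_box_lty.
Qed.

Lemma ge0_integral_shift v (f : B -> \bar R) :
  measurable_fun setT f -> (forall x, 0 <= f x) ->
  \int[mu]_x f (x + v)%R = \int[mu]_x f x.
Proof.
move=> mf f0.
have := @ge0_integral_pushforward _ _ B B R (shift_by v) (measurable_shift v) mu setT f measurableT mf (fun x _ => f0 x).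
rewrite preimage_setT => <-; apply: eq_measure_integral; first exact: measurable_shift.
by move=> ms A mA _; exact: mu_shift.
Qed.

Lemma integrable_shift v (f : B -> \bar R) :
  mu.-integrable setT f -> mu.-integrable setT (fun x => f (x + v)%R).
Proof.
move=> /integrableP[mf fi]; apply/integrableP; split.
  exact: (measurableT_comp mf (measurable_shift v)).
rewrite (ge0_integral_shift v (f := fun x => `|f x|))//.
exact: measurableT_comp.
Qed.

Lemma integral_shift v (f : B -> \bar R) :
  mu.-integrable setT f -> \int[mu]_x f (x + v)%R = \int[mu]_x f x.
Proof.
move=> /integrableP[mf _]; rewrite [LHS]integralE [RHS]integralE; congr (_ - _).
  rewrite -(ge0_integral_shift v (measurable_funepos mf) (funepos_ge0 f)).
  by apply: eq_integral => x _; rewrite !funepos.unlock.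
rewrite -(ge0_integral_shift v (measurable_funeneg mf) (funeneg_ge0 f)).
by apply: eq_integral => x _; rewrite !funeneg.unlock.
Qed.

Lemma sigma_finite_lebesgue : sigma_finite setT mu.
Proof.
exists (fun k => cube k : set B); first by rewrite cube_cover.
by move=> k; split; [exact: measurable_box|exact: mu_box_lty].
Qed.

(** The same measure, carrying the sigma-finite structure that Fubini and Tonelli require. *)
Definition sflebesgue : {sigma_finite_measure set B -> \bar R} :=
  HB.pack_for (SigmaFiniteMeasure.type B R) (Measure.sort mu)
    (isSFinite.Build _ _ _ _ (sfinite_measure_sigma_finite sigma_finite_lebesgue))
    (isSigmaFinite.Build _ _ _ _ sigma_finite_lebesgue).

Lemma ler_norm_coord x (i : 'I_N) : (`|x ord0 i| <= `|x|)%R.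
Proof.
by rewrite [leRHS]/Num.norm /= mx_normrE; apply/bigmax_geP; right => /=; exists (ord0, i).
Qed.

Lemma compact_mu_lty (K : set E) : compact K -> mu K < +oo.
Proof.
move=> cK; have [M M0 HM] := pinfty_ex_gt0 (compact_bounded cK).
apply: (@le_lt_trans _ _ (mu (box (const_mx (- M)%R) (const_mx M)))); last exact: mu_box_lty.
apply: le_measure; rewrite ?inE.
- by apply: closed_measurableB; apply: (compact_closed (@norm_hausdorff R _) cK).
- exact: measurable_box.
move=> x Kx i; rewrite !mxE -ler_norml.
by apply: le_trans (HM _ Kx); exact: ler_norm_coord.
Qed.

End Lebesgue.

(** * Test functions *)

Section TestFunctions.
Context {R : realType} {N : nat}.
Notation E := 'rV[R]_N.
Implicit Types (a b x v : E) (i j : 'I_N).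

Lemma is_derive_line (f : E -> R) (x v : E) (df : R) :
  is_derive (0 : R) (1 : R) (fun h => f (h *: v + x)) df -> is_derive x v f df.
Proof.
set g := fun h => _ => -[dg dgE].
have eqf : (fun h : R => h^-1 *: ((f \o shift x) (h *: v) - f x)) =
           (fun h : R => h^-1 *: ((g \o shift 0) (h *: (1 : R)) - g 0)).
  by apply/funext => h; rewrite /g /= scaleRE mulr1 addr0 scale0r add0r.
split; first by rewrite /derivable eqf.
by rewrite -dgE /derive eqf.
Qed.

Lemma coord_line (h : R) x i j :
  (h *: (ebasis R i) + x) ord0 j = (if j == i then h + x ord0 i else x ord0 j).
Proof.
rewrite !mxE eqxx /= eq_sym; have [<-|] := eqVneq i j; first by rewrite mulr1.
by rewrite mulr0 add0r.
Qed.

(** For products of functions of one variable, an iterated partial derivative depends only on how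
    often each coordinate is differentiated; this makes the conditions of [test_fun] checkable. *)
Definition tensor (f : 'I_N -> R -> R) (x : E) : R := \prod_j f j (x ord0 j).

Lemma is_derive_tensor (f : 'I_N -> R -> R) (g : R -> R) i x :
  is_derive (x ord0 i) (1 : R) (f i) (g (x ord0 i)) ->
  is_derive x (ebasis R i) (tensor f)
    (tensor (fun j => if j == i then g else f j) x).
Proof.
move=> df; apply: is_derive_line.
pose c := \prod_(j | j != i) f j (x ord0 j).
have -> : (fun h : R => tensor f (h *: ebasis R i + x)) =
    (fun h : R => c *: f i (h + x ord0 i)).
  apply/funext => h; rewrite /tensor (bigD1 i)//= coord_line eqxx scaleRE mulrC.
  by congr (_ * _); apply: eq_bigr => j ji; rewrite coord_line (negbTE ji).
have -> : tensor (fun j => if j == i then g else f j) x = c *: (g (x ord0 i) * 1).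
  rewrite /tensor (bigD1 i)//= eqxx mulr1 scaleRE mulrC; congr (_ * _).
  by apply: eq_bigr => j ji; rewrite (negbTE ji).
apply: is_deriveZ.
have d1 : is_derive (0 : R) (1 : R) (fun h : R => h + x ord0 i) 1.
  apply: (@is_derive_eq _ _ _ ((id : R -> R) + cst (x ord0 i))).
  by rewrite addr0.
have df0 : is_derive (0 + x ord0 i) (1 : R) (f i) (g (x ord0 i)) by rewrite add0r.
exact: (@is_derive1_comp R (f i) (fun h : R => h + x ord0 i) 0 _ _ df0 d1).
Qed.

Lemma tensor_continuous (f : 'I_N -> R -> R) :
  (forall j, continuous (f j)) -> continuous (tensor f).
Proof.
move=> cf; rewrite /tensor; elim: (index_enum _) => [|j s IH] x.
  have -> : (fun x : E => \prod_(j <- [::]) f j (x ord0 j)) = cst 1.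
    by apply/funext => y; rewrite big_nil.
  exact: cst_continuous.
have -> : (fun x : E => \prod_(k <- j :: s) f k (x ord0 k)) =
    (fun x => f j (x ord0 j) * \prod_(k <- s) f k (x ord0 k)).
  by apply/funext => y; rewrite big_cons.
apply: (@continuousM _ _ (fun x : E => f j (x ord0 j))); last exact: IH.
apply: (@continuous_comp _ _ _ (fun x : E => x ord0 j) (f j)); last exact: cf.
exact: coord_continuous.
Qed.

Lemma iter_partial_tensor (F : 'I_N -> nat -> R -> R) (s : seq 'I_N) :
  (forall j n (t : R), is_derive t (1 : R) (F j n) (F j n.+1 t)) ->
  iter_partial s (tensor (fun j => F j 0%N)) = tensor (fun j => F j (count_mem j s)).
Proof.
move=> dF; elim: s => //= i s ->; apply/funext => x; rewrite /partial.
have [_ ->] := @is_derive_tensor (fun j => F j (count_mem j s)) (F i (count_mem i s).+1) i x (dF i _ _).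
congr (tensor _ x); apply/funext => j; rewrite eq_sym.
by have [->|_] := eqVneq j i; rewrite ?add1n ?add0n.
Qed.

Lemma tensor_support (f : 'I_N -> R -> R) a b x :
  (forall j t, ~~ (a ord0 j <= t <= b ord0 j) -> f j t = 0) ->
  ~ box a b x -> tensor f x = 0.
Proof.
move=> sf; rewrite /box /= => /existsNP[j /negP /sf fj0].
by rewrite /tensor (bigD1 j)//= fj0 mul0r.
Qed.

Lemma test_fun_tensor (Om : set E) (f : 'I_N -> R -> R) a b :
  (forall j, smooth (f j)) ->
  (forall j t, ~~ (a ord0 j <= t <= b ord0 j) -> f j t = 0) ->
  box a b `<=` Om -> test_fun Om (tensor f).
Proof.
move=> /choice[F HF] sf abOm.
have dF j n (t : R) : is_derive t (1 : R) (F j n) (F j n.+1 t) by case: (HF j).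
have -> : f = (fun j => F j 0%N) by apply/funext => j; case: (HF j).
split; [|split].
- move=> s i x; rewrite iter_partial_tensor//.
  by case: (@is_derive_tensor (fun j => F j (count_mem j s)) _ i x (dF i _ _)).
- move=> s; rewrite iter_partial_tensor//; apply: tensor_continuous => j t.
  by apply/differentiable_continuous/derivable1_diffP; case: (dF j (count_mem j s) t).
- exists (box a b); split; first exact: box_compact.
  split=> // x; apply: tensor_support => j t /sf; by case: (HF j) => ->.
Qed.

Lemma partial_tensorE (f : 'I_N -> R -> R) (g : R -> R) i x :
  (forall t : R, is_derive t (1 : R) (f i) (g t)) ->
  partial i (tensor f) x = tensor (fun j => if j == i then g else f j) x.
Proof. by move=> df; case: (@is_derive_tensor f g i x (df _)). Qed.

Section TestFunctionProperties.
Context (Om : set E) (phi : E -> R) (Hphi : test_fun Om phi).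

Lemma test_fun_continuous : continuous phi.
Proof. by case: Hphi => _ [/(_ [::])]. Qed.

Lemma test_fun_partial_continuous i : continuous (partial i phi).
Proof. by case: Hphi => _ [/(_ [:: i])]. Qed.

Lemma test_fun_is_derive i x : is_derive x (ebasis R i) phi (partial i phi x).
Proof. by case: Hphi => /(_ [::] i x). Qed.

(** The same [K] serves for the partial derivatives: its complement is open, so [phi] vanishes near
    each point outside. *)
Lemma test_fun_support : exists K : set E, [/\ compact K, K `<=` Om,
  forall x, ~ K x -> phi x = 0 & forall i x, ~ K x -> partial i phi x = 0].
Proof.
case: Hphi => _ [_ [K [cK [KOm K0]]]]; exists K; split=> // i x nKx.
have oK : open (~` K).
  by apply: closed_openC; apply: (compact_closed (@norm_hausdorff R _) cK).
suff [] : is_derive x (ebasis R i) phi 0 by [].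
apply: (near_eq_is_derive _ (is_derive_cst 0 x (ebasis R i))).
have : nbhs x (~` K) by apply: open_nbhs_nbhs.
by apply: filterS => y /K0 ->.
Qed.

End TestFunctionProperties.

Lemma compact_support_bounded (f : E -> R) (K : set E) : continuous f -> compact K ->
  (forall x, ~ K x -> f x = 0) -> exists2 M : R, 0 < M & forall x, `|f x| <= M.
Proof.
move=> cf cK K0.
have cfK : compact (f @` K).
  by apply: continuous_compact => //; exact: continuous_subspaceT.
have [M M0 HM] := pinfty_ex_gt0 (compact_bounded cfK).
exists M => // x; have [Kx|nKx] := pselect (K x); last by rewrite K0// normr0 ltW.
by apply: HM; exists x.
Qed.

End TestFunctions.

(** * The fundamental lemma of the calculus of variations *)

Section AlmostEverywhere.
Context d (T : measurableType d) (R : realType) (mu : {measure set T -> \bar R}).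

Lemma ae_imp (P Q : T -> Prop) : {ae mu, forall x, P x} ->
  (forall x, P x -> Q x) -> {ae mu, forall x, Q x}.
Proof. by move=> aP PQ; apply: (@filterS _ _ (ae_filter_ringOfSetsType mu)) aP. Qed.

Lemma ae_imp2 (P Q S : T -> Prop) : {ae mu, forall x, P x} ->
  {ae mu, forall x, Q x} -> (forall x, P x -> Q x -> S x) -> {ae mu, forall x, S x}.
Proof.
by move=> aP aQ H; apply: (@filterS2 _ _ (ae_filter_ringOfSetsType mu)) aP aQ.
Qed.

Lemma ae_all_fin (I : finType) (P : I -> T -> Prop) :
  (forall i, {ae mu, forall x, P i x}) -> {ae mu, forall x, forall i, P i x}.
Proof.
by move=> H; apply: (@filter_forall _ I P _ (ae_filter_ringOfSetsType mu)).
Qed.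

End AlmostEverywhere.

Section FundamentalLemma.
Context {R : realType} {N : nat}.
Notation E := 'rV[R]_N.
Notation B := (Borel R N).
Context (mu : {measure set B -> \bar R}) (Hmu : is_lebesgue mu).
Implicit Types (a b x v : E).
Local Open Scope ereal_scope.

Definition boxbump a b (k : nat) : E -> R :=
  tensor (fun j => bump (a ord0 j) (b ord0 j) k).

Lemma boxbump_ge0 a b k x : (0 <= boxbump a b k x)%R.
Proof. by apply: prodr_ge0 => j _; exact: bump_ge0. Qed.

Lemma boxbump_le1 a b k x : (boxbump a b k x <= 1)%R.
Proof.
apply: prodr_ile1 => j _; rewrite bump_ge0; exact: bump_le1.
Qed.

Lemma boxbump_out a b k x : ~ box a b x -> boxbump a b k x = 0%R.
Proof.
apply: tensor_support => j t h; apply: bump_out; apply: contraNN h => /andP[h1 h2].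
by rewrite !ltW.
Qed.

Lemma measurable_boxbump a b k : measurable_fun setT (boxbump a b k : B -> R).
Proof.
apply: continuous_measurableB; apply: tensor_continuous => j.
exact/smooth_continuous/smooth_bump.
Qed.

Lemma boxbump_cvg a b x : (forall j, a ord0 j < x ord0 j < b ord0 j)%R ->
  boxbump a b k x @[k --> \oo] --> (1 : R)%R.
Proof.
move=> h; rewrite /boxbump /tensor.
elim: (index_enum _) => [|j s IH].
  by under eq_cvg do rewrite big_nil; exact: cvg_cst.
under eq_cvg do rewrite big_cons.
have hj := @bump_cvg R (a ord0 j) (b ord0 j) (x ord0 j); rewrite h in hj.
by have := cvgM hj IH; rewrite mulr1; exact.
Qed.

(** Bumps converge to 1 only in the open box. The faces that are left out are degenerate boxes, of
    volume zero. *)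
Lemma ae_box_interior a b :
  {ae mu, forall x : B, box a b x -> forall j, (a ord0 j < (x : E) ord0 j < b ord0 j)%R}.
Proof.
have H (j : 'I_N) :
    {ae mu, forall x : B, box a b x -> (a ord0 j < (x : E) ord0 j < b ord0 j)%R}.
  (* [upd v t] moves the j-th coordinate of a corner to [t], so the two faces orthogonal to
     direction j are themselves boxes. *)
  pose upd (v : E) (t : R) : E := (\row_i if i == j then t else v ord0 i)%R.
  exists (box a (upd b (a ord0 j)) `|` box (upd a (b ord0 j)) b : set B); split.
  - by apply: measurableU; exact: measurable_box.
  - have null (c d : E) : (c ord0 j = d ord0 j)%R -> mu (box c d) = 0.
      move=> cd.
      have [/forallP h|/forallPn[i]] := boolP [forall i, c ord0 i <= d ord0 i]%R.
        by rewrite Hmu// (bigD1 j)//= cd subrr mul0r.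
      by rewrite -ltNge => /box_empty ->; rewrite measure0.
    apply: null_set_setU; [exact: measurable_box|exact: measurable_box| |].
      by apply: null; rewrite mxE eqxx.
    by apply: null; rewrite mxE eqxx.
  - move=> x /= /not_implyP[bx /negP]; rewrite negb_and -!leNgt => /orP[h|h].
      left => i; have /andP[h1 h2] := bx i; rewrite mxE h1 /=.
      by case: eqVneq => [->|_].
    right => i; have /andP[h1 h2] := bx i; rewrite mxE h2 andbT.
    by case: eqVneq => [->|_].
by apply: ae_imp (ae_all_fin H) _ => x h bx j; exact: h.
Qed.

(** Dominated convergence, the bumps tending to 1 off the faces. *)
Lemma integral_box_eq0 (G : B -> R) a b :
  mu.-integrable (box a b) (EFin \o G) ->
  (forall k, \int[mu]_(x in (box a b : set B)) (G x * boxbump a b k x)%:E = 0) ->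
  \int[mu]_(x in (box a b : set B)) (G x)%:E = 0.
Proof.
move=> iG H0.
have mG := measurable_int _ iG.
have [] := @dominated_convergence _ B R mu (box a b) (measurable_box a b)
  (fun k x => (G x * boxbump a b k x)%:E) (EFin \o G) (abse \o EFin \o G).
- move=> k; apply/measurable_EFinP; apply: measurable_funM; first exact/measurable_EFinP.
  by apply: measurable_funTS; exact: measurable_boxbump.
- exact: mG.
- apply: ae_imp (ae_box_interior a b) _ => x h bx.
  apply: cvg_EFin; first by near=> k.
  have := cvgM (@cvg_cst _ (G x) nat \oo _) (boxbump_cvg (h bx)).
  by rewrite mulr1; exact.
- exact: integrable_abse.
- apply: aeW => x k _ /=; rewrite lee_fin normrM.
  by rewrite ler_piMr// ger0_norm ?boxbump_ge0// boxbump_le1.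
move=> _ _; rewrite (_ : [sequence _]_n = cst 0); last by apply/funext => k; exact: H0.
by move=> /cvg_lim <- //; rewrite lim_cst.
Unshelve. all: by end_near. Qed.

(** The sets whose trace on [Q] carries a zero integral form a Dynkin class that contains the
    pi-system of boxes, hence all Borel sets. *)
Lemma ae_eq0_of_integral_box (G : B -> R) c d :
  mu.-integrable (box c d) (EFin \o G) ->
  (forall a b, box a b `<=` box c d ->
     \int[mu]_(x in (box a b : set B)) (G x)%:E = 0) ->
  {ae mu, forall x : B, box c d x -> G x = 0%R}.
Proof.
move=> iG H.
have mQ := measurable_box c d; set Q : set B := box c d in iG mQ *.
have HI (a b : E) : \int[mu]_(x in box a b `&` Q) (G x)%:E = 0.
  by rewrite /Q box_setI; apply: H; rewrite -box_setI => x [].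
have HQ : \int[mu]_(x in Q) (G x)%:E = 0 by exact: H.
have H0 : forall A, <<s boxes >> A -> \int[mu]_(x in A `&` Q) (G x)%:E = 0.
  apply: (@dynkin_induction _ B boxes (fun A => \int[mu]_(x in A `&` Q) (G x)%:E = 0)).
  - exact: borel_boxes.
  - exact: setI_closed_boxes.
  - by rewrite setTI.
  - by move=> _ [a [b ->]].
  - move=> S mS S0.
    have QE : Q = (S `&` Q) `|` (~` S `&` Q) by rewrite -setIUl setUv setTI.
    have := HQ; rewrite {1}QE integral_setU//.
    + by rewrite S0 add0e.
    + exact: measurableI.
    + by apply: measurableI => //; exact: measurableC.
    + by rewrite -QE; exact: measurable_int iG.
    + by apply/disj_set2P; rewrite setIACA setICr set0I.
  - move=> F mF tF F0; rewrite setI_bigcupl integral_bigcup.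
    + by apply: eseries0 => i _ _; exact: F0.
    + exact: trivIset_setIr.
    + by move=> k; exact: measurableI.
    + rewrite -setI_bigcupl; apply: integrableS iG => //.
      by apply: measurableI => //; exact: bigcupT_measurable.
have aeQ : ae_eq mu Q (EFin \o G) (cst 0).
  have mc : measurable_fun Q (cst 0 : B -> \bar R) by exact: measurable_cst.
  refine (integral_ae_eq mQ iG mc _) => A AQ mA.
  by rewrite integral0 -(setIidl AQ); apply: H0; rewrite -borel_boxes.
by apply: ae_imp aeQ _ => x h Qx; case: (h Qx).
Qed.

(* Fundamental lemma of the calculus of variations, tested on product bumps only. *)
Lemma ae_eq0_of_integral_boxbump (G : B -> R) (U : set E) : open U ->
  (forall a b, box a b `<=` U -> mu.-integrable (box a b) (EFin \o G)) ->
  (forall a b k, box a b `<=` U ->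
     \int[mu]_(x in (box a b : set B)) (G x * boxbump a b k x)%:E = 0) ->
  {ae mu, forall x : B, U x -> G x = 0%R}.
Proof.
move=> oU iG H; have [P [a [b UE]]] := open_bigcup_box oU.
have Hk k : {ae mu, forall x : B, P k -> box (a k) (b k) x -> G x = 0%R}.
  have [Pk|nPk] := pselect (P k); last by apply: aeW => x /nPk.
  have sub : box (a k) (b k) `<=` U by rewrite UE => x bx; exists k.
  have h : {ae mu, forall x : B, box (a k) (b k) x -> G x = 0%R}.
    apply: ae_eq0_of_integral_box (iG _ _ sub) _ => c d /subset_trans /(_ sub) sub'.
    by apply: integral_box_eq0; [exact: iG|move=> n; exact: H].
  by apply: ae_imp h _ => x h _.
apply: ae_imp (ae_foralln Hk) _ => x h; rewrite UE => -[k Pk bk].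
exact: h k Pk bk.
Qed.

End FundamentalLemma.

(** * Averages along lines and difference quotients *)

Section LineIntegrals.
Context {R : realType} {N : nat}.
Notation E := 'rV[R]_N.
Notation B := (Borel R N).
Notation RR := (measurableTypeR R).
Notation leb := (@lebesgue_measure R).
Context (mu : {measure set B -> \bar R}) (Hmu : is_lebesgue mu) (i : 'I_N).
Implicit Types (a b x v : E).
Local Open Scope ereal_scope.

Definition line (x : B) (t : R) : B := ((x : E) + t *: ebasis R i)%R.

Lemma lineD (x : B) s t : line (line x s) t = line x (s + t)%R.
Proof. by rewrite /line scalerDl addrA. Qed.

Lemma measurable_line : measurable_fun setT (fun z : B * RR => line z.1 z.2 : B).
Proof.
apply: measurable_fun_Borel => j.
rewrite (_ : (fun _ => _) = (fun z : B * RR =>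
   ((z.1 : E) ord0 j + z.2 * (ebasis R i ord0 j))%R)); last first.
  by apply/funext => z; rewrite !mxE.
apply: measurable_funD; first by apply: measurableT_comp (measurable_coord j) measurable_fst.
by apply: measurable_funM => //; exact: measurable_snd.
Qed.

Lemma measurable_line1 x : measurable_fun setT (fun t : RR => line x t : B).
Proof. have h := @measurable_fun_pair2 _ _ _ B RR B _ (x : B) measurable_line. exact: h. Qed.

Lemma integral_indicE d (T : measurableType d) (m : {measure set T -> \bar R})
  (S : set T) (h : T -> R) :
  \int[m]_(t in S) (h t)%:E = \int[m]_t (h t * \1_S t)%:E.
Proof.
rewrite integral_mkcond; apply: eq_integral => t _; rewrite patchE indicE.
by case: ifP => tS; rewrite ?mulr1 ?mulr0.
Qed.

(** After the exchange of integrals, translation invariance makes the inner one independent of t. *)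
Lemma tonelli_line (F : B -> R) (S : set RR) : measurable S ->
  measurable_fun setT F -> (forall x, 0 <= F x)%R ->
  \int[mu]_x \int[leb]_(t in S) (F (line x t))%:E = leb S * \int[mu]_x (F x)%:E.
Proof.
move=> mS mF F0.
pose f (z : B * RR) := (F (line z.1 z.2) * \1_S z.2)%:E.
have mf : measurable_fun setT f.
  apply/measurable_EFinP; apply: measurable_funM.
    exact: (measurableT_comp mF measurable_line).
  by apply: (measurableT_comp (f := \1_S : RR -> R)) measurable_snd; exact: measurable_indic.
have f0 z : 0 <= f z by rewrite lee_fin mulr_ge0.
under eq_integral do rewrite integral_indicE.
have := @fubini_tonelli _ _ B RR R (sflebesgue Hmu) leb f mf f0; rewrite /f /= => ->.
under eq_integral => t _.
  under eq_integral do rewrite mulrC EFinM.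
  rewrite ge0_integralZl//; last 2 first.
  - apply/measurable_EFinP; apply: (measurableT_comp mF).
    exact: (measurable_shift (t *: ebasis R i)).
  - by move=> x _; rewrite lee_fin.
  rewrite (ge0_integral_shift Hmu _ (f := EFin \o F)); last 2 first.
  - exact/measurable_EFinP.
  - by move=> x; rewrite lee_fin.
  over.
rewrite ge0_integralZr//; last 2 first.
- by apply/measurable_EFinP; exact: measurable_indic.
- by apply: integral_ge0 => x _; rewrite lee_fin.
by rewrite integral_indic// setIT.
Qed.

(** Fubini on the product with [S], obtained by inserting the indicator of [S] in the second
    variable; only one iterated integral of the absolute value has to be shown finite. *)
Lemma fubini_slab (f : B * RR -> R) (S : set RR) : measurable S ->
  measurable_fun setT f ->
  \int[mu]_x \int[leb]_(t in S) `|f (x, t)|%:E < +oo ->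
  [/\ mu.-integrable setT (fun x => \int[leb]_(t in S) (f (x, t))%:E),
     {ae mu, forall x : B, leb.-integrable S (fun t => (f (x, t))%:E)} &
     \int[mu]_x \int[leb]_(t in S) (f (x, t))%:E =
     \int[leb]_(t in S) \int[mu]_x (f (x, t))%:E].
Proof.
move=> mS mf fi.
pose g (z : B * RR) := (f z * \1_S z.2)%:E.
have mg : measurable_fun setT g.
  apply/measurable_EFinP; apply: measurable_funM => //.
  by apply: (measurableT_comp (f := \1_S : RR -> R)) measurable_snd; exact: measurable_indic.
have gi : (sflebesgue Hmu \x leb).-integrable setT g.
  apply: (proj2 (@integrable12ltyP _ _ B RR R (sflebesgue Hmu) leb g mg)); rewrite /g /=.
  under eq_integral do under eq_integral do rewrite normrM (ger0_norm (_ : 0 <= \1_S _)%R)//.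
  by under eq_integral do rewrite -(integral_indicE leb S (fun t => `|f (_, t)|%R)).
split.
- apply: eq_integrable (integrable_fubini_F gi) => // x _.
  by rewrite (integral_indicE leb S (fun t => f (x, t))).
- apply: ae_imp (ae_integrable1 gi) _ => x /= H.
  apply/integrable_mkcond => //; apply: eq_integrable H => // t _.
  by rewrite /g /= patchE indicE; case: ifP => tS; rewrite ?mulr1 ?mulr0.
- under eq_integral do rewrite (integral_indicE leb S (fun t => f (_, t))).
  have := Fubini gi; rewrite /g /= => ->.
  rewrite [RHS]integral_mkcond; apply: eq_integral => t _; rewrite patchE indicE.
  case: ifP => tS; first by under eq_integral do rewrite mulr1.
  by under eq_integral do rewrite mulr0; rewrite integral0.
Qed.

Lemma ae_integrable_line (G : B -> R) (S : set RR) : measurable S -> leb S < +oo ->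
  mu.-integrable setT (EFin \o G) ->
  {ae mu, forall x : B, leb.-integrable S (fun t => (G (line x t))%:E)}.
Proof.
move=> mS lS iG; have /integrableP[/measurable_EFinP mG fG] := iG.
have mf := measurableT_comp mG measurable_line.
have [//|_ H _] := fubini_slab mS mf.
  rewrite (tonelli_line mS (F := fun x => `|G x|%R))//; last exact: measurableT_comp.
  by apply: lte_mul_pinfty => //; rewrite ge0_fin_numE.
exact: H.
Qed.

(** The Steklov average without the factor 1/h. Being a real integral, it takes the default value 0
    where the extended integral is infinite, so its identification with the latter in [steklovE]
    holds almost everywhere only. *)
Definition steklov (h : R) (G : B -> R) (x : B) : R :=
  (\int[leb]_(t in `[0, h]) G (line x t))%R.

Lemma leb_seg (h : R) : (0 <= h)%R -> leb `[0%R, h] = h%:E.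
Proof.
rewrite le_eqVlt lebesgue_measure_itv /= lte_fin => /predU1P[<-|->].
  by rewrite ltxx.
by rewrite oppr0 adde0.
Qed.

Section Steklov.
Context (h : R) (h0 : (0 <= h)%R) (G : B -> R).
Hypothesis iG : mu.-integrable setT (EFin \o G).

Let mG : measurable_fun setT G.
Proof. by apply/measurable_EFinP; exact: (measurable_int mu). Qed.

Let fubini_phi (phi : B -> R) (M : R) : measurable_fun setT phi -> (forall x, `|phi x| <= M)%R ->
  \int[mu]_x \int[leb]_(t in `[0%R, h]) `|phi x * G (line x t)|%:E < +oo.
Proof.
move=> mphi Mphi.
have M0 : (0 <= M)%R by apply: le_trans (Mphi 0%R).
apply: (@le_lt_trans _ _ (\int[mu]_x \int[leb]_(t in `[0%R, h]) (M * `|G (line x t)|)%:E)).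
  have H (f : B * RR -> R) : measurable_fun setT f -> (forall z, 0 <= f z)%R ->
      measurable_fun setT (fun x : B => \int[leb]_(t in `[0%R, h]) (f (x, t))%:E).
    move=> mf f0; pose g (z : B * RR) := (f z * \1_(`[0%R, h]%classic : set RR) z.2)%:E.
    apply: eq_measurable_fun (measurable_fun_fubini_tonelli_F (m2 := leb) g _ _).
    - by move=> x _; rewrite (integral_indicE leb _ (fun t => f (x, t))).
    - apply/measurable_EFinP; apply: measurable_funM => //.
      apply: (measurableT_comp (f := \1_(`[0%R, h]%classic : set RR) : RR -> R)) measurable_snd.
      exact: measurable_indic.
    - by move=> z; rewrite lee_fin mulr_ge0.
  have mGl := measurableT_comp mG measurable_line.
  apply: ge0_le_integral => //.
  - by move=> x _; apply: integral_ge0 => t _; rewrite lee_fin.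
  - apply: (H (fun z => `|phi z.1 * G (line z.1 z.2)|%R)) => //.
    apply: measurableT_comp => //; apply: measurable_funM => //.
    exact: measurableT_comp mphi measurable_fst.
  - apply: (H (fun z => M * `|G (line z.1 z.2)|)%R) => //.
      by apply: measurable_funM => //; apply: measurableT_comp.
    by move=> z; rewrite mulr_ge0.
  - move=> x _; apply: ge0_le_integral => //.
    + apply/measurable_EFinP/measurable_funTS; apply: measurableT_comp => //.
      by apply: measurable_funM => //; apply: measurableT_comp mG (measurable_line1 x).
    + apply/measurable_EFinP/measurable_funTS; apply: measurable_funM => //.
      by apply: measurableT_comp => //; apply: measurableT_comp mG (measurable_line1 x).
    + by move=> t _; rewrite lee_fin normrM ler_wpM2r.
rewrite (tonelli_line (measurable_itv _) (F := fun x => M * `|G x|)%R); last 2 first.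
- by apply: measurable_funM => //; apply: measurableT_comp.
- by move=> x; rewrite mulr_ge0.
rewrite leb_seg//; apply: lte_mul_pinfty => //.
under eq_integral do rewrite EFinM.
rewrite ge0_integralZl//; last by apply/measurable_EFinP; exact: measurableT_comp.
by apply: lte_mul_pinfty => //; case/integrableP : iG.
Qed.

Lemma steklovE : {ae mu, forall x : B,
  leb.-integrable `[0%R, h] (fun t => (G (line x t))%:E) /\
  (steklov h G x)%:E = \int[leb]_(t in `[0%R, h]) (G (line x t))%:E}.
Proof.
have H : {ae mu, forall x : B, leb.-integrable `[0%R, h] (fun t => (G (line x t))%:E)}.
  by apply: ae_integrable_line => //; rewrite leb_seg// ltry.
apply: ae_imp H _ => x H; split=> //; rewrite /steklov /Rintegral fineK//.
exact: integrable_fin_num.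
Qed.

Lemma integrable_steklov : mu.-integrable setT (EFin \o steklov h G).
Proof.
have mf := measurableT_comp mG measurable_line.
have m1 : measurable_fun setT (fun z : B * RR => (1 * G (line z.1 z.2))%R).
  exact: measurable_funM.
have mc : measurable_fun setT (cst 1%R : B -> R) by exact: measurable_cst.
have n1 (x : B) : (`|cst 1 x| <= 1 :> R)%R by rewrite normr1.
have [H _ _] := fubini_slab (measurable_itv _) m1 (fubini_phi mc n1).
have H' : mu.-integrable setT (fun x : B => \int[leb]_(t in `[0%R, h]) (G (line x t))%:E).
  by apply: eq_integrable H => // x _; apply: eq_integral => t _; rewrite /= mul1r.
have mst : measurable_fun setT (EFin \o steklov h G).
  apply/measurable_EFinP; apply: (measurableT_comp (f := fine)) => //.
  exact: measurable_int H'.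
apply: (le_integrable _ mst _ (integrable_abse H')) => // x _.
rewrite /= /steklov /Rintegral abse_id.
by case: (\int[leb]_(t in _) _) => //=; rewrite ?normr0 ?leey.
Qed.

(** The adjoint of averaging forwards is averaging backwards: Fubini and a translation along e_i
    move the average from [G] to [phi]. *)
Lemma integral_steklov (phi : B -> R) (M : R) :
  measurable_fun setT phi -> (forall x, `|phi x| <= M)%R ->
  \int[mu]_x (phi x * steklov h G x)%:E =
  \int[mu]_x (G x * \int[leb]_(t in `[0, h]) phi (line x (- t)))%:E.
Proof.
move=> mphi Mphi.
have m1 : measurable_fun setT (fun z : B * RR => (phi z.1 * G (line z.1 z.2))%R).
  apply: measurable_funM; first exact: measurableT_comp mphi measurable_fst.
  exact: measurableT_comp mG measurable_line.
have mopp : measurable_fun setT (fun z : B * RR => line z.1 (- z.2)%R).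
  apply: (measurableT_comp measurable_line (g := fun z : B * RR => (z.1, (- z.2)%R : RR))).
  by apply: measurable_fun_pair => //; apply: measurableT_comp.
have m2 : measurable_fun setT (fun z : B * RR => (G z.1 * phi (line z.1 (- z.2)))%R).
  apply: measurable_funM; first exact: measurableT_comp mG measurable_fst.
  exact: measurableT_comp mphi mopp.
have M0 : (0 <= M)%R by apply: le_trans (Mphi 0%R).
have f2 : \int[mu]_x \int[leb]_(t in `[0%R, h]) `|G x * phi (line x (- t))|%:E < +oo.
  apply: (@le_lt_trans _ _ (\int[mu]_x (`|G x| * (M * h))%:E)).
    apply: ge0_le_integral => //.
    - by move=> x _; apply: integral_ge0 => t _; rewrite lee_fin.
    - pose g (z : B * RR) := (`|G z.1 * phi (line z.1 (- z.2))| * \1_(`[0%R, h]%classic : set RR) z.2)%:E.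
      apply: eq_measurable_fun (measurable_fun_fubini_tonelli_F (m2 := leb) g _ _).
      + by move=> x _; rewrite (integral_indicE leb _ (fun t => `|G x * phi (line x (- t))|%R)).
      + apply/measurable_EFinP; apply: measurable_funM; first exact: measurableT_comp.
        apply: (measurableT_comp (f := \1_(`[0%R, h]%classic : set RR) : RR -> R)) measurable_snd.
        exact: measurable_indic.
      + by move=> z; rewrite lee_fin mulr_ge0.
    - apply/measurable_EFinP; apply: measurable_funM => //; exact: measurableT_comp.
    - move=> x _; apply: (@le_trans _ _ (\int[leb]_(t in `[0%R, h]) (cst (`|G x| * M)%:E) t)).
        apply: ge0_le_integral => //.
        + apply/measurable_EFinP/measurable_funTS; apply: measurableT_comp => //.
          exact: (measurableT_comp m2 (pair1_measurable (x : B))).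
        + by move=> t _; rewrite lee_fin normrM ler_wpM2l.
      by rewrite integral_cst//= leb_seg// -EFinM mulrA.
  under eq_integral do rewrite EFinM.
  rewrite ge0_integralZr//; last 2 first.
    by apply/measurable_EFinP; exact: measurableT_comp.
    by rewrite lee_fin mulr_ge0.
  apply: lte_mul_pinfty => //; first exact: integral_ge0.
    rewrite ge0_fin_numE; first by case/integrableP : iG.
    exact: integral_ge0.
  by rewrite ltry.
have [_ _ e1] := fubini_slab (measurable_itv _) m1 (fubini_phi mphi Mphi).
have [i2 a2 e2] := fubini_slab (measurable_itv _) m2 f2.
transitivity (\int[mu]_x \int[leb]_(t in `[0%R, h]) (phi x * G (line x t))%:E).
  apply: ae_eq_integral => //.
  - apply/measurable_EFinP; apply: measurable_funM => //.
    by apply/measurable_EFinP; exact: measurable_int integrable_steklov.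
  - by have [/measurable_int] := fubini_slab (measurable_itv _) m1 (fubini_phi mphi Mphi).
  - apply: ae_imp steklovE _ => x [ix Ex] _.
    rewrite EFinM Ex -integralZl//.
rewrite e1; transitivity (\int[leb]_(t in `[0%R, h]) \int[mu]_x (G x * phi (line x (- t)))%:E).
  apply: eq_integral => t _.
  rewrite -(integral_shift Hmu (t *: ebasis R i) (f := fun x => (G x * phi (line x (- t)))%:E)).
    apply: eq_integral => x _; rewrite mulrC.
    by congr (_ * phi _)%:E; rewrite /line scaleNr addrK.
  have ms : measurable_fun setT (fun x : B => line x (- t)).
    by have := measurable_shift (- t *: ebasis R i); exact.
  apply: (@le_integrable _ _ _ mu _ measurableT _ (fun x => (M%:E * (G x)%:E))).
  - by apply/measurable_EFinP; apply: measurable_funM => //; exact: measurableT_comp mphi ms.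
  - move=> x _; rewrite -EFinM lee_fin !normrM mulrC ler_wpM2r// (le_trans (Mphi _))//.
    exact: ler_norm.
  - exact: integrableZl.
rewrite -e2; apply: eq_integral => x _.
have iphi : leb.-integrable `[0%R, h] (EFin \o (fun t => phi (line x (- t)))).
  apply: measurable_bounded_integrable => //; first by rewrite /= leb_seg// ltry.
    apply: measurable_funTS.
    exact: (measurableT_comp (measurableT_comp mphi mopp) (pair1_measurable (x : B))).
  by exists M; split; [exact: num_real|move=> y My t _; exact: le_trans (Mphi _) (ltW My)].
rewrite /Rintegral EFinM fineK ?(integrable_fin_num _ iphi)//.
by rewrite -integralZl.
Qed.

End Steklov.

End LineIntegrals.

(** * Moving averages of bumps *)

Section BumpPrimitive.
Context {R : realType}.
Notation RR := (measurableTypeR R).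
Notation leb := (@lebesgue_measure R).
Implicit Types (a b s h : R) (k : nat).

Lemma smooth_cst (c : R) : smooth (cst c : R -> R).
Proof.
apply: (@smooth_coind _ (range (fun c : R => (cst c : R -> R)))); last by exists c.
move=> _ [d _ <-]; exists (cst 0 : R -> R); first by exists 0.
by move=> x; exact: is_derive_cst.
Qed.

Lemma integrable_bump a b k : leb.-integrable setT (EFin \o bump a b k).
Proof.
have -> : (EFin \o bump a b k) = ((EFin \o bump a b k) \_ `[a, b]).
  apply/funext => t; rewrite patchE; case: ifPn => //; rewrite notin_setE /= in_itv /=.
  move=> /negP h; rewrite bump_out//; apply: contraNN h => /andP[h1 h2]; by rewrite !ltW.
apply/(integrable_mkcond _ _).1 => //.
apply: measurable_bounded_integrable => //=.
- have [ab|ab] := leP a b; last by rewrite set_itv_ge ?measure0// bnd_simp -ltNge.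
  by rewrite lebesgue_measure_itv /=; case: ifP => _; rewrite ltry.
- by apply: measurable_funTS; apply: continuous_measurable_fun;
    exact/smooth_continuous/smooth_bump.
- exists 1; split; [exact: num_real|move=> y y1 t _].
  by rewrite /= ger0_norm ?bump_ge0// (le_trans (bump_le1 _ _ _ _))// ltW.
Qed.

Lemma bump_primitive a b k : exists P : R -> R,
  forall s, is_derive s (1 : R) P (bump a b k s).
Proof.
exists (fun s => \int[leb]_(t in `]-oo, s]) bump a b k t) => s.
have s1 : s < s + 1 by rewrite ltrDl.
have ib : leb.-integrable `]-oo, s + 1] (EFin \o bump a b k).
  by apply: integrableS (integrable_bump a b k).
have [dP dPE] := @continuous_FTC1 R (bump a b k) -oo%O s (s + 1) s1 ib
  (ltNyr _) (smooth_continuous (smooth_bump a b k) (x:=s)).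
by apply: DeriveDef; [exact: dP|rewrite -derive1E dPE].
Qed.

(** [A] is P(s) - P(s - h) for a primitive P of the bump. That its derivative is a plain difference
    of bumps is what lets a weak derivative, tested against such averages, produce difference
    quotients. *)
Lemma steklov_bump a b k h : 0 < h -> exists A : R -> R,
  [/\ smooth A,
      forall s, is_derive s (1 : R) A (bump a b k s - bump a b k (s - h)) &
      forall s, A s = \int[leb]_(t in `[0, h]) bump a b k (s - t)].
Proof.
move=> h0; have [P dP] := bump_primitive a b k.
have dshift s c : is_derive s (1 : R) (fun s => P (s - c)) (bump a b k (s - c)).
  have d1 : is_derive s (1 : R) (fun s : R => s - c) 1.
    apply: (@is_derive_eq _ _ _ ((id : R -> R) - cst c)).
    by rewrite subr0.
  have := @is_derive1_comp R P (fun s : R => s - c) s _ _ (dP _) d1.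
  by rewrite mulr1.
have dA s : is_derive s (1 : R) (fun s => P s - P (s - h)) (bump a b k s - bump a b k (s - h)).
  exact: is_deriveB (dP s) (dshift s h).
exists (fun s => P s - P (s - h)); split=> //.
  apply: (smooth_primitive dA).
  have -> : (fun x => bump a b k x - bump a b k (x - h)) =
      (fun x => bump a b k x + cst (-1) x * bump a b k (1 * x + (- h))).
    by apply/funext => x; rewrite mulN1r mul1r.
  apply: smoothD; first exact: smooth_bump.
  apply: smoothM; first exact: smooth_cst.
  exact/smooth_affine/smooth_bump.
move=> s.
have dF t : is_derive t (1 : R) (fun t => - P (s - t)) (bump a b k (s - t)).
  have d1 : is_derive t (1 : R) (fun t : R => s - t) (-1).
    apply: (@is_derive_eq _ _ _ (cst s - (id : R -> R))).
    by rewrite sub0r.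
  have d2 := @is_derive1_comp R P (fun t : R => s - t) t _ _ (dP _) d1.
  have := is_deriveN d2; by rewrite mulrN1 opprK.
have cF : continuous (fun t => - P (s - t)).
  by move=> t; apply/differentiable_continuous/derivable1_diffP; case: (dF t).
have cb : continuous (fun t => bump a b k (s - t)).
  move=> t; apply: (@continuous_comp _ _ _ (fun t : R => s - t) (bump a b k)).
    by apply: continuousB; [exact: cst_continuous|exact: cvg_id].
  exact/smooth_continuous/smooth_bump.
rewrite /Rintegral (@continuous_FTC2 R (fun t => bump a b k (s - t)) (fun t => - P (s - t)) 0 h)//=.
- by rewrite opprK subr0 addrC.
- exact: continuous_subspaceT.
- split.
  + by move=> t _; case: (dF t).
  + exact/cvg_at_right_filter/cF.
  + exact/cvg_at_left_filter/cF.
- by move=> t _; rewrite derive1E; case: (dF t).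
Qed.

End BumpPrimitive.

Section RealIntegrable.
Context d (T : measurableType d) (R : realType) (mu : {measure set T -> \bar R}).
Context (D : set T) (mD : measurable D) (f g : T -> R).
Hypotheses (iF : mu.-integrable D (EFin \o f)) (iG : mu.-integrable D (EFin \o g)).

Lemma integrableD_EFin : mu.-integrable D (EFin \o (fun x => f x + g x)).
Proof. by apply: eq_integrable (integrableD mD iF iG). Qed.

Lemma integrableB_EFin : mu.-integrable D (EFin \o (fun x => f x - g x)).
Proof. by apply: eq_integrable (integrableB mD iF iG). Qed.

Lemma integrableZl_EFin (k : R) : mu.-integrable D (EFin \o (fun x => k * f x)).
Proof. by apply: eq_integrable (integrableZl mD k iF). Qed.

End RealIntegrable.

(** * Differences of a function as averages of its weak derivative *)

Section DifferenceQuotient.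
Context {R : realType} {N : nat}.
Notation E := 'rV[R]_N.
Notation B := (Borel R N).
Notation leb := (@lebesgue_measure R).
Context (mu : {measure set B -> \bar R}) (Hmu : is_lebesgue mu).
Context (Om : set E) (oOm : open Om) (i : 'I_N) (D : set E) (cD : compact D) (DOm : D `<=` Om).
Context (u g : B -> R).
Hypotheses (iu : mu.-integrable (D : set B) (EFin \o u))
  (ig : mu.-integrable (D : set B) (EFin \o g))
  (W : forall phi, test_fun Om phi ->
     (\int[mu]_(x in (Om : set B)) (u x * partial i phi x)%:E =
      - \int[mu]_(x in (Om : set B)) (g x * phi x)%:E)%E).

(** Extension by 0 outside a compact set makes u and g integrable on the whole space, where
    translations act and Fubini is available. *)
Definition cutoff (D : set B) (f : B -> R) (x : B) : R := f x * \1_D x.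

Let mD : measurable (D : set B).
Proof. by apply: closed_measurableB; apply: (compact_closed (@norm_hausdorff R _) cD). Qed.

Lemma integrable_cutoff (f : B -> R) : mu.-integrable (D : set B) (EFin \o f) ->
  mu.-integrable setT (EFin \o cutoff D f).
Proof.
move=> /(integrable_mkcond _ mD) H; apply: eq_integrable H => // x _.
by rewrite patchE /cutoff /= indicE; case: ifP => _; rewrite ?mulr1 ?mulr0.
Qed.

Lemma integral_cutoff (f p : B -> R) : (forall x, ~ D x -> p x = 0) ->
  (\int[mu]_x (cutoff D f x * p x)%:E = \int[mu]_(x in (Om : set B)) (f x * p x)%:E)%E.
Proof.
move=> p0; rewrite [RHS]integral_indicE; apply: eq_integral => x _.
rewrite /cutoff !indicE; have [Dx|nDx] := pselect (D x).
  by rewrite !mem_set//; [rewrite !mulr1|exact: DOm].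
by rewrite p0// !mulr0 mul0r.
Qed.

Lemma weak_cutoff (phi : E -> R) : test_fun Om phi ->
  (forall x, ~ D x -> phi x = 0) -> (forall x, ~ D x -> partial i phi x = 0) ->
  \int[mu]_x (cutoff D u x * partial i phi x) = - \int[mu]_x (cutoff D g x * phi x).
Proof.
move=> tphi phi0 dphi0.
by rewrite /Rintegral (integral_cutoff u)// (integral_cutoff g)// W// fineN.
Qed.

Lemma integrableM_bounded (f p : B -> R) (M : R) :
  mu.-integrable setT (EFin \o f) -> measurable_fun setT p -> (forall x, `|p x| <= M) ->
  mu.-integrable setT (fun x => (f x * p x)%:E).
Proof.
move=> iF mp pM.
have mf : measurable_fun setT f by apply/measurable_EFinP; exact: measurable_int iF.
apply: (@le_integrable _ _ _ mu _ measurableT _ (fun x => (M%:E * (f x)%:E)%E)).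
- by apply/measurable_EFinP; exact: measurable_funM.
- move=> x _; rewrite -EFinM lee_fin !normrM mulrC ler_wpM2r// (le_trans (pM _))//.
  exact: ler_norm.
- exact: integrableZl.
Qed.

Lemma coord_line' (x : E) (t : R) (j : 'I_N) :
  (line i x t : E) ord0 j = if j == i then x ord0 i + t else x ord0 j.
Proof.
rewrite !mxE eqxx /=; have [->|_] := eqVneq j i; first by rewrite mulr1.
by rewrite mulr0 addr0.
Qed.

Lemma sweep_box (a b : E) (h : R) (U : set E) : 0 <= h -> box a b !=set0 ->
  (forall x t, U x -> 0 <= t <= h -> D (line i x t)) -> box a b `<=` U ->
  box a (\row_j (b ord0 j + (if j == i then h else 0))) `<=` D.
Proof.
move=> h0 [z bz] UD bU y Hy.
(* The least shift back that returns [y] to [box a b]. As the box is nonempty, a_i <= b_i and the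
   shift does not overshoot. *)
pose t := Num.max 0 (y ord0 i - b ord0 i).
have ht : 0 <= t <= h.
  rewrite /t le_max lexx /= ge_max h0 /=.
  by have := Hy i; rewrite !mxE eqxx => /andP[_]; rewrite lerBlDl.
have Hx : box a b (line i y (- t)).
  move=> j; rewrite coord_line'; case: eqVneq => [->|ji].
    have /andP[z1 z2] := bz i; have := Hy i; rewrite !mxE eqxx => /andP[y1 y2].
    have : t = 0 /\ y ord0 i <= b ord0 i \/ t = y ord0 i - b ord0 i.
      rewrite /t; case: (leP (y ord0 i - b ord0 i) 0) => [h1|_]; last by right.
      by left; split => //; rewrite -subr_le0.
    by move=> [[-> h1]| ->]; apply/andP; split; lra.
  by have := Hy j; rewrite !mxE (negbTE ji) addr0.
have := UD _ _ (bU _ Hx) ht; rewrite lineD addNr.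
by rewrite /line scale0r addr0.
Qed.

(** The test function is the backward moving average psi of the bump phi in direction i, with
    partial i psi = phi - phi(. - h e_i). The weak formulation becomes int u (phi - phi(. - h e_i))
    = - int g psi; a translation on the left and [integral_steklov] on the right leave phi as common
    factor. *)
Lemma diff_quotient_bump (a b : E) (h : R) (U : set E) k : 0 < h ->
  (forall x t, U x -> 0 <= t <= h -> D (line i x t)) -> box a b `<=` U ->
  (\int[mu]_(x in (box a b : set B))
    ((cutoff D u (line i x h) - cutoff D u x - steklov i h (cutoff D g) x) *
      boxbump a b k x)%:E = 0)%E.
Proof.
move=> h0 UD bU.
have [->|/set0P b0] := eqVneq (box a b) set0; first by rewrite integral_set0.
have [A [sA dA AE]] := steklov_bump (a ord0 i) (b ord0 i) k h0.
(* Averaging the product bump along e_i averages its i-th factor and leaves the others alone. *)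
pose f j : R -> R := if j == i then A else bump (a ord0 j) (b ord0 j) k.
pose b' : E := \row_j (b ord0 j + (if j == i then h else 0)).
have b'D : box a b' `<=` D by apply: sweep_box (ltW h0) b0 UD bU.
have f0 j t : ~~ (a ord0 j <= t <= b' ord0 j) -> f j t = 0.
  rewrite /f mxE; case: eqVneq => [->|_] H.
    rewrite AE; transitivity (\int[leb]_(t in `[0, h]) (cst 0 t)); last first.
      by rewrite Rintegral_cst// mul0r.
    apply: eq_Rintegral => s; rewrite inE /= in_itv /= => /andP[s0 sh]; apply: bump_out.
    by apply: contraNN H => /andP[h1 h2]; apply/andP; split; lra.
  rewrite addr0 in H; apply: bump_out.
  by apply: contraNN H => /andP[h1 h2]; rewrite !ltW.
have tpsi : test_fun Om (tensor f).
  apply: test_fun_tensor f0 _ => [j|]; last exact: subset_trans DOm.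
  by rewrite /f; case: ifP => _ //; exact: smooth_bump.
pose phi := boxbump a b k.
have mphi : measurable_fun setT (phi : B -> R) by exact: measurable_boxbump.
have phi1 (x : B) : `|phi x| <= 1 by rewrite ger0_norm ?boxbump_ge0 ?boxbump_le1.
pose c (x : E) : R := \prod_(j | j != i) bump (a ord0 j) (b ord0 j) k (x ord0 j).
have phiE (x : E) t : phi (line i x t) = c x * bump (a ord0 i) (b ord0 i) k (x ord0 i + t).
  rewrite /phi /boxbump /tensor (bigD1 i)//= coord_line' eqxx mulrC; congr (_ * _).
  by apply: eq_bigr => j ji; rewrite coord_line' (negbTE ji).
have line0 (x : E) : line i x 0 = x by rewrite /line scale0r addr0.
have fE (x : E) (F : R -> R) :
    tensor (fun j => if j == i then F else f j) x = c x * F (x ord0 i).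
  rewrite /tensor (bigD1 i)//= eqxx mulrC; congr (_ * _).
  by apply: eq_bigr => j ji; rewrite /f (negbTE ji).
have dpsi (x : E) : partial i (tensor f) x = phi x - phi (line i x (- h)).
  have dfi (t : R) : is_derive t (1 : R) (f i)
      (bump (a ord0 i) (b ord0 i) k t - bump (a ord0 i) (b ord0 i) k (t - h)).
    by rewrite /f eqxx; exact: dA.
  have := phiE x 0; rewrite line0 addr0 => ->.
  by rewrite (partial_tensorE x dfi) fE phiE mulrBr.
have psiE (x : E) : tensor f x = \int[leb]_(t in `[0, h]) phi (line i x (- t)).
  have -> : f = (fun j => if j == i then A else f j).
    by apply/funext => j; rewrite /f; case: eqVneq.
  rewrite fE AE -RintegralZl//; first by apply: eq_Rintegral => t _; rewrite phiE.
  apply: continuous_compact_integrable; first exact: segment_compact.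
  apply: continuous_subspaceT => t.
  apply: (@continuous_comp _ _ _ (fun t : R => x ord0 i - t)).
    by apply: continuousB; [exact: cst_continuous|exact: cvg_id].
  exact/smooth_continuous/smooth_bump.
have Wpsi := weak_cutoff tpsi.
have psi0 x : ~ D x -> tensor f x = 0.
  by move=> nDx; apply: (tensor_support f0) => /b'D.
have dpsi0 x : ~ D x -> partial i (tensor f) x = 0.
  have hh : (0 : R) <= h <= h by rewrite lexx ltW.
  have h00 : 0 <= (0 : R) <= h by rewrite lexx ltW.
  move=> nDx; rewrite dpsi /phi !boxbump_out ?subrr// => H; apply: nDx.
    by have := UD _ _ (bU _ H) hh; rewrite lineD addNr line0.
  by have := UD _ _ (bU _ H) h00; rewrite line0.
have iU := integrable_cutoff iu; have iG := integrable_cutoff ig.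
have mshift t : measurable_fun setT (fun x : B => line i x t).
  exact: (measurable_shift (t *: ebasis R i)).
have mphish : measurable_fun setT (fun x : B => phi (line i x (- h)) : R).
  exact: measurableT_comp mphi (mshift _).
have iUphi := integrableM_bounded iU mphi phi1.
have iUphish := integrableM_bounded iU mphish (fun x => phi1 _).
have iUsh : mu.-integrable setT (EFin \o (fun x => cutoff D u (line i x h))).
  exact: (integrable_shift Hmu (h *: ebasis R i) iU).
have iUshphi := integrableM_bounded iUsh mphi phi1.
have iSt := integrable_steklov Hmu i (ltW h0) iG.
have iStphi := integrableM_bounded iSt mphi phi1.
have e1 : \int[mu]_x (cutoff D u x * phi x) - \int[mu]_x (cutoff D u x * phi (line i x (- h)))
    = - \int[mu]_x (cutoff D g x * tensor f x).
  rewrite -(Wpsi psi0 dpsi0) -RintegralB//.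
  by apply: eq_Rintegral => x _; rewrite dpsi mulrBr.
have e2 : \int[mu]_x (cutoff D u x * phi (line i x (- h))) =
    \int[mu]_x (cutoff D u (line i x h) * phi x).
  rewrite /Rintegral -(integral_shift Hmu (h *: ebasis R i) iUphish).
  congr fine; apply: eq_integral => x _.
  by rewrite -/(line i x h) lineD subrr line0.
have e3 : \int[mu]_x (cutoff D g x * tensor f x) = \int[mu]_x (steklov i h (cutoff D g) x * phi x).
  under eq_Rintegral do rewrite psiE.
  rewrite /Rintegral -(integral_steklov Hmu i (ltW h0) iG mphi phi1).
  by congr fine; apply: eq_integral => x _; rewrite mulrC.
rewrite integral_indicE.
transitivity (\int[mu]_x (((cutoff D u (line i x h) * phi x - cutoff D u x * phi x) -
    steklov i h (cutoff D g) x * phi x))%:E)%E.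
  apply: eq_integral => x _; rewrite indicE -/phi !mulrBl.
  have [bx|nbx] := pselect (box a b x); first by rewrite mem_set// !mulr1.
  have -> : phi x = 0 by exact: boxbump_out.
  by rewrite !(mulr0, mul0r, subr0).
rewrite integralB_EFin//; last exact: integrableB_EFin.
rewrite integralB_EFin//.
have toR (F : B -> R) : mu.-integrable setT (fun x => (F x)%:E) ->
    (\int[mu]_x (F x)%:E = (\int[mu]_x F x)%:E)%E.
  by move=> iF; rewrite /Rintegral fineK// integrable_fin_num.
rewrite !toR// -!EFinB; congr EFin.
move: e1; rewrite e2 e3 -[X in X = _ -> _]opprB => /oppr_inj ->; exact: subrr.
Qed.

End DifferenceQuotient.

(** * Lebesgue differentiation on the real line and along coordinate lines *)

Section LineDifferentiation1D.
Context {R : realType}.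
Notation RR := (measurableTypeR R).
Notation leb := (@lebesgue_measure R).

Lemma lebesgue_measure_shift (s : R) (A : set RR) : measurable A ->
  leb ((fun t : R => s + t) @^-1` A) = leb A.
Proof.
have ms : measurable_fun setT ((fun t : R => s + t) : RR -> RR).
  by apply: measurable_funD; [exact: measurable_cst|exact: measurable_id].
move=> mA; apply/esym.
rewrite -[RHS]/(pushforward leb ((fun t : R => s + t) : RR -> RR) A).
apply: lebesgue_measure_unique => //= _ [[a b]] _ <-.
rewrite /= /pushforward (_ : _ @^-1` _ = `]a - s, b - s]%classic).
  rewrite !lebesgue_measure_itv/= !lte_fin ltrD2r; case: ifP => // _.
  by rewrite -!EFinB; congr EFin; ring.
by apply/seteqP; split => t; rewrite /= !in_itv /= ltrBlDl lerBrDl.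
Qed.

Lemma integral_shift1 (s : R) (f : R -> R) : leb.-integrable setT (EFin \o f) ->
  \int[leb]_t f (s + t) = \int[leb]_t f t.
Proof.
have ms : measurable_fun setT ((fun t : R => s + t) : RR -> RR).
  by apply: measurable_funD; [exact: measurable_cst|exact: measurable_id].
move=> iF; rewrite /Rintegral; congr fine.
have iF' : leb.-integrable setT ((EFin \o f) \o (fun t : R => s + t)).
  have /integrableP[mF fF] := iF; apply/integrableP; split.
    exact: measurableT_comp mF ms.
  move: fF; congr (_ < _)%E.
  rewrite -[RHS](@ge0_integral_pushforward _ _ RR RR R _ ms leb setT (abse \o (EFin \o f)))//.
    apply: eq_measure_integral => // A mA _; exact/esym/lebesgue_measure_shift.
    exact: measurableT_comp.
  by move=> y _; exact: abse_ge0.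
rewrite -[LHS](@integral_pushforward _ _ RR RR R _ ms leb setT (EFin \o f) (measurable_int _ iF) iF')//.
by apply: eq_measure_integral => // A mA _; exact: lebesgue_measure_shift.
Qed.

(** The indefinite integral from -oo is differentiable almost everywhere with derivative [f]; the
    averages are its difference quotients for the steps 1/(n+1). *)
Lemma ae_cvg_average (f : R -> R) : leb.-integrable setT (EFin \o f) ->
  {ae leb, forall s : R, (n.+1%:R * \int[leb]_(t in `[0%R, n.+1%:R^-1]) f (s + t)) @[n --> \oo] --> f s}.
Proof.
move=> iF.
have iI (I : interval R) : leb.-integrable [set` I] (EFin \o f).
  exact: (@integrableS _ _ _ leb setT _ _ measurableT (measurable_itv I) _ iF).
have locf : locally_integrable setT f.
  split; [|exact: openT|].
    by apply/measurable_EFinP; exact: measurable_int iF.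
  move=> K _ cK; have mK := compact_measurable cK.
  by have /integrableP[] := @integrableS _ _ _ leb setT _ _ measurableT mK (@subsetT _ _) iF.
have := FTC1Ny (fun y => iI _) locf; set F := fun x => _ => aeF.
apply: ae_imp aeF _ => s [dF Fs].
have FE (h : R) : 0 < h -> F (h + s) - F s = \int[leb]_(t in `[0%R, h]) f (s + t).
  move=> h0; rewrite /F Rintegral_itvB//; last by rewrite bnd_simp lerDr ltW.
  have E (S : set R) (q : R -> R) : \int[leb]_(t in S) q t = \int[leb]_t (q t * \1_S t).
    by rewrite /Rintegral integral_indicE.
  rewrite (Rintegral_itv_obnd_cbnd (iI _)).
  rewrite (E `[s, (h + s)]%classic) (E `[0, h]%classic) -(integral_shift1 s).
    apply: eq_Rintegral => t _; congr (_ * _); rewrite !indicE; congr (nat_of_bool _)%:R.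
    by apply/idP/idP; rewrite !inE /= !in_itv /= => /andP[h1 h2]; apply/andP; split; lra.
  have := proj1 (@integrable_mkcond _ RR R leb `[s, (h + s)]%classic (EFin \o f) (measurable_itv _)) (iI _).
  apply: eq_integrable => // t _; rewrite patchE /= indicE.
  by case: ifP => _; rewrite ?mulr1 ?mulr0.
have H : h^-1 *: (F (h *: 1 + s) - F s) @[h --> 0^'] --> f s.
  by rewrite -Fs derive1E; exact: dF.
have hn : (n.+1%:R^-1 : R) @[n --> \oo] --> (0 : R)^'.
  move=> A /(@cvg_harmonic R) HA.
  apply: (@filterS nat \oo _ (fun n => harmonic n != 0 :> R -> A (harmonic n))) => [n|]; last exact: HA.
  by apply; rewrite invr_neq0.
have := cvg_comp _ _ hn H.
apply: cvg_trans; apply: near_eq_cvg; near=> n => /=.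
by rewrite scaleRE invrK scaleRE mulr1 FE// invr_gt0.
Unshelve. all: by end_near. Qed.

End LineDifferentiation1D.

Section LineDifferentiation.
Context {R : realType} {N : nat}.
Notation E := 'rV[R]_N.
Notation B := (Borel R N).
Notation RR := (measurableTypeR R).
Notation leb := (@lebesgue_measure R).
Context (mu : {measure set B -> \bar R}) (Hmu : is_lebesgue mu) (i : 'I_N).

(** The exceptional set is null because almost every line in direction i meets it in a null set: by
    [tonelli_line] over an interval of length 1, its measure is the integral over x of the length of
    {t in ]0, 1[ : x + t e_i in Bad}. *)
Lemma ae_steklov_cvg (G : B -> R) : mu.-integrable setT (EFin \o G) ->
  {ae mu, forall x : B, (n.+1%:R * steklov i n.+1%:R^-1 G x) @[n --> \oo] --> G x}.
Proof.
move=> iG.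
have mG : measurable_fun setT G by apply/measurable_EFinP; exact: measurable_int iG.
pose err (n : nat) (x : B) : \bar R := `|n.+1%:R * steklov i n.+1%:R^-1 G x - G x|%:E.
have merr n : measurable_fun setT (err n).
  apply/measurable_EFinP; apply: measurableT_comp => //; apply: measurable_funB => //.
  apply: measurable_funM => //; apply/measurable_EFinP.
  by apply: measurable_int (integrable_steklov Hmu i _ iG); rewrite invr_ge0.
(* Convergence fails exactly where the limsup of the errors is positive; in this form the
   exceptional set is visibly measurable. *)
pose Bad : set B := [set x | (0 < limn_esup (err ^~ x))%E].
have mBad : measurable Bad.
  rewrite -[Bad]setTI; apply: emeasurable_fun_o_infty => //.
  exact: measurable_fun_limn_esup.
have goodP (x : B) : (n.+1%:R * steklov i n.+1%:R^-1 G x) @[n --> \oo] --> G x -> ~ Bad x.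
  move=> H; rewrite /Bad /=.
  have H0 : err n x @[n --> \oo] --> 0%:E.
    apply: cvg_EFin; first by near=> n.
    rewrite -(@normr0 _ R) -(subrr (G x)); apply: cvg_norm.
    by apply: cvgB => //; exact: cvg_cst.
  rewrite is_cvg_limn_esupE; last by apply/cvg_ex; exists 0%:E.
  by rewrite (cvg_lim _ H0)// ltxx.
suff Bad0 : mu Bad = 0%E.
  exists Bad; split=> // x /= nH; apply: contrapT => nBad; apply: nH.
  have err0 : err n x @[n --> \oo] --> 0%:E.
    by apply: limn_esup_le_cvg; [rewrite leNgt; apply/negP|move=> n; rewrite lee_fin].
  apply/cvgrPdist_le => e e0.
  move/fine_cvgP : err0 => [_ /cvgrPdist_le /(_ _ e0)].
  by apply: filterS => n /=; rewrite sub0r normrN normr_id distrC.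
have leb01 : leb `]0%R, 1%R[ = 1%E.
  by rewrite lebesgue_measure_itv /= lte_fin ltr01 oppr0 adde0.
have mI : measurable_fun setT (\1_Bad : B -> R) by exact: measurable_indic.
have I0 (x : B) : 0 <= (\1_Bad x : R) by [].
have := tonelli_line Hmu i (measurable_itv `]0%R, 1%R[) mI I0.
rewrite leb01 mul1e integral_indic// setIT => <-.
(* Twice the unit interval, because an average of length at most 1 started at s < 1 only looks at
   points below 2. *)
have leb02 : (leb `[0%R, 2%R] < +oo)%E by rewrite leb_seg// ltry.
have aeI := ae_integrable_line Hmu i (measurable_itv `[0%R, 2%R]) leb02 iG.
rewrite -[RHS](integral0 mu setT); apply: ae_eq_integral => //.
  have := measurable_fun_fubini_tonelli_F (m2 := leb) (T1 := B) (T2 := RR)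
    (fun z => (\1_Bad (line i z.1 z.2) * \1_(`]0%R, 1%R[%classic : set RR) z.2)%:E).
  move=> H; apply: eq_measurable_fun (H _ _).
  - by move=> x _; rewrite (integral_indicE leb _ (fun t => \1_Bad (line i x t))).
  - apply/measurable_EFinP; apply: measurable_funM.
      by apply: measurableT_comp (measurable_line i); exact: measurable_indic.
    apply: (measurableT_comp (f := \1_(`]0%R, 1%R[%classic : set RR) : RR -> R)) measurable_snd.
    exact: measurable_indic.
  - by move=> z; rewrite lee_fin mulr_ge0.
apply: ae_imp aeI _ => x ix _.
have iX : leb.-integrable setT (EFin \o (fun t => G (line i x t) * \1_(`[0%R, 2%R]%classic : set RR) t)).
  have := proj1 (@integrable_mkcond _ RR R leb `[0%R, 2%R]%classic _ (measurable_itv _)) ix.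
  apply: eq_integrable => // t _; rewrite patchE /= indicE.
  by case: ifP => _; rewrite ?mulr1 ?mulr0.
rewrite /= -[RHS](integral0 leb `]0%R, 1%R[%classic); apply: ae_eq_integral => //.
  apply/measurable_EFinP/measurable_funTS; apply: measurableT_comp (measurable_line1 i x).
  exact: measurable_indic.
apply: ae_imp (ae_cvg_average iX) _ => s H; rewrite /= in_itv /= => /andP[s0 s1].
rewrite indicE memNset//; apply: goodP.
move: H; rewrite indicE mem_set /= ?in_itv /=; last by apply/andP; split; lra.
rewrite mulr1; apply: cvg_trans; apply: near_eq_cvg; near=> n.
congr (_ * _); apply: eq_Rintegral => t; rewrite inE /= in_itv /= => /andP[t0 tn].
have n1 : n.+1%:R^-1 <= 1 :> R by rewrite invf_le1 ?ler1n.
have t1 : t <= 1 := le_trans tn n1.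
rewrite indicE mem_set /= ?in_itv /= ?mulr1 ?lineD//.
by apply/andP; split; [exact: addr_ge0 (ltW s0) t0|rewrite -[2]/(1 + 1 : R) lerD// ltW].
Unshelve. all: by end_near. Qed.

Lemma ae_diff_quotient (Om D U : set E) (u g : B -> R) (h : R) :
  compact D -> D `<=` Om -> open U ->
  mu.-integrable (D : set B) (EFin \o u) -> mu.-integrable (D : set B) (EFin \o g) ->
  (forall phi, test_fun Om phi ->
     (\int[mu]_(x in (Om : set B)) (u x * partial i phi x)%:E =
      - \int[mu]_(x in (Om : set B)) (g x * phi x)%:E)%E) ->
  0 < h -> (forall x t, U x -> 0 <= t <= h -> D (line i x t)) ->
  {ae mu, forall x : B, U x ->
     cutoff D u (line i x h) - cutoff D u x = steklov i h (cutoff D g) x}.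
Proof.
move=> cD DOm oU iu ig W h0 UD.
have iU := integrable_cutoff cD iu; have iG := integrable_cutoff cD ig.
have iUsh : mu.-integrable setT (EFin \o (fun x => cutoff D u (line i x h))).
  exact: (integrable_shift Hmu (h *: ebasis R i) iU).
have iSt := integrable_steklov Hmu i (ltW h0) iG.
have iall := integrableB_EFin measurableT (integrableB_EFin measurableT iUsh iU) iSt.
have := @ae_eq0_of_integral_boxbump _ _ mu Hmu (fun x : B =>
  cutoff D u (line i x h) - cutoff D u x - steklov i h (cutoff D g) x) U oU.
move=> H; apply: ae_imp (H _ _) _.
- move=> a b _; apply: integrableS iall => //; exact: measurable_box.
- by move=> a b k abU; exact: (diff_quotient_bump Hmu cD DOm iu ig W k h0 UD abU).
- by move=> x /= H' /H' /eqP; rewrite subr_eq0 => /eqP.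
Qed.

End LineDifferentiation.

(** * Weak derivatives of truncations *)

(* The functions [|f_n - f| - G_n + G] are dominated by [2 G] and have the same
   integrals as [|f_n - f|]. *)
Lemma generalized_dominated_cvg d (T : measurableType d) (R : realType)
  (mu : {measure set T -> \bar R}) (f G : nat -> T -> R) (fl Gl : T -> R) :
  (forall n, measurable_fun setT (f n)) -> measurable_fun setT fl ->
  (forall n, mu.-integrable setT (EFin \o G n)) -> mu.-integrable setT (EFin \o Gl) ->
  (forall n, \int[mu]_x G n x = \int[mu]_x Gl x) ->
  (forall n, {ae mu, forall x, `|f n x| <= G n x}) ->
  {ae mu, forall x, f n x @[n --> \oo] --> fl x} ->
  {ae mu, forall x, G n x @[n --> \oo] --> Gl x} ->
  \int[mu]_x f n x @[n --> \oo] --> \int[mu]_x fl x.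
Proof.
move=> mf mfl iG iGl eqG fG cvf cvG.
have mG n : measurable_fun setT (G n) by apply/measurable_EFinP; exact: measurable_int (iG n).
have mGl : measurable_fun setT Gl by apply/measurable_EFinP; exact: measurable_int iGl.
have aefG := ae_foralln fG.
have flG : {ae mu, forall x, `|fl x| <= Gl x}.
  apply: ae_imp2 aefG (ae_imp2 cvf cvG (fun x a b => conj a b)) _ => x H [c1 c2].
  by apply: (ler_cvg_to (cvg_norm c1) c2); exact: nearW H.
have dom (h H : T -> R) : measurable_fun setT h -> mu.-integrable setT (EFin \o H) ->
    {ae mu, forall x, `|h x| <= H x} -> mu.-integrable setT (EFin \o h).
  move=> mh iH hH; have mH : measurable_fun setT H by apply/measurable_EFinP; exact: measurable_int iH.
  apply/integrableP; split; first exact/measurable_EFinP.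
  have /integrableP[_] := iH; apply: le_lt_trans; apply: ae_ge0_le_integral => //.
  - by apply: measurableT_comp => //; exact/measurable_EFinP.
  - by apply: measurableT_comp => //; exact/measurable_EFinP.
  - by apply: ae_imp hH _ => x h1 _ /=; rewrite lee_fin (le_trans h1)// ler_norm.
have iF n := dom _ _ (mf n) (iG n) (fG n).
have ifl := dom _ _ mfl iGl flG.
pose k n x : R := Num.max (`|f n x - fl x| - (G n x - Gl x)) 0.
have mk n : measurable_fun setT (k n).
  apply: measurable_maxr => //; apply: measurable_funB; last exact: measurable_funB.
  by apply: measurableT_comp => //; exact: measurable_funB.
have i2G := integrableD_EFin measurableT iGl iGl.
have kG : {ae mu, forall x n, setT x -> (`|(k n x)%:E| <= (Gl x + Gl x)%:E)%E}.
  apply: ae_imp2 aefG flG _ => x H Hl n _; rewrite lee_fin ger0_norm; last first.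
    by rewrite /k le_max lexx orbT.
  have := H n; have G0 : 0 <= Gl x := le_trans (normr_ge0 _) Hl.
  rewrite /k ge_max addr_ge0// andbT => Hn.
  by have := ler_normB (f n x) (fl x); lra.
have k0 : {ae mu, forall x, setT x -> (k n x)%:E @[n --> \oo] --> (cst 0 x : \bar R)%E}.
  apply: ae_imp2 cvf cvG _ => x c1 c2 _; apply: cvg_EFin; first by near=> n.
  have H : `|f n x - fl x| - (G n x - Gl x) @[n --> \oo] --> (0 : R).
    rewrite -[X in _ --> X](_ : `|fl x - fl x| - (Gl x - Gl x) = 0); last first.
      by rewrite !subrr normr0 subr0.
    apply: cvgB; last by apply: cvgB => //; exact: cvg_cst.
    by apply: cvg_norm; apply: cvgB => //; exact: cvg_cst.
  apply: (squeeze_cvgr (f := cst 0) (h := fun n => `| `|f n x - fl x| - (G n x - Gl x)|)).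
  - by near=> n; rewrite /k /= le_max lexx orbT ge_max ler_norm normr_ge0.
  - exact: cvg_cst.
  - by have := cvg_norm H; rewrite normr0; exact.
have mk' n : measurable_fun setT (EFin \o k n) by exact/measurable_EFinP.
have mc : measurable_fun setT (cst 0%E : T -> \bar R) by exact: measurable_cst.
have [_ _ cvk] := dominated_convergence measurableT mk' mc k0 i2G kG.
rewrite integral0 in cvk.
apply/cvgrPdist_le => e e0.
have /fine_cvgP[_ /cvgrPdist_le /(_ _ e0)] := cvk.
apply: filterS => n /=; rewrite sub0r normrN => H; rewrite distrC.
have ik : mu.-integrable setT (EFin \o k n).
  apply: (dom _ (fun x => Gl x + Gl x)) => //.
  by apply: ae_imp kG _ => x /(_ n I); rewrite lee_fin.
rewrite -RintegralB//.
have iB := integrableB_EFin measurableT (iF n) ifl.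
apply: le_trans (le_normr_Rintegral measurableT iB) _.
have iA : mu.-integrable setT (EFin \o (fun x => `|f n x - fl x|)) := integrable_norm iB.
have iGB := integrableB_EFin measurableT (iG n) iGl.
have -> : \int[mu]_x `|f n x - fl x| = \int[mu]_x (`|f n x - fl x| - (G n x - Gl x)).
  by rewrite RintegralB// [X in _ - X]RintegralB// eqG subrr subr0.
apply: le_trans _ (le_trans (ler_norm _) H).
apply: le_Rintegral => //; first exact: integrableB_EFin.
by move=> x _; rewrite /k le_max lexx.
Unshelve. all: by end_near. Qed.

Definition trunc (R : realType) (c t : R) : R := Num.max (t - c) 0.

(** Limit of ((t + s - c)^+ - (t - c)^+) / h when h > 0 tends to 0 and s/h tends to y. At t = c the
    quotient is (s/h)^+, whence the exceptional value. *)
Definition trunc_deriv (R : realType) (c t y : R) : R :=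
  if c < t then y else if t == c then Num.max y 0 else 0.

Lemma trunc_lip (R : realType) (c s t : R) : `|trunc c s - trunc c t| <= `|s - t|.
Proof.
rewrite /trunc; have [h1|h1] := leP (s - c) 0; have [h2|h2] := leP (t - c) 0.
- by rewrite subrr normr0.
- by rewrite sub0r normrN gtr0_norm// ler_normr; apply/orP; right; lra.
- by rewrite subr0 gtr0_norm// ler_normr; apply/orP; left; lra.
- by rewrite opprB addrA subrK.
Qed.

(** Convergence of the quotients forces [s n] to 0, so for [a] different from [c] the sign of a + s
    n - c is eventually that of a - c. *)
Lemma trunc_cvg (R : realType) (c a y : R) (s : nat -> R) (h : nat -> R) :
  (forall n, 0 < h n) -> h n @[n --> \oo] --> (0 : R) ->
  (h n)^-1 * s n @[n --> \oo] --> y ->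
  (h n)^-1 * (trunc c (a + s n) - trunc c a) @[n --> \oo] --> trunc_deriv c a y.
Proof.
move=> h0 hc sc.
have s0 : s n @[n --> \oo] --> (0 : R).
  have H : h n * ((h n)^-1 * s n) @[n --> \oo] --> 0 * y by exact: cvgM hc sc.
  rewrite mul0r in H.
  apply: cvg_trans H; apply: near_eq_cvg; near=> n => /=.
  by rewrite mulrA divff ?mul1r// gt_eqF.
rewrite /trunc_deriv; case: (ltgtP c a) => [ca|ac|<-].
- have /cvgrPdist_lt/(_ (a - c)) := s0; rewrite subr_gt0 => /(_ ca) Hn.
  apply: cvg_trans sc; apply: near_eq_cvg; near=> n; congr (_ * _).
  have : `|0 - s n| < a - c by near: n.
  rewrite sub0r normrN.
  by move=> /ltr_normlP[h1 h2]; rewrite /trunc !max_l; lra.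
- have /cvgrPdist_lt/(_ (c - a)) := s0; rewrite subr_gt0 => /(_ ac) Hn.
  apply: cvg_trans (@cvg_cst _ (0 : R) nat \oo _).
  apply: near_eq_cvg; near=> n.
  have : `|0 - s n| < c - a by near: n.
  rewrite sub0r normrN.
  by move=> /ltr_normlP[h1 h2]; rewrite /trunc !max_r ?subrr ?mulr0//; lra.
- apply: (@cvg_trans _ (Num.max ((h n)^-1 * s n) 0 @[n --> \oo])).
    apply: near_eq_cvg; near=> n.
    rewrite /trunc subrr maxxx subr0 addrAC subrr add0r maxr_pMr ?mulr0//.
    by rewrite invr_ge0 ltW.
  apply: (@cvg_comp _ _ _ _ (fun t : R => Num.max t 0) _ _ _ sc).
exact: (@continuous_max R R (id : R -> R^o) (cst 0) y (@cvg_id _ _) (@cst_continuous _ _ _ _)).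
Unshelve. all: by end_near. Qed.

Lemma trunc_deriv_le (R : realType) (c t y : R) : `|trunc_deriv c t y| <= `|y|.
Proof.
rewrite /trunc_deriv; case: ifP => // _; case: ifP => _; last by rewrite normr0.
by have [h|h] := leP y 0; rewrite ?normr0.
Qed.

(** * Room for shifts inside an open set *)

Section CompactNeighbourhood.
Context {R : realType} {N : nat}.
Notation E := 'rV[R]_N.

Lemma ball_coordP (x y : E) (e : R) : 0 < e ->
  ball x e y <-> (forall j, `|x ord0 j - y ord0 j| < e).
Proof.
move=> e0; split=> [[_ H] j|H]; first exact: H.
by split=> // i0 j; rewrite (ord1 i0); exact: H.
Qed.

(** [U] is where difference quotients will be controlled, [D] the compact set on which the function
    and its derivative are integrable. *)
Lemma compact_neighbourhood (K Om : set E) : compact K -> open Om -> K `<=` Om ->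
  exists (D U : set E) (r : R), [/\ 0 < r, compact D /\ D `<=` Om, open U, K `<=` U &
    forall i (x : E) t, U x -> 0 <= t <= r -> D (line i x t)].
Proof.
move=> cK oOm KOm.
(* Compactness yields one radius that is valid for all points of [K]. *)
have nearK : \forall r \near (0 : R)^'+, K `<=` [set x : E | ball x r `<=` Om].
  apply: (proj1 (compact_near_coveringP K) cK _ _ (fun (r : R) (x : E) => ball x r `<=` Om)).
  move=> x /KOm Omx.
  have /nbhs_ballP[e /= e0 He] := open_nbhs_nbhs (conj oOm Omx).
  have e20 : 0 < e / 2 by rewrite divr_gt0.
  exists (ball x (e / 2), [set r : R | r < e / 2]).
    split; first exact: nbhsx_ballx.
    exact: nbhs_right_lt.
  move=> [y r] /= [By rlt] z Bz; apply: He.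
  have r0 : 0 < r by case: Bz.
  apply/ball_coordP => // j.
  move/(ball_coordP _ _ e20) : By => /(_ j) h1; move/(ball_coordP _ _ r0) : Bz => /(_ j) h2.
  have := ler_normD (x ord0 j - y ord0 j) (y ord0 j - z ord0 j).
  by rewrite addrA subrK; move: h1 h2 rlt; lra.
have [r /= r0 Kr] : exists2 r : R, 0 < r & K `<=` [set x : E | ball x r `<=` Om].
  near (0 : R)^'+ => r; exists r; first by near: r; exact: nbhs_right_gt.
  by near: r.
(* [U] is the q-neighbourhood of [K]; a shift by at most q leaves each coordinate within 2 q of a
   point of [K], and 2 q = r / 2 keeps [D] inside the balls of radius r. *)
pose q := r / 4; have q0 : 0 < q by rewrite divr_gt0.
pose D : set E := [set z.1 + z.2 | z in K `*` box (const_mx (- (2 * q))) (const_mx (2 * q))].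
exists D, (\bigcup_(y in K) ball y q), q; split=> //.
- split.
    apply: continuous_compact; last by apply: compact_setX => //; exact: box_compact.
    by apply: continuous_subspaceT => z; apply: (@cvgD _ _ _ _ _ (fun z : E * E => z.1) (fun z : E * E => z.2)); [exact: cvg_fst|exact: cvg_snd].
  move=> _ [[x y] /= [Kx By] <-]; apply: (Kr _ Kx); apply/ball_coordP => // j.
  rewrite !mxE opprD addrA subrr sub0r normrN.
  have := By j; rewrite !mxE -ler_norml => /le_lt_trans; apply.
  by rewrite /q; lra.
- by apply: bigcup_open => y _; exact: ball_open.
- by move=> x Kx; exists x => //; exact: ballxx.
- move=> i x t [y Ky /(ball_coordP _ _ q0) By] /andP[t0 tq].
  exists (y, line i x t - y); last by rewrite /= addrC subrK.
  split=> //= j; rewrite !mxE -ler_norml.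
  have := By j; rewrite distrC => h.
  have ht : `|t * ((ord0 == ord0 :> 'I_1) && (j == i))%:R| <= q.
    by rewrite eqxx /=; case: eqVneq => _; rewrite ?mulr1 ?mulr0 ?normr0 ?ger0_norm// ltW.
  rewrite addrAC (le_trans (ler_normD _ _))//.
  by move: h ht; lra.
Unshelve. all: by end_near. Qed.

End CompactNeighbourhood.

Section AlongLine.
Context {R : realType} {N : nat}.
Notation E := 'rV[R]_N.

Lemma is_derive_along (i : 'I_N) (f : E -> R) (x : E) (s df : R) :
  is_derive (line i x s : E) (ebasis R i) f df ->
  is_derive s (1 : R) (fun s => f (line i x s)) df.
Proof.
move=> [dg dgE].
have eqf : (fun h : R => h^-1 *: ((f \o shift (line i x s : E)) (h *: ebasis R i) - f (line i x s))) =
   (fun h : R => h^-1 *: (((fun s => f (line i x s)) \o shift s) (h *: (1 : R)) - f (line i x s))).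
  apply/funext => h; congr (_ *: (f _ - _)); rewrite /= scaleRE mulr1 addrC.
  by rewrite -/(line i _ h) lineD addrC.
split; first by rewrite /derivable -eqf.
by rewrite -dgE /derive -eqf.
Qed.

(** Mean value theorem along the segment, [M] bounding the partial derivative. The shift is backward
    because differences are moved from the function to [phi]. *)
Lemma test_fun_along_bounded (i : 'I_N) (Om : set E) (phi : E -> R) : test_fun Om phi ->
  exists2 M : R, 0 < M & forall x (h : R), 0 < h -> `|phi (line i x (- h)) - phi x| <= M * h.
Proof.
move=> tphi; have [K [cK _ _ dphi0]] := test_fun_support tphi.
have [M M0 HM] := compact_support_bounded (test_fun_partial_continuous tphi (i:=i)) cK (dphi0 i).
exists M => // x h h0.
have dphi s : is_derive s (1 : R) (fun s => phi (line i x s)) (partial i phi (line i x s)).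
  by apply: is_derive_along; exact: (test_fun_is_derive tphi i _).
have hN : - h < 0 by rewrite oppr_lt0.
have cphi : {within `[- h, 0], continuous (fun s => phi (line i x s))}.
  apply: continuous_subspaceT => s.
  by apply/differentiable_continuous/derivable1_diffP; case: (dphi s).
have [c _ E1] := MVT hN (fun s _ => dphi s) cphi.
have -> : phi x = phi (line i x 0) by rewrite /line scale0r addr0.
by rewrite distrC E1 sub0r opprK normrM (gtr0_norm h0) ler_wpM2r// ltW.
Qed.

Lemma test_fun_along_cvg (i : 'I_N) (Om : set E) (phi : E -> R) (x : E) (h : nat -> R) :
  test_fun Om phi -> (forall n, 0 < h n) -> h n @[n --> \oo] --> (0 : R) ->
  (h n)^-1 * (phi (line i x (- h n)) - phi x) @[n --> \oo] --> - partial i phi x.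
Proof.
move=> tphi h0 hc.
have : is_derive (0 : R) (1 : R) (fun s => phi (line i x s)) (partial i phi x).
  apply: is_derive_along; rewrite {1}/line scale0r addr0; exact: (test_fun_is_derive tphi i _).
move=> [d0 dE].
have H : t^-1 *: (phi (line i x (t *: 1 + 0)) - phi (line i x 0)) @[t --> 0^'] --> partial i phi x.
  by rewrite -dE; exact: d0.
have hn : - h n @[n --> \oo] --> (0 : R)^'.
  have hc' : - h n @[n --> \oo] --> (0 : R) by rewrite -oppr0; exact: cvgN.
  move=> A /hc' HA.
  apply: (@filterS nat \oo _ (fun n => - h n != 0 -> A (- h n))) => [n|]; last exact: HA.
  by apply; rewrite oppr_eq0 gt_eqF.
have H2 : - ((- h n)^-1 *: (phi (line i x (- h n *: 1 + 0)) - phi (line i x 0))) @[n --> \oo]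
    --> - partial i phi x.
  exact: cvgN (cvg_comp _ _ hn H).
apply: cvg_trans H2; apply: near_eq_cvg; near=> n => /=.
rewrite !scaleRE mulr1 addr0 invrN mulNr opprK.
by rewrite {2}/line scale0r addr0.
Unshelve. all: by end_near. Qed.

End AlongLine.

Section Truncation.
Context {R : realType} {N : nat}.
Notation E := 'rV[R]_N.
Notation B := (Borel R N).
Notation leb := (@lebesgue_measure R).
Context (mu : {measure set B -> \bar R}) (Hmu : is_lebesgue mu).

(** Local integrability instead of p-integrability: truncation at a level c < 0 yields functions
    that are at least -c wherever u >= 0, hence possibly not p-integrable. *)
Definition locint (Om : set E) (f : B -> R) : Prop :=
  measurable_fun (Om : set B) f /\
  forall K : set E, compact K -> K `<=` Om -> mu.-integrable (K : set B) (EFin \o f).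

Definition weak_deriv (Om : set E) (i : 'I_N) (u g : B -> R) : Prop :=
  forall phi, test_fun Om phi ->
    (\int[mu]_(x in (Om : set B)) (u x * partial i phi x)%:E =
     - \int[mu]_(x in (Om : set B)) (g x * phi x)%:E)%E.

Lemma compact_measurableB (K : set E) : compact K -> measurable (K : set B).
Proof. by move=> cK; apply: closed_measurableB; apply: (compact_closed (@norm_hausdorff R _) cK). Qed.

Lemma measurable_trunc_deriv (D : set B) (c : R) (u g : B -> R) : measurable D ->
  measurable_fun D u -> measurable_fun D g ->
  measurable_fun D (fun x => trunc_deriv c (u x) (g x)).
Proof.
move=> mD mu_ mg; rewrite /trunc_deriv.
apply: measurable_fun_if => //.
- by apply: measurable_fun_ltr.
- by apply: measurable_funS mg => //; exact: subIsetl.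
- apply: (measurable_funS mD (@subIsetl _ _ _)).
  apply: measurable_fun_if => //.
  + by apply: measurable_fun_eqr.
  + by apply: measurable_maxr => //; apply: measurable_funS mg => //; exact: subIsetl.
Qed.

Lemma dominated_integrable_EFin (D : set B) (f G : B -> R) : measurable D ->
  measurable_fun D f -> mu.-integrable D (EFin \o G) ->
  (forall x, D x -> `|f x| <= `|G x|) -> mu.-integrable D (EFin \o f).
Proof.
move=> mD mf iG fG; apply: (le_integrable mD _ _ iG); first exact/measurable_EFinP.
by move=> x Dx; rewrite /= lee_fin fG.
Qed.

Lemma trunc_norm_le (c t : R) : `|trunc c t| <= `|t| + `|c|.
Proof.
apply: le_trans (ler_normB t c); have := trunc_lip c t c.
by rewrite [X in _ - X](_ : _ = 0) ?subr0// /trunc subrr maxxx.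
Qed.

Lemma locint_trunc (Om : set E) (c : R) (u : B -> R) :
  locint Om u -> locint Om (fun x => trunc c (u x)).
Proof.
move=> [mu_ iu]; have mt (D : set B) : measurable_fun D u -> measurable_fun D (fun x => trunc c (u x)).
  by move=> mD; rewrite /trunc; apply: measurable_maxr => //; apply: measurable_funB.
split=> [|K cK KOm]; first exact: mt.
have mK := compact_measurableB cK; have iK := iu _ cK KOm.
have iC : mu.-integrable (K : set B) (EFin \o cst `|c|).
  apply: measurable_bounded_integrable => //; first exact: compact_mu_lty.
  by exists `|c|; split; [exact: num_real|move=> y cy x _; rewrite /= normr_id ltW].
have iA : mu.-integrable (K : set B) (EFin \o (fun x => `|u x|)) := integrable_norm iK.
apply: (dominated_integrable_EFin mK _ (integrableD_EFin mK iA iC)).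
  by apply: mt; apply/measurable_EFinP; exact: measurable_int iK.
by move=> x _ /=; rewrite (ger0_norm (addr_ge0 _ _))// trunc_norm_le.
Qed.

Lemma steklov_norm_le (i : 'I_N) (h : R) (G : B -> R) : 0 <= h -> mu.-integrable setT (EFin \o G) ->
  {ae mu, forall x : B, `|steklov i h G x| <= steklov i h (fun x => `|G x|) x}.
Proof.
move=> h0 iG; apply: ae_imp (steklovE Hmu i h0 iG) _ => x [ix _].
by apply: le_normr_Rintegral.
Qed.

Lemma integral_steklov1 (i : 'I_N) (h : R) (G : B -> R) : 0 <= h -> mu.-integrable setT (EFin \o G) ->
  \int[mu]_x steklov i h G x = h * \int[mu]_x G x.
Proof.
move=> h0 iG.
have m1 : measurable_fun setT (cst 1 : B -> R) by exact: measurable_cst.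
have n1 (x : B) : `|cst 1 x : R| <= 1 by rewrite normr1.
have := integral_steklov Hmu i h0 iG m1 n1 => /(congr1 fine).
rewrite -!/(Rintegral _ _ _) => H.
rewrite mulrC -RintegralZr//.
transitivity (\int[mu]_x (cst 1 x * steklov i h G x)).
  by apply: eq_Rintegral => x _; rewrite mul1r.
rewrite H; apply: eq_Rintegral => x _; congr (_ * _).
by rewrite Rintegral_cst//= mul1r leb_seg.
Qed.

Section WeakTrunc.
Context (Om : set E) (oOm : open Om) (i : 'I_N) (u g : B -> R) (c : R).
Hypotheses (lu : locint Om u) (lg : locint Om g) (W : weak_deriv Om i u g).

(** The limit of int (w(x + h e_i) - w(x)) / h * phi(x), with w the cut-off truncation, is computed
    twice. As it stands, the quotient is bounded by averages of |g|, which need not have a common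
    integrable majorant; this calls for [generalized_dominated_cvg]. With the difference moved to
    phi, ordinary domination suffices. *)
Lemma weak_deriv_trunc :
  weak_deriv Om i (fun x => trunc c (u x)) (fun x => trunc_deriv c (u x) (g x)).
Proof.
move=> phi tphi.
have [K [cK KOm phi0 dphi0]] := test_fun_support tphi.
have [D [U [r [r0 [cD DOm] oU KU UD]]]] := compact_neighbourhood cK oOm KOm.
have mD := compact_measurableB cD.
have DU : U `<=` D.
  move=> x Ux; have h00 : 0 <= (0 : R) <= r by rewrite lexx ltW.
  by have := UD i x 0 Ux h00; rewrite /line scale0r addr0.
have phiD x : ~ D x -> phi x = 0 by move=> nDx; apply: phi0 => /KU /DU.
have dphiD x : ~ D x -> partial i phi x = 0 by move=> nDx; apply: dphi0 => /KU /DU.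
(* The offset makes every step [h n] at most [r], so the shifts stay in [D] from n = 0 on. *)
pose n0 := Num.bound r^-1.
pose h n : R := (n + n0).+1%:R^-1.
have hgt0 n : 0 < h n by rewrite /h invr_gt0.
have hr n : h n <= r.
  rewrite /h -(invrK r) lef_pV2 ?posrE ?invr_gt0//.
  have := @archi_boundP R r^-1; rewrite invr_ge0 ltW// => /(_ isT) /ltW H.
  by apply: le_trans H _; rewrite ler_nat -/n0 (leq_trans (leq_addl n n0)).
have hc : h n @[n --> \oo] --> (0 : R).
  by have := @cvg_harmonic R; rewrite -(cvg_shiftn n0).
have [_ /(_ _ cD DOm) iuD] := lu; have [_ /(_ _ cD DOm) igD] := lg.
have [_ /(_ _ cD DOm) itD] := locint_trunc c lu.
have iU := integrable_cutoff cD iuD; have iG := integrable_cutoff cD igD.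
have iT := integrable_cutoff cD itD.
set w := cutoff D (fun x => trunc c (u x)) in iT.
pose gD := cutoff D g.
have iGn : mu.-integrable setT (EFin \o (fun x => `|gD x|)) := integrable_norm iG.
have [M M0 HM] := compact_support_bounded (test_fun_continuous tphi) cK phi0.
have mphi : measurable_fun setT (phi : B -> R).
  by apply: continuous_measurableB; exact: test_fun_continuous tphi.
have mshift t : measurable_fun setT (fun x : B => line i x t).
  exact: (measurable_shift (t *: ebasis R i)).
pose f n (x : B) := (h n)^-1 * (w (line i x (h n)) - w x) * phi x.
pose fl (x : B) := cutoff D (fun x => trunc_deriv c (u x) (g x)) x * phi x.
have meas (F : B -> R) : mu.-integrable setT (EFin \o F) -> measurable_fun setT F.
  by move=> iF; apply/measurable_EFinP; exact: measurable_int iF.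
have mw := meas _ iT.
have mf n : measurable_fun setT (f n).
  apply: measurable_funM => //; apply: measurable_funM => //.
  by apply: measurable_funB => //; exact: measurableT_comp mw (mshift _).
have iL : mu.-integrable (D : set B) (EFin \o (fun x => trunc_deriv c (u x) (g x))).
  apply: (dominated_integrable_EFin mD _ igD).
    apply: measurable_trunc_deriv => //; apply/measurable_EFinP;
      [exact: measurable_int iuD|exact: measurable_int igD].
  by move=> x _; exact: trunc_deriv_le.
have mfl : measurable_fun setT fl.
  by apply: measurable_funM => //; apply: meas; exact: integrable_cutoff.
(* Averaging over a segment of length h multiplies the integral by h, so after division all [G n]
   have the same integral as [Gl]. *)
pose G n (x : B) := M * ((h n)^-1 * steklov i (h n) (fun x => `|gD x|) x).
pose Gl (x : B) := M * `|gD x|.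
have iGG n : mu.-integrable setT (EFin \o G n).
  apply: integrableZl_EFin => //; apply: integrableZl_EFin => //.
  by apply: integrable_steklov => //; exact: ltW.
have iGl : mu.-integrable setT (EFin \o Gl) by exact: integrableZl_EFin.
have eqG n : \int[mu]_x G n x = \int[mu]_x Gl x.
  rewrite RintegralZl//; last by apply: integrableZl_EFin => //; apply: integrable_steklov => //; exact: ltW.
  rewrite RintegralZl//; last by apply: integrable_steklov => //; exact: ltW.
  by rewrite integral_steklov1// ?mulKf ?gt_eqF// 1?ltW// RintegralZl.
have aeD n : {ae mu, forall x : B, U x -> cutoff D u (line i x (h n)) - cutoff D u x = steklov i (h n) gD x}.
  apply: (ae_diff_quotient Hmu cD DOm oU iuD igD W (hgt0 n)) => x t Ux /andP[t0 th].
  by apply: UD => //; rewrite t0 (le_trans th).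
have cutE (F : B -> R) (x : B) : D x -> cutoff D F x = F x.
  by move=> Dx; rewrite /cutoff indicE mem_set// mulr1.
have UDh (x : B) n : U x -> D (line i x (h n)).
  by move=> Ux; apply: UD => //; rewrite ltW/=.
(* Truncation is 1-Lipschitz: its difference is bounded by that of u, which is an average of g on
   [U]. *)
have fG n : {ae mu, forall x, `|f n x| <= G n x}.
  apply: ae_imp2 (aeD n) (steklov_norm_le i (ltW (hgt0 n)) iG) _ => x H Hs.
  have G0 : 0 <= steklov i (h n) (fun x => `|gD x|) x by exact: le_trans Hs.
  have [Kx|nKx] := pselect (K x); last first.
    by rewrite /f phi0// mulr0 normr0 mulr_ge0 ?(ltW M0)// mulr_ge0// invr_ge0 ltW.
  have Ux := KU _ Kx; rewrite /f /G normrM mulrC ler_pM//.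
  rewrite normrM gtr0_norm ?invr_gt0// ler_wpM2l// ?invr_ge0 ?(ltW (hgt0 n))//.
  apply: le_trans _ Hs; rewrite -H// /w !cutE//; [exact: trunc_lip|exact: DU|exact: UDh|exact: DU|exact: UDh].
have shiftn (F : nat -> R) (l : R) : F n @[n --> \oo] --> l -> F (n + n0)%N @[n --> \oo] --> l.
  by rewrite -(cvg_shiftn n0).
have cvf : {ae mu, forall x, f n x @[n --> \oo] --> fl x}.
  apply: ae_imp2 (ae_foralln aeD) (ae_steklov_cvg Hmu i iG) _ => x H Hc.
  have [Kx|nKx] := pselect (K x); last first.
    rewrite /f /fl phi0// mulr0; under eq_cvg do rewrite mulr0; exact: cvg_cst.
  have Ux := KU _ Kx.
  have {}Hc := shiftn (fun n => n.+1%:R * steklov i n.+1%:R^-1 gD x) _ Hc.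
  have Hc' : (h n)^-1 * steklov i (h n) gD x @[n --> \oo] --> g x.
    rewrite -(cutE g x (DU _ Ux)); apply: cvg_trans Hc; apply: near_eq_cvg; near=> n.
    by rewrite /h invrK.
  apply: cvgM; last exact: cvg_cst.
  rewrite cutE; last exact: DU.
  have := trunc_cvg (c := c) (a := u x) hgt0 hc Hc'.
  apply: cvg_trans; apply: near_eq_cvg; near=> n; congr (_ * (_ - _)).
    rewrite /w cutE; last exact: UDh.
    rewrite -H// !cutE; [by congr trunc; lra|exact: DU|exact: UDh].
  by rewrite /w cutE//; exact: DU.
have cvG : {ae mu, forall x, G n x @[n --> \oo] --> Gl x}.
  apply: ae_imp (ae_steklov_cvg Hmu i iGn) _ => x /shiftn Hc.
  apply: cvgM; first exact: cvg_cst.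
  apply: cvg_trans Hc; apply: near_eq_cvg; near=> n.
  by rewrite /h invrK.
have lim1 := generalized_dominated_cvg mf mfl iGG iGl eqG fG cvf cvG.
have [M' M'0 HM'] := test_fun_along_bounded i tphi.
(* Discrete integration by parts turns the forward quotient of w into this quotient of phi, whose
   limit is - partial i phi. *)
pose q n (x : B) := (h n)^-1 * (phi (line i x (- h n)) - phi x).
have mq n : measurable_fun setT (q n).
  apply: measurable_funM => //; apply: measurable_funB => //.
  exact: measurableT_comp mphi (mshift _).
have qM n x : `|q n x| <= M'.
  rewrite /q normrM gtr0_norm ?invr_gt0// ler_pdivrMl// mulrC; exact: HM'.
have fq n : \int[mu]_x f n x = \int[mu]_x (w x * q n x).
  have iTs : mu.-integrable setT (EFin \o (fun x => w (line i x (h n)))).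
    exact: (integrable_shift Hmu (h n *: ebasis R i) iT).
  have mphis : measurable_fun setT (fun x : B => phi (line i x (- h n)) : R).
    exact: measurableT_comp mphi (mshift _).
  have i1 := integrableM_bounded iTs mphi HM.
  have i2 := integrableM_bounded iT mphi HM.
  have i3 := integrableM_bounded iT mphis (fun x => HM _).
  transitivity ((h n)^-1 * (\int[mu]_x (w (line i x (h n)) * phi x) - \int[mu]_x (w x * phi x))).
    rewrite -RintegralB// -RintegralZl//; last exact: integrableB_EFin.
    by apply: eq_Rintegral => x _; rewrite /f -mulrA mulrBl.
  have -> : \int[mu]_x (w (line i x (h n)) * phi x) = \int[mu]_x (w x * phi (line i x (- h n))).
    rewrite /Rintegral -(integral_shift Hmu (h n *: ebasis R i) i3); congr fine.
    apply: eq_integral => x _; congr (w _ * phi _)%:E.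
    by rewrite -/(line i x (h n)) lineD subrr /line scale0r addr0.
  rewrite -RintegralB// -RintegralZl//; last exact: integrableB_EFin.
  by apply: eq_Rintegral => x _; rewrite /q -mulrBr mulrCA.
have iwM : mu.-integrable setT (EFin \o (fun x => M' * `|w x|)).
  by apply: integrableZl_EFin => //; exact: integrable_norm iT.
have mpart : measurable_fun setT (partial i phi : B -> R).
  by apply: continuous_measurableB; exact: test_fun_partial_continuous tphi i.
have [M'' _ HM''] := compact_support_bounded (test_fun_partial_continuous tphi (i:=i)) cK (dphi0 i).
have i4 := integrableM_bounded iT mpart HM''.
have mwq n : measurable_fun setT (fun x => (w x * q n x)%:E).
  by apply/measurable_EFinP; exact: measurable_funM.
have mwp : measurable_fun setT (fun x => (w x * - partial i phi x)%:E).
  by apply/measurable_EFinP; apply: measurable_funM => //; exact: measurableT_comp.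
have cwq : {ae mu, forall x, setT x -> (w x * q n x)%:E @[n --> \oo] --> (w x * - partial i phi x)%:E}.
  apply: aeW => x _; apply: cvg_EFin; first by near=> n.
  apply: cvgM; first exact: cvg_cst.
  exact: test_fun_along_cvg tphi hgt0 hc.
have bwq : {ae mu, forall x n, setT x -> (`|(w x * q n x)%:E| <= (M' * `|w x|)%:E)%E}.
  by apply: aeW => x n _; rewrite lee_fin normrM mulrC ler_wpM2r.
have [iwd _ lim2] := dominated_convergence measurableT mwq mwp cwq iwM bwq.
have {}lim2 : \int[mu]_x f n x @[n --> \oo] --> \int[mu]_x (w x * - partial i phi x).
  under eq_cvg do rewrite fq.
  by apply: fine_cvg; rewrite fineK//; exact: integrable_fin_num.
have E := cvg_unique _ lim1 lim2.
have iflT : mu.-integrable setT (EFin \o fl) := integrableM_bounded (integrable_cutoff cD iL) mphi HM.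
rewrite -(integral_cutoff mu DOm (fun x => trunc c (u x)) dphiD).
rewrite -(integral_cutoff mu DOm (fun x => trunc_deriv c (u x) (g x)) phiD).
rewrite -[LHS]fineK ?integrable_fin_num// -[X in (- X)%E]fineK ?integrable_fin_num// -EFinN.
congr EFin; rewrite -!/(Rintegral _ _ _).
have -> : \int[mu]_x (w x * partial i phi x) = - \int[mu]_x (w x * - partial i phi x).
  rewrite -mulN1r -RintegralZl//.
  by apply: eq_Rintegral => x _; rewrite mulN1r mulrN opprK.
by rewrite -E.
Unshelve. all: by end_near. Qed.

End WeakTrunc.
End Truncation.

(** * Positive parts, and derivatives on the zero set *)

Section PositivePart.
Context {R : realType} {N : nat}.
Notation E := 'rV[R]_N.
Notation B := (Borel R N).
Context (mu : {measure set B -> \bar R}) (Hmu : is_lebesgue mu).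
Context (Om : set E) (oOm : open Om) (i : 'I_N).

(** Product bumps on boxes inside [Om] already separate weak derivatives, by the fundamental
    lemma. *)
Lemma weak_deriv_unique (u g g' : B -> R) : locint mu Om g -> locint mu Om g' ->
  weak_deriv mu Om i u g -> weak_deriv mu Om i u g' ->
  {ae mu, forall x : B, Om x -> g x = g' x}.
Proof.
move=> [mg ig] [mg' ig'] W W'.
have iB a b : box a b `<=` Om -> mu.-integrable (box a b : set B) (EFin \o (fun x => g x - g' x)).
  move=> abOm; have cb : compact (box a b) by exact: box_compact.
  by apply: integrableB_EFin; [exact: measurable_box|exact: ig|exact: ig'].
suff H : {ae mu, forall x : B, Om x -> (fun x => g x - g' x) x = 0}.
  by apply: ae_imp H _ => x H /H /eqP; rewrite subr_eq0 => /eqP.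
apply: (ae_eq0_of_integral_boxbump Hmu oOm iB) => a b k abOm.
have tb : test_fun Om (boxbump a b k).
  apply: (@test_fun_tensor _ _ _ _ a b) => // [j|j t h].
    exact: smooth_bump.
  by apply: bump_out; apply: contraNN h => /andP[h1 h2]; rewrite !ltW.
have cb : compact (box a b) by exact: box_compact.
have mb := measurable_box a b.
have ob (x : E) : ~ box a b x -> boxbump a b k x = 0 by exact: boxbump_out.
have mphi := measurable_boxbump a b k.
have phi1 (x : B) : `|boxbump a b k x| <= 1 by rewrite ger0_norm ?boxbump_ge0 ?boxbump_le1.
have H0 : \int[mu]_x (cutoff (box a b) g x * boxbump a b k x) =
    \int[mu]_x (cutoff (box a b) g' x * boxbump a b k x).
  apply: oppr_inj; rewrite /Rintegral !(integral_cutoff mu abOm _ ob) -!fineN.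
  by rewrite -(W _ tb) -(W' _ tb).
have ic := integrableM_bounded (integrable_cutoff cb (ig _ cb abOm)) mphi phi1.
have ic' := integrableM_bounded (integrable_cutoff cb (ig' _ cb abOm)) mphi phi1.
rewrite integral_indicE.
transitivity (\int[mu]_x ((cutoff (box a b) g x * boxbump a b k x -
    cutoff (box a b) g' x * boxbump a b k x))%:E)%E.
  by apply: eq_integral => x _; congr EFin; rewrite /cutoff; ring.
have iBB := integrableB_EFin measurableT ic ic'.
rewrite -[LHS]fineK ?integrable_fin_num// -/(Rintegral _ _ _) RintegralB// H0.
by rewrite subrr.
Qed.

(** Almost everywhere convergence under one locally integrable bound suffices, since test functions
    have compact support. This serves both the truncations with levels tending to 0 and the running
    maxima. *)
Lemma weak_deriv_lim (v g : nat -> B -> R) (vl gl G : B -> R) :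
  (forall n, weak_deriv mu Om i (v n) (g n)) -> locint mu Om G ->
  (forall n, measurable_fun (Om : set B) (v n)) -> measurable_fun (Om : set B) vl ->
  (forall n, measurable_fun (Om : set B) (g n)) -> measurable_fun (Om : set B) gl ->
  (forall n, {ae mu, forall x : B, Om x -> `|v n x| <= G x /\ `|g n x| <= G x}) ->
  {ae mu, forall x : B, Om x -> v n x @[n --> \oo] --> vl x /\ g n x @[n --> \oo] --> gl x} ->
  weak_deriv mu Om i vl gl.
Proof.
move=> W [mG iG] mv mvl mg mgl bvg cvg phi tphi.
have [K [cK KOm phi0 dphi0]] := test_fun_support tphi.
have mK := compact_measurableB cK.
have mOm : measurable (Om : set B) by exact: open_measurableB.
have key (F : nat -> B -> R) (Fl p : B -> R) (M : R) :
    (forall x, ~ K x -> p x = 0) -> (forall x, `|p x| <= M) -> measurable_fun setT p ->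
    (forall n, {ae mu, forall x : B, Om x -> `|F n x| <= G x}) ->
    (forall n, measurable_fun (Om : set B) (F n)) -> measurable_fun (Om : set B) Fl ->
    {ae mu, forall x : B, Om x -> F n x @[n --> \oo] --> Fl x} ->
    (\int[mu]_(x in (Om : set B)) (F n x * p x)%:E @[n --> \oo] -->
     \int[mu]_(x in (Om : set B)) (Fl x * p x)%:E)%E.
  move=> p0 pM mp FG mF mFl cF.
  have iMG : mu.-integrable (Om : set B) (EFin \o (fun x => M * `|cutoff K G x|)).
    apply: (@integrableS _ _ _ mu setT) => //.
    apply: integrableZl_EFin => //.
    exact: (integrable_norm (integrable_cutoff cK (iG _ cK KOm))).
  have m1 n : measurable_fun (Om : set B) (fun x => (F n x * p x)%:E).
    by apply/measurable_EFinP; apply: measurable_funM => //; exact: measurable_funTS.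
  have m2 : measurable_fun (Om : set B) (fun x => (Fl x * p x)%:E).
    by apply/measurable_EFinP; apply: measurable_funM => //; exact: measurable_funTS.
  have c2 : {ae mu, forall x, Om x -> (F n x * p x)%:E @[n --> \oo] --> (Fl x * p x)%:E}.
    apply: ae_imp cF _ => x cF Omx; apply: cvg_EFin; first by near=> n.
    by apply: cvgM; [exact: cF|exact: cvg_cst].
  have b2 : {ae mu, forall x n, Om x -> (`|(F n x * p x)%:E| <= (M * `|cutoff K G x|)%:E)%E}.
    apply: ae_imp (ae_foralln FG) _ => x FGx n Omx.
    rewrite lee_fin normrM mulrC /cutoff indicE.
    have [Kx|nKx] := pselect (K x); last first.
      by rewrite p0// normr0 mul0r mulr_ge0// (le_trans _ (pM x)).
    by rewrite mem_set// mulr1 ler_pM// (le_trans (FGx n Omx))// ler_norm.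
  by have [_ _] := dominated_convergence mOm m1 m2 c2 iMG b2.
have [M1 _ HM1] := compact_support_bounded (test_fun_continuous tphi) cK phi0.
have [M2 _ HM2] := compact_support_bounded (test_fun_partial_continuous tphi (i:=i)) cK (dphi0 i).
have mphi : measurable_fun setT (phi : B -> R).
  by apply: continuous_measurableB; exact: test_fun_continuous tphi.
have mpart : measurable_fun setT (partial i phi : B -> R).
  by apply: continuous_measurableB; exact: test_fun_partial_continuous tphi i.
have lim1 : (\int[mu]_(x in (Om : set B)) (v n x * partial i phi x)%:E @[n --> \oo] -->
     \int[mu]_(x in (Om : set B)) (vl x * partial i phi x)%:E)%E.
  apply: key (dphi0 i) HM2 mpart _ mv mvl _.
    by move=> n; apply: ae_imp (bvg n) _ => x h /h[].
  by apply: ae_imp cvg _ => x h /h[].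
have lim2 : (\int[mu]_(x in (Om : set B)) (g n x * phi x)%:E @[n --> \oo] -->
     \int[mu]_(x in (Om : set B)) (gl x * phi x)%:E)%E.
  apply: key phi0 HM1 mphi _ mg mgl _.
    by move=> n; apply: ae_imp (bvg n) _ => x h /h[].
  by apply: ae_imp cvg _ => x h /h[].
have lim3 : (\int[mu]_(x in (Om : set B)) (v n x * partial i phi x)%:E @[n --> \oo]
    --> - \int[mu]_(x in (Om : set B)) (gl x * phi x)%:E)%E.
  rewrite (_ : (fun n => _) = (fun n =>
      - \int[mu]_(x in (Om : set B)) (g n x * phi x)%:E)%E); last first.
    by apply/funext => n; exact: W tphi.
  exact: cvgeN lim2.
exact: (cvg_unique (@ereal_hausdorff R) lim1 lim3).
Unshelve. all: by end_near. Qed.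

Section Pos.
Context (u g : B -> R) (lu : locint mu Om u) (lg : locint mu Om g)
  (W : weak_deriv mu Om i u g).

Let limit_trunc (c : nat -> R) (v l : B -> R) : (forall n, `|c n| <= 1) ->
  measurable_fun (Om : set B) v -> measurable_fun (Om : set B) l ->
  (forall x : B, trunc (c n) (u x) @[n --> \oo] --> v x) ->
  (forall x : B, trunc_deriv (c n) (u x) (g x) @[n --> \oo] --> l x) ->
  weak_deriv mu Om i v l.
Proof.
move=> c1 mv ml cv cl.
have mOm : measurable (Om : set B) by exact: open_measurableB.
have [mu_ iu] := lu; have [mg ig] := lg.
(* This bound holds for all levels at once because |c n| <= 1. *)
have lG : locint mu Om (fun x => (`|u x| + 1) + `|g x|).
  split=> [|K cK KOm].
    by apply: measurable_funD; [apply: measurable_funD => //|]; exact: measurableT_comp.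
  have mK := compact_measurableB cK.
  apply: integrableD_EFin => //; last exact: (integrable_norm (ig _ cK KOm)).
  apply: integrableD_EFin => //; first exact: (integrable_norm (iu _ cK KOm)).
  apply: measurable_bounded_integrable => //; first exact: compact_mu_lty.
  by exists 1; split; [exact: num_real|move=> y cy x _; rewrite /= normr1 ltW].
apply: (weak_deriv_lim (fun n => weak_deriv_trunc Hmu oOm (c n) lu lg W) lG) => //.
- by move=> n; case: (locint_trunc Hmu (c n) lu).
- by move=> n; exact: measurable_trunc_deriv.
- move=> n; apply: aeW => x _; split.
    by rewrite (le_trans (trunc_norm_le _ _))// -addrA lerD2l (le_trans (c1 n))// lerDl.
  by rewrite (le_trans (trunc_deriv_le _ _ _))// lerDr addr_ge0.
- by apply: aeW => x _; split.
Qed.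

(** With levels above 0, points where u = 0 lie strictly below every level, and a point where u > 0
    is strictly above all but finitely many; the case t = c of [trunc_deriv] does not survive. *)
Lemma weak_deriv_pos :
  weak_deriv mu Om i (fun x => Num.max (u x) 0) (fun x => if 0 < u x then g x else 0).
Proof.
have [mu_ iu] := lu; have [mg ig] := lg.
apply: (@limit_trunc (fun n => n.+1%:R^-1)).
- by move=> n; rewrite ger0_norm ?invr_ge0// invf_le1 ?ler1n.
- exact: measurable_maxr.
- apply: measurable_fun_if => //; first exact: open_measurableB.
  + exact: measurable_fun_ltr.
  + exact: (measurable_funS (open_measurableB oOm) (@subIsetl _ _ _) mg).
- move=> x; rewrite /trunc.
  have H : u x - n.+1%:R^-1 @[n --> \oo] --> u x.
    rewrite -[X in _ --> X]subr0; apply: cvgB; [exact: cvg_cst|exact: cvg_harmonic].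
  apply: (@cvg_comp _ _ _ _ (fun t : R => Num.max t 0) _ _ _ H).
  exact: (@continuous_max R R (id : R -> R^o) (cst 0) (u x) (@cvg_id _ _) (@cst_continuous _ _ _ _)).
- move=> x; case: ifPn => [ux|]; last rewrite -leNgt => ux.
    have /cvgrPdist_lt/(_ _ ux) := @cvg_harmonic R => H.
    apply: cvg_trans (@cvg_cst _ (g x) nat \oo _); apply: near_eq_cvg; near=> n.
    have : `|0 - n.+1%:R^-1| < u x by near: n.
    by rewrite sub0r normrN ger0_norm// /trunc_deriv => ->.
  apply: cvg_trans (@cvg_cst _ (0 : R) nat \oo _); apply: near_eq_cvg; near=> n.
  have n0 : 0 < n.+1%:R^-1 :> R by rewrite invr_gt0.
  by rewrite /trunc_deriv ltNge (le_trans ux (ltW n0))/= lt_eqF// (le_lt_trans ux).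
Unshelve. all: by end_near. Qed.

(** With levels below 0, points where u = 0 lie strictly above every level and keep the value g. *)
Lemma weak_deriv_pos_ge :
  weak_deriv mu Om i (fun x => Num.max (u x) 0) (fun x => if 0 <= u x then g x else 0).
Proof.
have [mu_ iu] := lu; have [mg ig] := lg.
apply: (@limit_trunc (fun n => - n.+1%:R^-1)).
- by move=> n; rewrite normrN ger0_norm ?invr_ge0// invf_le1 ?ler1n.
- exact: measurable_maxr.
- apply: measurable_fun_if => //; first exact: open_measurableB.
  + exact: measurable_fun_ler.
  + exact: (measurable_funS (open_measurableB oOm) (@subIsetl _ _ _) mg).
- move=> x; rewrite /trunc.
  have H : u x - (- n.+1%:R^-1) @[n --> \oo] --> u x.
    rewrite -[X in _ --> X]subr0 -oppr0; apply: cvgB; first exact: cvg_cst.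
    by apply: cvgN; exact: cvg_harmonic.
  apply: (@cvg_comp _ _ _ _ (fun t : R => Num.max t 0) _ _ _ H).
  exact: (@continuous_max R R (id : R -> R^o) (cst 0) (u x) (@cvg_id _ _) (@cst_continuous _ _ _ _)).
- move=> x; case: ifPn => [ux|]; last rewrite -ltNge => ux.
    apply: cvg_trans (@cvg_cst _ (g x) nat \oo _); apply: near_eq_cvg; near=> n.
    have n0 : - n.+1%:R^-1 < 0 :> R by rewrite oppr_lt0 invr_gt0.
    by rewrite /trunc_deriv (lt_le_trans n0).
  have ux' : 0 < - u x by rewrite oppr_gt0.
  have /cvgrPdist_lt/(_ _ ux') := @cvg_harmonic R => H.
  apply: cvg_trans (@cvg_cst _ (0 : R) nat \oo _); apply: near_eq_cvg; near=> n.
  have : `|0 - n.+1%:R^-1| < - u x by near: n.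
  rewrite sub0r normrN ger0_norm// ltrNr => h.
  by rewrite /trunc_deriv ltNge ltW//= lt_eqF.
Unshelve. all: by end_near. Qed.

(** The two weak derivatives of u^+ just obtained differ exactly by g on {u = 0}; uniqueness
    concludes. *)
Lemma weak_deriv_zero : {ae mu, forall x : B, Om x -> u x = 0 -> g x = 0}.
Proof.
have mOm : measurable (Om : set B) by exact: open_measurableB.
have [mu_ iu] := lu; have [mg ig] := lg.
have lif (b : B -> bool) : measurable_fun (Om : set B) b -> locint mu Om (fun x => if b x then g x else 0).
  move=> mb; have mif : measurable_fun (Om : set B) (fun x => if b x then g x else 0).
    apply: measurable_fun_if => //.
    by apply: measurable_funS mg => //; exact: subIsetl.
  split=> // K cK KOm; have mK := compact_measurableB cK.
  apply: (dominated_integrable_EFin mK _ (ig _ cK KOm)); first exact: measurable_funS mif.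
  by move=> x _; case: ifP; rewrite ?normr0.
have H := weak_deriv_unique (lif (fun x => 0 < u x) (measurable_fun_ltr _ _))
  (lif (fun x => 0 <= u x) (measurable_fun_ler _ _)) weak_deriv_pos weak_deriv_pos_ge.
apply: ae_imp (H _ _ _ _) _ => // x /= h Omx ux; have := h Omx.
by rewrite ux ltxx lexx.
Qed.

End Pos.
End PositivePart.

(** * Energies and weak gradients *)

Section PowerIntegrals.
Context {R : realType} {N : nat} (p : R) (p1 : 1 < p).
Notation E := 'rV[R]_N.
Notation B := (Borel R N).

Let p0 : 0 <= p. Proof. by rewrite (le_trans _ (ltW p1)). Qed.

Lemma powR_le (a b : R) : 0 <= a -> a <= b -> a `^ p <= b `^ p.
Proof. by move=> a0 ab; apply: ge0_ler_powR => //; rewrite nnegrE// (le_trans a0). Qed.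

(** From (2 max(a, b))^p = 2^p max(a^p, b^p). This crude constant stands in for Minkowski's
    inequality: sums of functions are only ever required to be finite or small in energy. *)
Lemma powRD_le (a b c : R) : 0 <= a -> 0 <= b -> 0 <= c -> c <= 2 * Num.max a b ->
  c `^ p <= 2 `^ p * (a `^ p + b `^ p).
Proof.
move=> a0 b0 c0 cab; apply: le_trans (powR_le c0 cab) _.
rewrite powRM// ?le_max ?a0// ler_wpM2l ?powR_ge0//.
by have [_|_] := leP a b; rewrite ?lerDl ?lerDr powR_ge0.
Qed.

Lemma powR_normD (a b : R) : `|a + b| `^ p <= 2 `^ p * (`|a| `^ p + `|b| `^ p).
Proof.
apply: powRD_le => //; apply: le_trans (ler_normD _ _) _.
by have [h|h] := leP `|a| `|b|; lra.
Qed.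

(** With it, p-integrable functions are seen to be locally integrable without Hoelder's
    inequality. *)
Lemma le_1powR (a : R) : 0 <= a -> a <= 1 + a `^ p.
Proof.
move=> a0; have [a1|a1] := leP a 1; first by rewrite (le_trans a1)// lerDl powR_ge0.
have : a `^ 1 <= a `^ p by apply: ler_powR; exact: ltW.
by rewrite powRr1//; lra.
Qed.

Definition gnorm (g : 'I_N -> E -> R) (x : E) : R := Num.sqrt (\sum_(i < N) g i x ^+ 2).

Lemma gnorm_ge0 g x : 0 <= gnorm g x. Proof. exact: sqrtr_ge0. Qed.

Lemma gnorm_coord g i x : `|g i x| <= gnorm g x.
Proof.
rewrite -sqrtr_sqr ler_wsqrtr// (bigD1 i)//= lerDl.
by apply: sumr_ge0 => j _; exact: sqr_ge0.
Qed.

Lemma gnorm_le_sum g x : gnorm g x <= \sum_(i < N) `|g i x|.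
Proof.
have s0 : 0 <= \sum_(i < N) `|g i x| by apply: sumr_ge0.
rewrite -(ger0_norm s0) -sqrtr_sqr ler_wsqrtr//.
elim: (index_enum _) => [|j s IH]; first by rewrite !big_nil expr0n.
rewrite !big_cons sqrrD real_normK ?num_real// -addrA lerD2l (le_trans IH)// lerDr.
by rewrite mulrn_wge0// mulr_ge0// sumr_ge0.
Qed.

Lemma gnormD g h x : gnorm (fun i x => g i x + h i x) x <= 2 * Num.max (gnorm g x) (gnorm h x).
Proof.
have m0 : 0 <= 2 * Num.max (gnorm g x) (gnorm h x) by rewrite mulr_ge0// le_max gnorm_ge0.
rewrite -(ger0_norm m0) -sqrtr_sqr; apply: ler_wsqrtr.
have S0 (f : 'I_N -> E -> R) : 0 <= \sum_(i < N) f i x ^+ 2 by apply: sumr_ge0 => j _; exact: sqr_ge0.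
apply: (@le_trans _ _ (2 * (\sum_(i < N) g i x ^+ 2 + \sum_(i < N) h i x ^+ 2))).
  rewrite -big_split mulr_sumr; apply: ler_sum => j _ /=.
  by have := sqr_ge0 (g j x - h j x); rewrite sqrrB sqrrD; lra.
have SE (f : 'I_N -> E -> R) : \sum_(i < N) f i x ^+ 2 = gnorm f x ^+ 2.
  by rewrite /gnorm sqr_sqrtr.
rewrite !SE exprMn.
have H (a b : R) : 0 <= a -> a <= b -> a ^+ 2 <= b ^+ 2.
  by move=> a0 ab; rewrite lerXn2r// nnegrE// (le_trans a0).
have [/(H _ _ (gnorm_ge0 g x)) h1|/ltW/(H _ _ (gnorm_ge0 h x)) h1] := leP (gnorm g x) (gnorm h x).
  by lra.
by lra.
Qed.

Lemma gnormZ k g x : gnorm (fun i x => k * g i x) x = `|k| * gnorm g x.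
Proof.
rewrite /gnorm -sqrtr_sqr -sqrtrM ?sqr_ge0// mulr_sumr; congr Num.sqrt.
by apply: eq_bigr => i _; rewrite exprMn.
Qed.

Lemma eq_gnorm g h x : (forall i, g i x = h i x) -> gnorm g x = gnorm h x.
Proof. by move=> gh; rewrite /gnorm; congr Num.sqrt; apply: eq_bigr => i _; rewrite gh. Qed.

Definition energy (u : E -> R) (g : 'I_N -> E -> R) (x : E) : R :=
  `|u x| `^ p + gnorm g x `^ p.

Lemma energy_ge0 u g x : 0 <= energy u g x.
Proof. by rewrite addr_ge0 ?powR_ge0. Qed.

Lemma eq_energy u g v h x : u x = v x -> (forall i, g i x = h i x) ->
  energy u g x = energy v h x.
Proof. by move=> uv gh; rewrite /energy uv (eq_gnorm gh). Qed.

Lemma energyD u g v h x :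
  energy (fun x => u x + v x) (fun i x => g i x + h i x) x <=
  2 `^ p * (energy u g x + energy v h x).
Proof.
rewrite /energy addrACA mulrDr; apply: lerD (powR_normD _ _) _.
exact: powRD_le (gnorm_ge0 g x) (gnorm_ge0 h x) (gnorm_ge0 _ x) (gnormD g h x).
Qed.

Lemma energyZ k u g x :
  energy (fun x => k * u x) (fun i x => k * g i x) x = `|k| `^ p * energy u g x.
Proof. by rewrite /energy gnormZ normrM !powRM// ?gnorm_ge0// mulrDr. Qed.

Lemma energyB u g v h x :
  energy (fun x => u x - v x) (fun i x => g i x - h i x) x <=
  2 `^ p * (energy u g x + energy v h x).
Proof.
have := energyD u g (fun x => -1 * v x) (fun i x => -1 * h i x) x.
rewrite (energyZ (-1) v h) normrN1 powR1 mul1r; congr (_ <= _).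
by apply: eq_energy => [|i]; rewrite mulN1r.
Qed.

End PowerIntegrals.

Section Lp.
Context {R : realType} {N : nat}.
Notation E := 'rV[R]_N.
Notation B := (Borel R N).
Context (mu : {measure set B -> \bar R}) (Hmu : is_lebesgue mu).
Context (Om : set E) (oOm : open Om) (p : R) (p1 : 1 < p).

Let p0 : 0 <= p. Proof. by rewrite (le_trans _ (ltW p1)). Qed.
Let mOm : measurable (Om : set B). Proof. exact: open_measurableB. Qed.

Definition Lp (f : E -> R) : Prop :=
  measurable_fun (Om : set B) (f : B -> R) /\
  (\int[mu]_(x in (Om : set B)) (`|f x| `^ p)%:E < +oo)%E.

Lemma measurable_normpow (f : B -> R) : measurable_fun (Om : set B) f ->
  measurable_fun (Om : set B) (fun x => `|f x| `^ p).
Proof.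
move=> mf; apply: (measurableT_comp (measurable_powR p)).
by apply: measurableT_comp => //.
Qed.

Lemma Lp_integrable (f : E -> R) : Lp f ->
  mu.-integrable (Om : set B) (EFin \o (fun x => `|f x| `^ p)).
Proof.
move=> [mf fi]; apply/integrableP; split.
  by apply/measurable_EFinP; exact: measurable_normpow.
move: fi; congr (_ < _)%E; apply: eq_integral => x _ /=.
by rewrite [X in _ = X%:E]ger0_norm ?powR_ge0.
Qed.

Lemma Lp_dominated (f G : E -> R) : measurable_fun (Om : set B) (f : B -> R) ->
  mu.-integrable (Om : set B) (EFin \o G) ->
  {ae mu, forall x : B, Om x -> `|f x| `^ p <= G x} -> Lp f.
Proof.
move=> mf /integrableP[mG iG] fG; split=> //; apply: le_lt_trans iG.
apply: ae_ge0_le_integral => //.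
- by apply/measurable_EFinP; exact: measurable_normpow.
- exact: measurableT_comp.
- by apply: ae_imp fG _ => x h Omx; rewrite /= lee_fin (le_trans (h Omx))// ler_norm.
Qed.

Lemma LpD (f g : E -> R) : Lp f -> Lp g -> Lp (fun x => f x + g x).
Proof.
move=> Lf Lg; have [mf _] := Lf; have [mg _] := Lg.
apply: (Lp_dominated _ (integrableZl_EFin mOm (integrableD_EFin mOm (Lp_integrable Lf) (Lp_integrable Lg)) (2 `^ p))).
  exact: measurable_funD.
by apply: aeW => x _; exact: powR_normD.
Qed.

Lemma LpZ (k : R) (f : E -> R) : Lp f -> Lp (fun x => k * f x).
Proof.
move=> Lf; have [mf _] := Lf.
apply: (Lp_dominated _ (integrableZl_EFin mOm (Lp_integrable Lf) (`|k| `^ p))).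
  exact: measurable_funM.
by apply: aeW => x _; rewrite normrM powRM.
Qed.

Lemma Lp_norm_le (f g : E -> R) : measurable_fun (Om : set B) (f : B -> R) -> Lp g ->
  (forall x, `|f x| <= `|g x|) -> Lp f.
Proof.
move=> mf Lg fg; apply: (Lp_dominated mf (Lp_integrable Lg)).
by apply: aeW => x _; apply: powR_le.
Qed.

Lemma Lp0 : Lp (fun=> 0).
Proof.
split; first exact: measurable_cst.
by rewrite normr0 powR0 ?gt_eqF ?(lt_trans _ p1)// integral0 ltry.
Qed.

Lemma Lp_locint (f : E -> R) : Lp f -> locint mu Om f.
Proof.
move=> Lf; have [mf _] := Lf; split=> // K cK KOm.
have mK := compact_measurableB cK.
have i1 : mu.-integrable (K : set B) (EFin \o cst 1).
  apply: measurable_bounded_integrable => //; first exact: compact_mu_lty.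
  by exists 1; split; [exact: num_real|move=> y cy x _; rewrite /= normr1 ltW].
have iK : mu.-integrable (K : set B) (EFin \o (fun x => `|f x| `^ p)).
  exact: (integrableS mOm mK KOm (Lp_integrable Lf)).
apply: (dominated_integrable_EFin mK _ (integrableD_EFin mK i1 iK)).
  exact: measurable_funS mf.
by move=> x _; rewrite (ger0_norm (addr_ge0 _ (powR_ge0 _ _)))//= le_1powR.
Qed.

Lemma measurable_gnorm (g : 'I_N -> E -> R) :
  (forall i, measurable_fun (Om : set B) (g i : B -> R)) ->
  measurable_fun (Om : set B) (gnorm g : B -> R).
Proof.
move=> mg; apply: (measurableT_comp (continuous_measurable_fun (@sqrt_continuous R))).
elim: (index_enum _) => [|j s IH].
  rewrite (_ : (fun x => _) = cst 0); first exact: measurable_cst.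
  by apply/funext => x; rewrite big_nil.
rewrite (_ : (fun x => _) = (fun x => g j x ^+ 2 + \sum_(i <- s) g i x ^+ 2)); last first.
  by apply/funext => x; rewrite big_cons.
by apply: measurable_funD => //; exact: measurable_funX.
Qed.

(** Measurability of the components is kept on the right, since that of the length does not imply
    it. *)
Lemma Lp_gnorm (g : 'I_N -> E -> R) : (forall i, Lp (g i)) <->
  (forall i, measurable_fun (Om : set B) (g i : B -> R)) /\ Lp (gnorm g).
Proof.
split=> [Lg|[mg Lg] i].
  have mg i : measurable_fun (Om : set B) (g i : B -> R) by case: (Lg i).
  split=> //; apply: (Lp_norm_le (g := fun x => \sum_(i < N) `|g i x|)).
  - exact: measurable_gnorm.
  - elim: (index_enum _) => [|j s IH].
      rewrite (_ : (fun x => _) = cst 0); first exact: Lp0.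
      by apply/funext => x; rewrite big_nil.
    rewrite (_ : (fun x => _) = (fun x => `|g j x| + \sum_(i <- s) `|g i x|)); last first.
      by apply/funext => x; rewrite big_cons.
    apply: LpD IH; apply: Lp_norm_le (Lg j) _; first exact: measurableT_comp.
    by move=> x; rewrite normr_id.
  - move=> x; rewrite ger0_norm ?gnorm_ge0// ger0_norm ?sumr_ge0//; exact: gnorm_le_sum.
apply: Lp_norm_le Lg _ => // x; rewrite [leRHS]ger0_norm ?gnorm_ge0//.
exact: gnorm_coord.
Qed.

End Lp.

(** * Calculus of weak gradients and of their energies *)

Section WeakGradient.
Context {R : realType} {N : nat}.
Notation E := 'rV[R]_N.
Notation B := (Borel R N).
Context (mu : {measure set B -> \bar R}) (Hmu : is_lebesgue mu).
Context (Om : set E) (oOm : open Om) (p : R) (p1 : 1 < p).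
Implicit Types (u v w : E -> R) (g h : 'I_N -> E -> R).

Let mOm : measurable (Om : set B). Proof. exact: open_measurableB. Qed.

Notation WG := (is_weak_grad mu Om p).
Notation Lp := (Lp mu Om p).
Notation energy := (energy p).
Notation Wn := (Wnormp mu Om p).

Let Lp_local (f : E -> R) : Lp f -> locint mu Om f.
Proof. exact: (Lp_locint Hmu oOm p1). Qed.

Lemma weak_gradP u g : WG u g <->
  [/\ Lp u, forall i, Lp (g i) & forall i, weak_deriv mu Om i u (g i)].
Proof.
split=> [[mu_ [iu [ig W]]]|[[mu_ iu] ig W]].
  by split=> // i phi tphi; exact: W.
by split=> //; split=> //; split=> // phi tphi i; exact: W.
Qed.

Lemma WnormpE u g : Wn u g = (\int[mu]_(x in (Om : set B)) (energy u g x)%:E)%E.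
Proof. by []. Qed.

Lemma energy_integrable u g : Lp u -> (forall i, Lp (g i)) ->
  mu.-integrable (Om : set B) (EFin \o energy u g).
Proof.
move=> Lu Lg'; have [_ Lg] := proj1 (Lp_gnorm mu oOm p1 g) Lg'.
have := integrableD_EFin mOm (Lp_integrable Lu) (Lp_integrable Lg).
by apply: eq_integrable => // x _; rewrite /= /energy (ger0_norm (gnorm_ge0 g x)).
Qed.

Lemma weak_grad_energy_integrable u g : WG u g -> mu.-integrable (Om : set B) (EFin \o energy u g).
Proof. by move=> /weak_gradP[Lu Lg _]; exact: energy_integrable. Qed.

Lemma Lp_of_energy u g (G : E -> R) : measurable_fun (Om : set B) (u : B -> R) ->
  (forall i, measurable_fun (Om : set B) (g i : B -> R)) ->
  mu.-integrable (Om : set B) (EFin \o G) ->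
  {ae mu, forall x : B, Om x -> energy u g x <= G x} -> Lp u /\ forall i, Lp (g i).
Proof.
move=> mu_ mg iG uG; split=> [|i].
  apply: (Lp_dominated oOm mu_ iG); apply: ae_imp uG _ => x h Omx.
  by apply: le_trans (h Omx); rewrite lerDl powR_ge0.
apply: (Lp_dominated oOm (mg i) iG); apply: ae_imp uG _ => x h Omx.
apply: le_trans (h Omx); apply: (@le_trans _ _ (gnorm g x `^ p)); last by rewrite lerDr powR_ge0.
by apply: powR_le => //; exact: gnorm_coord.
Qed.

Lemma measurable_energy u g : measurable_fun (Om : set B) (u : B -> R) ->
  (forall i, measurable_fun (Om : set B) (g i : B -> R)) ->
  measurable_fun (Om : set B) (energy u g : B -> R).
Proof.
move=> mu_ mg; apply: measurable_funD; first exact: measurable_normpow.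
apply: (measurableT_comp (measurable_powR p)).
exact: measurable_gnorm.
Qed.

Lemma Wnormp_lty u g : WG u g -> (Wn u g < +oo)%E.
Proof.
move=> /weak_grad_energy_integrable /integrableP[_]; congr (_ < _)%E.
by apply: eq_integral => x _ /=; rewrite ger0_norm ?energy_ge0.
Qed.

Lemma weak_grad_measurable u g : WG u g -> measurable_fun (Om : set B) (u : B -> R) /\
  forall i, measurable_fun (Om : set B) (g i : B -> R).
Proof. by move=> /weak_gradP[[mu_ _] Lg _]; split=> // i; case: (Lg i). Qed.

Lemma le_Wnormp u g (G : E -> R) : measurable_fun (Om : set B) (u : B -> R) ->
  (forall i, measurable_fun (Om : set B) (g i : B -> R)) ->
  measurable_fun (Om : set B) (G : B -> R) ->
  {ae mu, forall x : B, Om x -> energy u g x <= G x} ->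
  (forall x, 0 <= G x) ->
  (Wn u g <= \int[mu]_(x in (Om : set B)) (G x)%:E)%E.
Proof.
move=> mu_ mg mG uG G0; rewrite WnormpE; apply: ae_ge0_le_integral => //.
- by move=> x _; rewrite lee_fin energy_ge0.
- by apply/measurable_EFinP; exact: measurable_energy.
- by move=> x _; rewrite lee_fin.
- exact/measurable_EFinP.
Qed.

Lemma integrable_test (F q : E -> R) (K : set E) (M : R) : locint mu Om F ->
  compact K -> K `<=` Om -> (forall x, ~ K x -> q x = 0) -> (forall x, `|q x| <= M) ->
  measurable_fun setT (q : B -> R) ->
  mu.-integrable (Om : set B) (EFin \o (fun x => F x * q x)).
Proof.
move=> [_ iF] cK KOm q0 qM mq.
have := integrableM_bounded (integrable_cutoff cK (iF _ cK KOm)) mq qM.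
move=> /(integrableS measurableT mOm (@subsetT _ _)).
apply: eq_integrable => // x _; rewrite /= /cutoff indicE; congr EFin.
have [Kx|nKx] := pselect (K x); first by rewrite mem_set// mulr1.
by rewrite q0// !mulr0.
Qed.

Lemma test_fun_integrable i (F : E -> R) phi : locint mu Om F -> test_fun Om phi ->
  mu.-integrable (Om : set B) (EFin \o (fun x => F x * phi x)) /\
  mu.-integrable (Om : set B) (EFin \o (fun x => F x * partial i phi x)).
Proof.
move=> lF tphi; have [K [cK KOm phi0 dphi0]] := test_fun_support tphi.
have [M1 _ HM1] := compact_support_bounded (test_fun_continuous tphi) cK phi0.
have [M2 _ HM2] := compact_support_bounded (test_fun_partial_continuous tphi (i:=i)) cK (dphi0 i).
split.
- apply: integrable_test cK KOm phi0 HM1 _ => //.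
  by apply: continuous_measurableB; exact: test_fun_continuous tphi.
- apply: integrable_test cK KOm (dphi0 i) HM2 _ => //.
  by apply: continuous_measurableB; exact: test_fun_partial_continuous tphi i.
Qed.

Lemma weak_derivD i (u g v h : E -> R) : locint mu Om u -> locint mu Om g ->
  locint mu Om v -> locint mu Om h -> weak_deriv mu Om i u g -> weak_deriv mu Om i v h ->
  weak_deriv mu Om i (fun x => u x + v x) (fun x => g x + h x).
Proof.
move=> lu lg lv lh W1 W2 phi tphi.
have [_ iu] := test_fun_integrable i lu tphi; have [_ iv] := test_fun_integrable i lv tphi.
have [ig _] := test_fun_integrable i lg tphi; have [ih _] := test_fun_integrable i lh tphi.
transitivity (\int[mu]_(x in (Om : set B)) (u x * partial i phi x + v x * partial i phi x)%:E)%E.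
  by apply: eq_integral => x _; rewrite mulrDl.
rewrite integralD_EFin// W1// W2//.
transitivity (- \int[mu]_(x in (Om : set B)) (g x * phi x + h x * phi x)%:E)%E; last first.
  by congr (- _)%E; apply: eq_integral => x _; rewrite mulrDl.
rewrite integralD_EFin// oppeD// fin_num_adde_defl//; exact: integrable_fin_num.
Qed.

Lemma weak_derivZ i (k : R) (u g : E -> R) : locint mu Om u -> locint mu Om g ->
  weak_deriv mu Om i u g -> weak_deriv mu Om i (fun x => k * u x) (fun x => k * g x).
Proof.
move=> lu lg W phi tphi.
have [_ iu] := test_fun_integrable i lu tphi; have [ig _] := test_fun_integrable i lg tphi.
transitivity (\int[mu]_(x in (Om : set B)) (k%:E * (u x * partial i phi x)%:E))%E.
  by apply: eq_integral => x _; rewrite -mulrA.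
rewrite integralZl// W//.
transitivity (- \int[mu]_(x in (Om : set B)) (k%:E * (g x * phi x)%:E))%E; last first.
  by congr (- _)%E; apply: eq_integral => x _; rewrite -mulrA.
by rewrite integralZl// muleN.
Qed.

Lemma weak_gradD u g v h : WG u g -> WG v h ->
  WG (fun x => u x + v x) (fun i x => g i x + h i x).
Proof.
move=> /weak_gradP[Lu Lg Wu] /weak_gradP[Lv Lh Wv]; apply/weak_gradP; split.
- exact: (LpD oOm p1 Lu Lv).
- by move=> i; exact: (LpD oOm p1 (Lg i) (Lh i)).
- move=> i; exact: (weak_derivD (Lp_local Lu) (Lp_local (Lg i)) (Lp_local Lv) (Lp_local (Lh i)) (Wu i) (Wv i)).
Qed.

Lemma weak_gradZ k u g : WG u g -> WG (fun x => k * u x) (fun i x => k * g i x).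
Proof.
move=> /weak_gradP[Lu Lg Wu]; apply/weak_gradP; split.
- exact: (LpZ oOm k Lu).
- by move=> i; exact: (LpZ oOm k (Lg i)).
- move=> i; exact: (weak_derivZ k (Lp_local Lu) (Lp_local (Lg i)) (Wu i)).
Qed.

Lemma weak_gradB u g v h : WG u g -> WG v h ->
  WG (fun x => u x - v x) (fun i x => g i x - h i x).
Proof.
move=> Wu Wv; have := weak_gradD Wu (weak_gradZ (-1) Wv).
congr is_weak_grad; first by apply/funext => x; rewrite mulN1r.
by apply/funext => i; apply/funext => x; rewrite mulN1r.
Qed.

Lemma weak_grad_unique u g h : WG u g -> WG u h ->
  {ae mu, forall x : B, Om x -> forall i, g i x = h i x}.
Proof.
move=> /weak_gradP[Lu Lg Wu] /weak_gradP[_ Lh Wh].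
have H i : {ae mu, forall x : B, Om x -> g i x = h i x}.
  exact: (weak_deriv_unique Hmu oOm (Lp_local (Lg i)) (Lp_local (Lh i)) (Wu i) (Wh i)).
by apply: ae_imp (ae_all_fin H) _ => x Hx Omx i; exact: Hx.
Qed.

Lemma weak_grad_zero u g : WG u g ->
  {ae mu, forall x : B, Om x -> u x = 0 -> forall i, g i x = 0}.
Proof.
move=> /weak_gradP[Lu Lg Wu].
have H i : {ae mu, forall x : B, Om x -> u x = 0 -> g i x = 0}.
  exact: (weak_deriv_zero Hmu oOm (Lp_local Lu) (Lp_local (Lg i)) (Wu i)).
by apply: ae_imp (ae_all_fin H) _ => x Hx Omx ux i; exact: Hx.
Qed.

Lemma measurable_select (f k q r : B -> R) : measurable_fun (Om : set B) f ->
  measurable_fun (Om : set B) k -> measurable_fun (Om : set B) q ->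
  measurable_fun (Om : set B) r ->
  measurable_fun (Om : set B) (fun x => if f x < k x then q x else r x).
Proof.
move=> mf mk mq mr; apply: measurable_fun_if => //; first exact: measurable_fun_ltr.
  exact: (measurable_funS mOm (@subIsetl _ _ _) mq).
exact: (measurable_funS mOm (@subIsetl _ _ _) mr).
Qed.

Lemma weak_grad_pos u g : WG u g ->
  WG (fun x => Num.max (u x) 0) (fun i x => if 0 < u x then g i x else 0).
Proof.
move=> /weak_gradP[Lu Lg Wu]; apply/weak_gradP; split.
- apply: (Lp_norm_le oOm p1 _ Lu) => [|x].
    by apply: measurable_maxr => //; case: Lu.
  by have [h|h] := leP (u x) 0; rewrite ?normr0.
- move=> i; apply: (Lp_norm_le oOm p1 _ (Lg i)) => [|x].
    by apply: measurable_select => //; [case: Lu|case: (Lg i)].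
  by case: ifP; rewrite ?normr0.
- move=> i; exact: (weak_deriv_pos Hmu oOm (Lp_local Lu) (Lp_local (Lg i)) (Wu i)).
Qed.

Lemma weak_grad_max u g v h : WG u g -> WG v h ->
  WG (fun x => Num.max (u x) (v x)) (fun i x => if v x < u x then g i x else h i x).
Proof.
move=> Wu Wv; have := weak_gradD (weak_grad_pos (weak_gradB Wu Wv)) Wv.
congr is_weak_grad.
  apply/funext => x; have [h1|h1] := leP (u x - v x) 0.
    by rewrite add0r max_r// -subr_le0.
  by rewrite subrK max_l// ltW// -subr_gt0.
apply/funext => i; apply/funext => x; rewrite subr_gt0.
by case: ifP => _; rewrite ?subrK ?add0r.
Qed.

Lemma energy_max u g v h x : energy (fun x => Num.max (u x) (v x))
    (fun i x => if v x < u x then g i x else h i x) x =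
  if v x < u x then energy u g x else energy v h x.
Proof.
case: ifP => vu; apply: eq_energy => [|i]; rewrite ?vu//.
  by rewrite max_l// ltW.
by rewrite max_r// leNgt vu.
Qed.

(** The constant is 1, against 2^p in [WnormpD]; with a larger one the capacity formula would come
    out only up to a factor. *)
Lemma Wnormp_max u g v h : WG u g -> WG v h ->
  (Wn (fun x => Num.max (u x) (v x)) (fun i x => if (v x < u x)%R then g i x else h i x)
   <= Wn u g + Wn v h)%E.
Proof.
move=> Wu Wv; have [mu_ mg] := weak_grad_measurable Wu; have [mv mh] := weak_grad_measurable Wv.
rewrite !WnormpE -integralD_EFin//; last 2 first.
  exact: weak_grad_energy_integrable.
  exact: weak_grad_energy_integrable.
have [mM mGM] := weak_grad_measurable (weak_grad_max Wu Wv).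
apply: le_Wnormp => //.
- by apply: measurable_funD; exact: measurable_energy.
- apply: aeW => x _; rewrite energy_max; case: ifP => _; rewrite ?lerDl ?lerDr energy_ge0//.
- by move=> x; rewrite addr_ge0 ?energy_ge0.
Qed.

Lemma WnormpZ k u g : WG u g ->
  Wn (fun x => k * u x) (fun i x => k * g i x) = ((`|k| `^ p)%:E * Wn u g)%E.
Proof.
move=> Wu; rewrite !WnormpE -integralZl//; last exact: weak_grad_energy_integrable.
by apply: eq_integral => x _; rewrite energyZ// EFinM.
Qed.

Lemma WnormpD u g v h : WG u g -> WG v h ->
  (Wn (fun x => u x + v x)%R (fun i x => g i x + h i x)%R
   <= (2 `^ p)%:E * (Wn u g + Wn v h))%E.
Proof.
move=> Wu Wv; have [mu_ mg] := weak_grad_measurable Wu; have [mv mh] := weak_grad_measurable Wv.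
have iu := weak_grad_energy_integrable Wu; have iv := weak_grad_energy_integrable Wv.
rewrite (WnormpE u) (WnormpE v) -(integralD_EFin mOm iu iv) -(integralZl mOm (integrableD_EFin mOm iu iv)).
have [mS mGS] := weak_grad_measurable (weak_gradD Wu Wv).
apply: le_Wnormp => //.
- by apply: measurable_funM => //; apply: measurable_funD; exact: measurable_energy.
- by apply: aeW => x _; exact: energyD.
- by move=> x; rewrite mulr_ge0 ?powR_ge0// addr_ge0 ?energy_ge0.
Qed.

Lemma eq_Wnormp u g v h :
  measurable_fun (Om : set B) (u : B -> R) -> (forall i, measurable_fun (Om : set B) (g i : B -> R)) ->
  measurable_fun (Om : set B) (v : B -> R) -> (forall i, measurable_fun (Om : set B) (h i : B -> R)) ->
  {ae mu, forall x : B, Om x -> u x = v x /\ forall i, g i x = h i x} -> Wn u g = Wn v h.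
Proof.
move=> mu_ mg mv mh H; rewrite !WnormpE; apply: ae_eq_integral => //.
- by apply/measurable_EFinP; exact: measurable_energy.
- by apply/measurable_EFinP; exact: measurable_energy.
- by apply: ae_imp H _ => x Hx Omx; have [uv gh] := Hx Omx; rewrite (eq_energy p uv gh).
Qed.

End WeakGradient.

(** * The space W-tilde *)

Section SummableConvergence.
Context {R : realType} {N : nat}.
Notation E := 'rV[R]_N.
Notation B := (Borel R N).
Context (mu : {measure set B -> \bar R}).
Context (Om : set E) (oOm : open Om).

Let mOm : measurable (Om : set B). Proof. exact: open_measurableB. Qed.

(* The [\bar R]-valued sum of the series is replaced by a real-valued function,
   equal to it almost everywhere. *)
Lemma ae_summable (f : nat -> E -> R) (d : R) :
  (forall n, measurable_fun (Om : set B) (f n : B -> R)) -> (forall n x, 0 <= f n x) ->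
  (forall n, (\int[mu]_(x in (Om : set B)) (f n x)%:E <= (d / 2 ^+ n.+1)%:E)%E) ->
  exists S : E -> R, [/\ mu.-integrable (Om : set B) (EFin \o S),
    forall x, 0 <= S x,
    (\int[mu]_(x in (Om : set B)) (S x)%:E <= d%:E)%E &
    {ae mu, forall x : B, Om x ->
      (forall n, \sum_(k < n) f k x <= S x) /\ f n x @[n --> \oo] --> (0 : R)}].
Proof.
move=> mf f0 If.
have d0 : 0 <= d.
  have : (0 <= (d / 2 ^+ 1)%:E)%E.
    by apply: le_trans (If 0%N); apply: integral_ge0 => x _; rewrite lee_fin.
  by rewrite lee_fin expr1; lra.
pose F (x : B) := (\sum_(0 <= k <oo) (f k x)%:E)%E.
have mF : measurable_fun (Om : set B) F.
  by apply: ge0_emeasurable_sum => [k x _ _|k _]; [rewrite lee_fin|exact/measurable_EFinP].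
have F0 x : (0 <= F x)%E by apply: nneseries_ge0 => n _ _; rewrite lee_fin.
have IF : (\int[mu]_(x in (Om : set B)) F x <= d%:E)%E.
  rewrite integral_nneseries//; last 2 first.
  - by move=> n; exact/measurable_EFinP.
  - by move=> n x _; rewrite lee_fin.
  apply: le_trans (epsilon_trick0 xpredT d0); apply: lee_nneseries => [n _ _|n _].
    by apply: integral_ge0 => x _; rewrite lee_fin.
  by rewrite natrX; exact: If.
have iF : mu.-integrable (Om : set B) F.
  apply/integrableP; split=> //; apply: le_lt_trans (ltry d); apply: le_trans IF.
  by under eq_integral => x _ do rewrite gee0_abs//.
have Ffin : {ae mu, forall x : B, Om x -> F x \is a fin_num} := integrable_ae mOm iF.
have mS : measurable_fun (Om : set B) (fine \o F).
  by apply: measurableT_comp.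
have SF : (\int[mu]_(x in (Om : set B)) ((fine \o F) x)%:E = \int[mu]_(x in (Om : set B)) F x)%E.
  apply: ae_eq_integral => //; first exact/measurable_EFinP.
  by apply: ae_imp Ffin _ => x h Omx; rewrite /= fineK// h.
exists (fine \o F); split=> [|x||].
- apply/integrableP; split; first exact/measurable_EFinP.
  apply: le_lt_trans (ltry d); apply: le_trans IF; rewrite -SF.
  under eq_integral => x _ do rewrite /= ger0_norm ?fine_ge0//.
  exact: lexx.
- by rewrite /= fine_ge0.
- by rewrite SF.
- apply: ae_imp Ffin _ => x h Omx.
  have le_S n : \sum_(k < n) f k x <= fine (F x).
    rewrite -lee_fin fineK ?h// -sumEFin.
    have := @nneseries_lim_ge R (fun k => (f k x)%:E) xpredT 0 n.
    by rewrite big_mkord; apply=> k _ _; rewrite lee_fin.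
  split=> //; apply: cvg_series_cvg_0; apply: nondecreasing_is_cvgn.
    by apply: nondecreasing_series => n _ _; exact: f0.
  by exists (fine (F x)) => _ [n _ <-]; rewrite /series /= big_mkord.
Qed.

End SummableConvergence.

Section Wtilde.
Context {R : realType} {N : nat}.
Notation E := 'rV[R]_N.
Notation B := (Borel R N).
Context (mu : {measure set B -> \bar R}) (Hmu : is_lebesgue mu).
Context (Om : set E) (oOm : open Om) (p : R) (p1 : 1 < p).
Implicit Types (u v w : E -> R) (g h : 'I_N -> E -> R).

Let mOm : measurable (Om : set B). Proof. exact: open_measurableB. Qed.

Notation WG := (is_weak_grad mu Om p).
Notation Lp := (Lp mu Om p).
Notation energy := (energy p).
Notation Wn := (Wnormp mu Om p).
Notation Wt := (inWtilde mu Om p).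

Lemma Wnormp_ge0 u g : (0 <= Wn u g)%E.
Proof. by apply: integral_ge0 => x _; rewrite lee_fin addr_ge0 ?powR_ge0. Qed.

Lemma CcD u v : Cc_closure Om u -> Cc_closure Om v -> Cc_closure Om (fun x => u x + v x).
Proof.
move=> [cu [K [cK [KO K0]]]] [cv [L [cL [LO L0]]]]; split.
  by move=> x; apply: (@continuousD _ _ _ (u : subspace (closure Om) -> R) v); [exact: cu|exact: cv].
exists (K `|` L); split; first exact: compactU.
split=> [x [/KO|/LO]//|x Ox /not_orP[nK nL]].
by rewrite K0// L0// addr0.
Qed.

Lemma CcZ k u : Cc_closure Om u -> Cc_closure Om (fun x => k * u x).
Proof.
move=> [cu [K [cK [KO K0]]]]; split.
  move=> x; apply: (@continuousM _ _ (cst k) (u : subspace (closure Om) -> R)); last exact: cu.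
  exact: cst_continuous.
by exists K; split=> //; split=> // x Ox nK; rewrite K0// mulr0.
Qed.

Lemma Cc_max u v : Cc_closure Om u -> Cc_closure Om v -> Cc_closure Om (fun x => Num.max (u x) (v x)).
Proof.
move=> [cu [K [cK [KO K0]]]] [cv [L [cL [LO L0]]]]; split.
  by move=> x; apply: (@continuous_max _ _ (u : subspace (closure Om) -> R^o) v); [exact: cu|exact: cv].
exists (K `|` L); split; first exact: compactU.
split=> [x [/KO|/LO]//|x Ox /not_orP[nK nL]].
by rewrite K0// L0// maxxx.
Qed.

Lemma Cc0 : Cc_closure Om (fun=> 0).
Proof.
split; first by move=> x; exact: cst_continuous.
by exists set0; split; [exact: compact0|split].
Qed.

Lemma Wtilde_intro u g : WG u g ->
  (forall eps, 0 < eps -> exists v h, [/\ Cc_closure Om v, WG v h &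
     (Wn (fun x => u x - v x)%R (fun i x => g i x - h i x)%R < eps%:E)%E]) -> Wt u.
Proof.
move=> Wu H; split; first by exists g.
move=> eps /H[v [h [Cv Wv lt]]]; exists v; split; first exact: Cv.
by exists g, h.
Qed.

(** The definition of [inWtilde] chooses a gradient of u anew for every eps; almost everywhere
    uniqueness allows a single given gradient throughout. *)
Lemma Wtilde_approx u g : Wt u -> WG u g ->
  forall eps, 0 < eps -> exists v h, [/\ Cc_closure Om v, WG v h &
     (Wn (fun x => u x - v x)%R (fun i x => g i x - h i x)%R < eps%:E)%E].
Proof.
move=> [_ H] Wu eps e0; have [v [Cv [g' [h [Wu' [Wv lt]]]]]] := H eps e0.
exists v, h; split; [exact: Cv|exact: Wv|].
have [m1 m2] := weak_grad_measurable (weak_gradB Hmu oOm p1 Wu Wv).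
have [m3 m4] := weak_grad_measurable (weak_gradB Hmu oOm p1 Wu' Wv).
rewrite (eq_Wnormp oOm p m1 m2 m3 m4); first exact: lt.
apply: ae_imp (weak_grad_unique Hmu oOm p1 Wu Wu') _ => x gg' Omx; split=> [//|i].
by rewrite gg'.
Qed.

Lemma WtildeD u v : Wt u -> Wt v -> Wt (fun x => u x + v x).
Proof.
move=> Wtu Wtv; have [[g Wu] _] := Wtu; have [[h Wv] _] := Wtv.
apply: (Wtilde_intro (weak_gradD Hmu oOm p1 Wu Wv)) => eps e0.
have c0 : 0 < 2 `^ p :> R by apply: powR_gt0.
have e2 : 0 < eps / 2 / 2 `^ p by rewrite !divr_gt0.
have [u' [g' [Cu Wu' ltu]]] := Wtilde_approx Wtu Wu e2.
have [v' [h' [Cv Wv' ltv]]] := Wtilde_approx Wtv Wv e2.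
exists (fun x => u' x + v' x), (fun i x => g' i x + h' i x).
split; [exact: CcD|exact: weak_gradD|].
have E1 : (fun x => u x - u' x + (v x - v' x)) = (fun x => u x + v x - (u' x + v' x)).
  by apply/funext => x; ring.
have E2 : (fun i x => g i x - g' i x + (h i x - h' i x)) = (fun i x => g i x + h i x - (g' i x + h' i x)).
  by apply/funext => i; apply/funext => x; ring.
have := WnormpD Hmu oOm p1 (weak_gradB Hmu oOm p1 Wu Wu') (weak_gradB Hmu oOm p1 Wv Wv').
rewrite E1 E2.
move=> /le_lt_trans; apply.
rewrite -lte_pdivlMl// -EFinM (_ : _ * eps = eps / 2 / 2 `^ p + eps / 2 / 2 `^ p); last first.
  by field; rewrite gt_eqF.
rewrite EFinD; exact: (lteD ltu ltv).
Qed.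

Lemma WtildeZ k u : Wt u -> Wt (fun x => k * u x).
Proof.
move=> Wtu; have [[g Wu] _] := Wtu.
apply: (Wtilde_intro (weak_gradZ Hmu oOm p1 k Wu)) => eps e0.
(* The added 1 covers the case k = 0. *)
have c0 : 0 < `|k| `^ p + 1 by rewrite ltr_wpDl ?powR_ge0.
have e2 : 0 < eps / (`|k| `^ p + 1) by rewrite divr_gt0.
have [u' [g' [Cu Wu' ltu]]] := Wtilde_approx Wtu Wu e2.
exists (fun x => k * u' x), (fun i x => k * g' i x).
split; [exact: CcZ|exact: weak_gradZ|].
have WB := weak_gradB Hmu oOm p1 Wu Wu'.
have E1 : (fun x => k * (u x - u' x)) = (fun x => k * u x - k * u' x).
  by apply/funext => x; ring.
have E2 : (fun i x => k * (g i x - g' i x)) = (fun i x => k * g i x - k * g' i x).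
  by apply/funext => i; apply/funext => x; ring.
have := WnormpZ oOm p1 k WB; rewrite E1 E2 => ->.
have fW : (Wn (fun x => u x - u' x)%R (fun i x => g i x - g' i x)%R \is a fin_num)%E.
  rewrite ge0_fin_numE; first exact: (Wnormp_lty oOm p1 WB).
  exact: Wnormp_ge0.
move: ltu; rewrite -(fineK fW) -EFinM !lte_fin ltr_pdivlMr// => ltu.
apply: le_lt_trans ltu; rewrite mulrC ler_wpM2l ?lerDl//.
by rewrite fine_ge0// Wnormp_ge0.
Qed.

Lemma WtildeB u v : Wt u -> Wt v -> Wt (fun x => u x - v x).
Proof.
move=> Wu Wv; have := WtildeD Wu (WtildeZ (-1) Wv); congr inWtilde.
by apply/funext => x; rewrite mulN1r.
Qed.

End Wtilde.

(** * Stability of W-tilde under maxima *)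

Section WtildeMax.
Context {R : realType} {N : nat}.
Notation E := 'rV[R]_N.
Notation B := (Borel R N).
Context (mu : {measure set B -> \bar R}) (Hmu : is_lebesgue mu).
Context (Om : set E) (oOm : open Om) (p : R) (p1 : 1 < p).
Implicit Types (u v w : E -> R) (g h : 'I_N -> E -> R).

Let pgt0 : 0 < p. Proof. exact: lt_trans p1. Qed.
Let mOm : measurable (Om : set B). Proof. exact: open_measurableB. Qed.

Notation WG := (is_weak_grad mu Om p).
Notation Lp := (Lp mu Om p).
Notation energy := (energy p).
Notation Wn := (Wnormp mu Om p).
Notation Wt := (inWtilde mu Om p).

Lemma powR_cvg0 (a : nat -> R) : (forall n, 0 <= a n) ->
  a n `^ p @[n --> \oo] --> (0 : R) -> a n @[n --> \oo] --> (0 : R).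
Proof.
move=> a0 H; apply/cvgrPdist_lt => e e0.
have ep : 0 < e `^ p by exact: powR_gt0.
move/cvgrPdist_lt : H => /(_ _ ep); apply: filterS => n.
rewrite !sub0r !normrN !ger0_norm ?powR_ge0//.
by rewrite !ltNge; apply: contra => /(powR_le p1 (ltW e0)).
Qed.

Lemma energy_cvg0 (u : nat -> E -> R) (g : nat -> 'I_N -> E -> R) x :
  energy (u n) (g n) x @[n --> \oo] --> (0 : R) ->
  u n x @[n --> \oo] --> (0 : R) /\ forall i, g n i x @[n --> \oo] --> (0 : R).
Proof.
move=> H; have sq (a : nat -> R) : (forall n, `|a n| `^ p <= energy (u n) (g n) x) ->
    a n @[n --> \oo] --> (0 : R).
  move=> le; apply/norm_cvg0P; apply: powR_cvg0 => //.
  apply: (squeeze_cvgr _ (cvg_cst 0) H); apply: nearW => n.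
  by rewrite powR_ge0 le.
split=> [|i]; apply: sq => n; first by rewrite lerDl powR_ge0.
apply: (@le_trans _ _ (gnorm (g n) x `^ p)); last by rewrite lerDr powR_ge0.
by apply: powR_le => //; exact: gnorm_coord.
Qed.

(** Membership is obtained from dominated convergence: pointwise decay of the energy density of the
    error, below an integrable bound, gives approximation in the norm. *)
Lemma Wtilde_lim u g (v : nat -> E -> R) (h : nat -> 'I_N -> E -> R) (G : E -> R) :
  WG u g -> (forall n, Cc_closure Om (v n)) -> (forall n, WG (v n) (h n)) ->
  mu.-integrable (Om : set B) (EFin \o G) ->
  {ae mu, forall x : B, Om x ->
    (forall n, energy (fun x => u x - v n x) (fun i x => g i x - h n i x) x <= G x) /\
    energy (fun x => u x - v n x) (fun i x => g i x - h n i x) x @[n --> \oo] --> (0 : R)} ->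
  Wt u.
Proof.
move=> Wu Cv Wv iG H; apply: (Wtilde_intro Wu) => eps e0.
pose T n x := energy (fun x => u x - v n x) (fun i x => g i x - h n i x) x.
have mT n : measurable_fun (Om : set B) (EFin \o T n).
  have [m1 m2] := weak_grad_measurable (weak_gradB Hmu oOm p1 Wu (Wv n)).
  by apply/measurable_EFinP; exact: measurable_energy.
have cT : {ae mu, forall x : B, Om x -> (EFin \o T n) x @[n --> \oo] --> (0%:E : \bar R)}.
  apply: ae_imp H _ => x Hx Omx; have [_ c] := Hx Omx.
  by apply: cvg_EFin; [near=> n|exact: c].
have bT : {ae mu, forall (x : B) n, Om x -> (`|(EFin \o T n) x| <= (EFin \o G) x)%E}.
  apply: ae_imp H _ => x Hx n Omx; have [c _] := Hx Omx.
  rewrite /= lee_fin ger0_norm ?energy_ge0//; exact: c.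
have m0 : measurable_fun (Om : set B) (cst (0 : \bar R)) by exact: measurable_cst.
have [_ _ c] := dominated_convergence mOm mT m0 cT iG bT.
have {c} : \forall n \near \oo, (\int[mu]_(x in (Om : set B)) (EFin \o T n) x < eps%:E)%E.
  apply: (c [set y | (y < eps%:E)%E]); rewrite integral0.
  apply: open_nbhs_nbhs; split; first exact: open_ereal_lt_ereal.
  by rewrite /= lte_fin.
move=> [n _ /(_ n (leqnn n)) lt]; exists (v n), (h n).
split; [exact: Cv|exact: Wv|exact: lt].
Unshelve. all: by end_near.
Qed.

(** Positive parts of fast approximants v_n are still in C_c. They converge in energy because v_n
    tends to u almost everywhere and the gradient of u vanishes where u does. *)
Lemma Wtilde_pos u : Wt u -> Wt (fun x => Num.max (u x) 0).
Proof.
move=> Wtu; have [[g Wu] _] := Wtu.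
have /choice[vh Hvh] (n : nat) : exists vh : (E -> R) * ('I_N -> E -> R),
    [/\ Cc_closure Om vh.1, WG vh.1 vh.2 &
     (Wn (fun x => u x - vh.1 x)%R (fun i x => g i x - vh.2 i x)%R < (1 / 2 ^+ n.+1)%:E)%E].
  have e0 : 0 < 1 / 2 ^+ n.+1 :> R by rewrite divr_gt0// exprn_gt0.
  by have [v [h H]] := Wtilde_approx Hmu oOm p1 Wtu Wu e0; exists (v, h).
pose v n := (vh n).1; pose h n := (vh n).2.
have Cv n : Cc_closure Om (v n) by case: (Hvh n).
have Wv n : WG (v n) (h n) by case: (Hvh n).
pose T n x := energy (fun x => u x - v n x) (fun i x => g i x - h n i x) x.
have mT n : measurable_fun (Om : set B) (T n : B -> R).
  have [m1 m2] := weak_grad_measurable (weak_gradB Hmu oOm p1 Wu (Wv n)).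
  exact: measurable_energy.
have T0 n x : 0 <= T n x by exact: energy_ge0.
have IT n : (\int[mu]_(x in (Om : set B)) (T n x)%:E <= (1 / 2 ^+ n.+1)%:E)%E.
  have [_ _ H] := Hvh n; exact: (ltW H).
have [S [iS S0 _ HS]] := ae_summable oOm mT T0 IT.
have iu := weak_grad_energy_integrable oOm p1 Wu.
have iG := integrableZl_EFin mOm (integrableD_EFin mOm iS iu) (2 `^ p).
apply: (Wtilde_lim (weak_grad_pos Hmu oOm p1 Wu) _ _ iG).
- by move=> n; apply: Cc_max (Cv n) (Cc0 Om).
- by move=> n; exact: weak_grad_pos (Wv n).
apply: ae_imp2 HS (weak_grad_zero Hmu oOm p1 Wu) _ => x HS uz Omx.
have [{}HS cT] := HS Omx.
have TS n : T n x <= S x.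
  apply: le_trans (HS n.+1); rewrite big_ord_recr /= lerDr.
  by apply: sumr_ge0 => k _; exact: T0.
have [cu _] := @energy_cvg0 (fun n x => u x - v n x) (fun n i x => g i x - h n i x) x cT.
(* The gradient error is 1_{v_n > 0} (grad u - grad v_n), controlled by [T n], plus (1_{u > 0} -
   1_{v_n > 0}) grad u, whose energy density is [D n]. *)
pose a n x := Num.max (u x) 0 - Num.max (v n x) 0.
pose da n i x := if 0 < v n x then g i x - h n i x else 0.
pose db n i x := (if 0 < u x then g i x else 0) - (if 0 < v n x then g i x else 0).
pose D n := energy (fun=> 0) (db n) x.
have split n : energy (fun x => Num.max (u x) 0 - Num.max (v n x) 0)
    (fun i x => (if 0 < u x then g i x else 0) - (if 0 < v n x then h n i x else 0)) x <=
    2 `^ p * (T n x + D n).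
  have := energyD p1 (a n) (da n) (fun=> 0) (db n) x.
  rewrite (_ : energy _ _ x = energy (fun x => Num.max (u x) 0 - Num.max (v n x) 0)
    (fun i x => (if 0 < u x then g i x else 0) - (if 0 < v n x then h n i x else 0)) x); last first.
    by apply: eq_energy => [|i]; rewrite ?addr0// /da /db; case: ifP; case: ifP => _ _; ring.
  move=> /le_trans; apply; rewrite ler_wpM2l ?powR_ge0// lerD2r.
  apply: lerD; apply: powR_le => //.
  - rewrite /a; have [h1|h1] := leP (u x) 0; have [h2|h2] := leP (v n x) 0;
      rewrite ?subrr ?subr0 ?sub0r ?normr0 ?normrN//.
    + by rewrite gtr0_norm// distrC ger0_norm; lra.
    + by rewrite gtr0_norm// ger0_norm; lra.
  - exact: sqrtr_ge0.
  - have [vn|vn] := ltP 0 (v n x); first by rewrite (@eq_gnorm _ _ _ (fun i x => g i x - h n i x))// /da => i; rewrite vn.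
    rewrite (@eq_gnorm _ _ _ (fun i x => 0 * g i x)); last by move=> i; rewrite /da ltNge vn mul0r.
    by rewrite gnormZ normr0 mul0r sqrtr_ge0.
have DE n : (0 < u x) = (0 < v n x) -> D n = 0.
  move=> E0; rewrite /D (_ : energy _ _ x = energy (fun x => 0 * u x) (fun i x => 0 * g i x) x).
    by rewrite energyZ normr0 powR0 ?gt_eqF// mul0r.
  by apply: eq_energy => [|i]; rewrite mul0r// /db E0 subrr.
have Dle n : D n <= energy u g x.
  rewrite /D (_ : energy _ _ x = energy (fun x => 0 * u x) (db n) x); last by apply: eq_energy => [|i]; rewrite ?mul0r.
  apply: lerD; first by rewrite mul0r normr0 powR0 ?gt_eqF// powR_ge0.
  apply: powR_le => //; first exact: sqrtr_ge0.
  pose k : R := (0 < u x)%R%:R - (0 < v n x)%R%:R.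
  rewrite (@eq_gnorm _ _ _ (fun i x => k * g i x)); last first.
    by move=> i; rewrite /db /k mulrBl; case: ifP; case: ifP; rewrite ?mul1r ?mul0r.
  rewrite gnormZ ler_piMl ?sqrtr_ge0// /k.
  by case: (_ < _); case: (_ < _); rewrite ?subrr ?subr0 ?sub0r ?normrN ?normr0 ?normr1.
split=> [n|].
  by apply: le_trans (split n) _; rewrite /= ler_wpM2l ?powR_ge0// lerD.
have cv : v n x @[n --> \oo] --> u x.
  have : u x - (u x - v n x) @[n --> \oo] --> u x - 0 by apply: cvgB cu; exact: cvg_cst.
  by rewrite subr0; under eq_fun do rewrite subKr.
have cD : D n @[n --> \oo] --> (0 : R).
  have [u0|u0|u0] := ltgtP (u x) 0.
  - apply: cvg_near_cst; near=> n; apply: DE.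
    have : v n x < 0 by near: n; exact: (cvgr_lt _ cv 0 u0).
    by move=> vn; rewrite !ltNge !ltW.
  - apply: cvg_near_cst; near=> n; apply: DE.
    have : 0 < v n x by near: n; exact: (cvgr_gt _ cv 0 u0).
    by move=> vn; rewrite u0 vn.
  (* Where u = 0 the sign of v_n may oscillate for ever, but grad u = 0 there. *)
  - apply: cvg_near_cst; apply: nearW => n.
    rewrite /D (_ : energy _ _ x = energy (fun x => 0 * u x) (fun i x => 0 * g i x) x).
      by rewrite energyZ normr0 powR0 ?gt_eqF// mul0r.
    by apply: eq_energy => [|i]; rewrite mul0r// /db uz// !if_same subrr.
have cR : 2 `^ p * (T n x + D n) @[n --> \oo] --> (0 : R).
  rewrite -[X in _ --> X](mulr0 (2 `^ p)) -[X in _ * X]addr0.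
  by apply: cvgM; [exact: cvg_cst|exact: cvgD].
apply: (squeeze_cvgr _ (cvg_cst 0) cR); apply: nearW => n.
by rewrite energy_ge0 split.
Unshelve. all: by end_near. Qed.

Lemma Wtilde_max u v : Wt u -> Wt v -> Wt (fun x => Num.max (u x) (v x)).
Proof.
move=> Wu Wv; have := WtildeD Hmu oOm p1 Wv (Wtilde_pos (WtildeB Hmu oOm p1 Wu Wv)).
congr inWtilde; apply/funext => x; have [h1|h1] := leP (u x - v x) 0.
  by rewrite addr0 max_r// -subr_le0.
by rewrite addrC subrK max_l// ltW// -subr_gt0.
Qed.

End WtildeMax.

(** * Suprema of sequences with summable energies *)

Section CountableMaximum.
Context {R : realType} {N : nat}.
Notation E := 'rV[R]_N.
Notation B := (Borel R N).
Context (mu : {measure set B -> \bar R}) (Hmu : is_lebesgue mu).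
Context (Om : set E) (oOm : open Om) (p : R) (p1 : 1 < p).
Implicit Types (u v : E -> R) (g : 'I_N -> E -> R).

Let pgt0 : 0 < p. Proof. exact: lt_trans p1. Qed.
Let mOm : measurable (Om : set B). Proof. exact: open_measurableB. Qed.

Notation WG := (is_weak_grad mu Om p).
Notation Lp := (Lp mu Om p).
Notation energy := (energy p).
Notation Wn := (Wnormp mu Om p).
Notation Wt := (inWtilde mu Om p).

(** The finite part of the limsup is measurable and defined everywhere; its values where the
    sequence diverges are irrelevant. *)
Lemma measurable_limit (f : nat -> B -> R) :
  (forall n, measurable_fun (Om : set B) (f n)) ->
  exists F : B -> R, measurable_fun (Om : set B) F /\
    forall x l, f n x @[n --> \oo] --> (l : R) -> F x = l.
Proof.
move=> mf; exists (fun x => fine (limn_esup (fun n => (f n x)%:E))); split.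
  apply: measurableT_comp => //; apply: measurable_fun_limn_esup => n.
  exact/measurable_EFinP.
move=> x l fl; have c : (fun n => (f n x)%:E) @ \oo --> l%:E.
  by apply: cvg_EFin; [near=> n|exact: fl].
by have [_ ->] := cvg_limn_einf_sup c.
Unshelve. all: by end_near. Qed.

Lemma energy_zero u g x : u x = 0 -> (forall i, g i x = 0) -> energy u g x = 0.
Proof.
move=> u0 g0; rewrite (@eq_energy _ _ _ _ _ (fun x => 0 * u x) (fun i x => 0 * g i x)).
- by rewrite energyZ normr0 powR0 ?gt_eqF// mul0r.
- by rewrite u0 mul0r.
- by move=> i; rewrite g0 mul0r.
Qed.

Section MaximalFunction.
Context (w : nat -> E -> R) (h : nat -> 'I_N -> E -> R).

(** Function and gradient are built together so that both stop changing at the same index. A tie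
    keeps the older gradient, which stationarity relies on. *)
Fixpoint max_upto k : (E -> R) * ('I_N -> E -> R) :=
  if k is k'.+1 then
    let zH := max_upto k' in
    (fun x => Num.max (w k x) (zH.1 x),
     fun i x => if zH.1 x < w k x then h k i x else zH.2 i x)
  else (w 0%N, h 0%N).

Lemma max_upto_ge k n x : (n <= k)%N -> w n x <= (max_upto k).1 x.
Proof.
elim: k => [|k IH]; first by rewrite leqn0 => /eqP ->.
by rewrite leq_eqVlt /= le_max => /predU1P[->|/IH ->]; rewrite ?lexx ?orbT.
Qed.

Lemma energy_max_upto k x : energy (max_upto k).1 (max_upto k).2 x <=
  \sum_(j < k.+1) energy (w j) (h j) x.
Proof.
elim: k => [|k IH]; first by rewrite big_ord_recr big_ord0 /= add0r.
rewrite big_ord_recr /= energy_max; case: ifP => _.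
  by rewrite lerDr sumr_ge0// => j _; exact: energy_ge0.
by apply: le_trans IH _; rewrite lerDl energy_ge0.
Qed.

(** If some [w m x] is positive, later terms eventually fall below it; if none is, all terms vanish
    at x and no update ever takes place. *)
Lemma max_upto_stationary x : (forall n, 0 <= w n x) ->
  w n x @[n --> \oo] --> (0 : R) ->
  exists K, forall k, (K <= k)%N -> (max_upto k).1 x = (max_upto K).1 x /\
    forall i, (max_upto k).2 i x = (max_upto K).2 i x.
Proof.
move=> w0 cw; have [K HK] : exists K, forall k, (K <= k)%N -> w k.+1 x <= (max_upto k).1 x.
  have [[m wm]|nw] := pselect (exists m, 0 < w m x).
    have [n _ Hn] := cvgr_lt _ cw _ wm.
    exists (maxn m n) => k; rewrite geq_max => /andP[mk nk].
    apply: le_trans (max_upto_ge _ mk); apply: ltW; apply: Hn => /=.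
    exact: leq_trans nk _.
  exists 0%N => k _; apply: le_trans (max_upto_ge x (leq0n k)).
  apply: le_trans (w0 0%N); rewrite leNgt; apply/negP => wk.
  by apply: nw; exists k.+1.
exists K; elim=> [|k IH]; first by rewrite leqn0 => /eqP ->.
rewrite leq_eqVlt => /predU1P[<- //|]; rewrite ltnS => Kk.
have [e1 e2] := IH Kk; have wk := HK k Kk; split=> [|i] /=.
  by rewrite max_r //; exact: e1.
by rewrite ltNge wk; exact: e2.
Qed.

Lemma max_upto_Cc k : (forall n, Cc_closure Om (w n)) -> Cc_closure Om (max_upto k).1.
Proof. by move=> Cw; elim: k => [|k IH]; [exact: Cw|exact: Cc_max (Cw _) IH]. Qed.

Lemma max_upto_WG k : (forall n, WG (w n) (h n)) -> WG (max_upto k).1 (max_upto k).2.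
Proof. move=> Ww; elim: k => [|k IH]; [exact: Ww|exact: weak_grad_max (Ww _) IH]. Qed.

End MaximalFunction.

(** At almost every point the k-th maximum and its gradient are eventually constant in k and have
    energy density at most the sum S of all densities. Hence the weak formulation and the bound pass
    to the limit, and the error, dominated and eventually 0, places the supremum in the closure of
    C_c. *)
Lemma countable_max (w : nat -> E -> R) (h : nat -> 'I_N -> E -> R) (d : R) :
  (forall n x, 0 <= w n x) -> (forall n, Cc_closure Om (w n)) ->
  (forall n, WG (w n) (h n)) -> (forall n, (Wn (w n) (h n) <= (d / 2 ^+ n.+1)%:E)%E) ->
  exists z G, [/\ Wt z, WG z G, (Wn z G <= d%:E)%E &
    {ae mu, forall x : B, Om x -> forall n, w n x <= z x}].
Proof.
move=> w0 Cw Ww Iw.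
pose z k := (max_upto w h k).1; pose H k := (max_upto w h k).2.
have Wz k : WG (z k) (H k) by exact: max_upto_WG.
have mw n : measurable_fun (Om : set B) (energy (w n) (h n) : B -> R).
  by have [m1 m2] := weak_grad_measurable (Ww n); exact: measurable_energy.
have [S [iS S0 IS HS]] := ae_summable oOm mw (fun n x => energy_ge0 _ _ _ x) Iw.
have mz k : measurable_fun (Om : set B) (z k : B -> R) by case: (weak_grad_measurable (Wz k)).
have mH k i : measurable_fun (Om : set B) (H k i : B -> R) by case: (weak_grad_measurable (Wz k)).
have [Z [mZ ZE]] := measurable_limit mz.
have /choice[G HG] i := measurable_limit (fun k => mH k i).
have key : {ae mu, forall x : B, Om x -> (forall k, energy (z k) (H k) x <= S x) /\
   exists K, forall k, (K <= k)%N -> z k x = Z x /\ forall i, H k i x = G i x}.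
  apply: ae_imp HS _ => x HS Omx; have [le_S cw] := HS Omx; split=> [k|].
    exact: le_trans (energy_max_upto w h k x) (le_S k.+1).
  have [cw0 _] := energy_cvg0 p1 (u := w) (g := h) cw.
  have [K HK] := max_upto_stationary h (fun n => w0 n x) cw0.
  have ZK : Z x = z K x.
    apply: ZE; apply: cvg_near_cst; near=> k.
    have [|e1 _] := HK k; [by near: k; exact: nbhs_infty_ge|exact: e1].
  have GK i : G i x = H K i x.
    apply: (proj2 (HG i)); apply: cvg_near_cst; near=> k.
    have [|_ e2] := HK k; [by near: k; exact: nbhs_infty_ge|exact: e2].
  exists K => k Kk; have [e1 e2] := HK k Kk; rewrite ZK; split=> [|i]; first exact: e1.
  by rewrite GK; exact: e2.
have mG i : measurable_fun (Om : set B) (G i) by case: (HG i).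
have ZS : {ae mu, forall x : B, Om x -> energy Z G x <= S x}.
  apply: ae_imp key _ => x Hx Omx; have [le_S [K HK]] := Hx Omx.
  have [e1 e2] := HK K (leqnn K).
  by rewrite -(eq_energy p e1 e2).
have [LZ LG] := Lp_of_energy oOm p1 mZ mG iS ZS.
have WZ : WG Z G.
  apply/(weak_gradP mu Om p); split; [exact: LZ|exact: LG|] => i.
  (* The majorant comes from t <= 1 + t^p, applied to |z n| and to the length of its gradient. *)
  apply: (@weak_deriv_lim R N mu Om oOm i z (fun k => H k i) Z (G i) (fun x => 1 + S x)).
  - by move=> n; have /weak_gradP[_ _] := Wz n.
  - split=> [|K cK KOm].
      by apply: measurable_funD => //; case/integrableP: iS => /measurable_EFinP.
    have mK := compact_measurableB cK.
    have i1 : mu.-integrable (K : set B) (EFin \o cst 1).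
      apply: measurable_bounded_integrable => //; first exact: compact_mu_lty.
      by exists 1; split; [exact: num_real|move=> y cy x _; rewrite /= normr1 ltW].
    have iSK : mu.-integrable (K : set B) (EFin \o S) by exact: (integrableS mOm mK KOm iS).
    exact: (integrableD_EFin mK (f := cst 1) i1 iSK).
  - exact: mz.
  - exact: mZ.
  - exact: (fun k => mH k i).
  - exact: mG.
  - move=> n; apply: ae_imp key _ => x Hx Omx; have [le_S _] := Hx Omx.
    have zS : `|z n x| `^ p <= S x by apply: le_trans (le_S n); rewrite lerDl powR_ge0.
    have gS : gnorm (H n) x `^ p <= S x by apply: le_trans (le_S n); rewrite lerDr powR_ge0.
    split; first by apply: le_trans (le_1powR p1 (normr_ge0 _)) _; rewrite lerD2l.
    apply: le_trans (gnorm_coord _ _ _) _.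
    by apply: le_trans (le_1powR p1 (gnorm_ge0 _ _)) _; rewrite lerD2l.
  - apply: ae_imp key _ => x Hx Omx; have [_ [K HK]] := Hx Omx.
    split; apply: cvg_near_cst; near=> k.
      have [|e1 _] := HK k; [by near: k; exact: nbhs_infty_ge|exact: e1].
    have [|_ e2] := HK k; [by near: k; exact: nbhs_infty_ge|exact: e2].
exists Z, G; split.
- apply: (Wtilde_lim Hmu oOm p1 WZ (v := z) (h := H) _ _ (integrableZl_EFin mOm (integrableD_EFin mOm iS iS) (2 `^ p))).
  + by move=> n; exact: max_upto_Cc.
  + exact: Wz.
  apply: ae_imp2 key ZS _ => x Hx ZS Omx; have [le_S [K HK]] := Hx Omx.
  split=> [n|].
    apply: le_trans (energyB p1 _ _ _ _ x) _; rewrite /= ler_wpM2l ?powR_ge0//.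
    by apply: lerD; [exact: ZS|exact: le_S].
  apply: cvg_near_cst; near=> k.
  have [|e1 e2] := HK k; first by near: k; exact: nbhs_infty_ge.
  by apply: energy_zero => [|i]; rewrite ?e1 ?e2 subrr.
- exact: WZ.
- by apply: le_trans IS; apply: le_Wnormp => //; case/integrableP: iS => /measurable_EFinP.
- apply: ae_imp key _ => x Hx Omx n; have [_ [K HK]] := Hx Omx.
  have [<- _] := HK (maxn n K) (leq_maxr _ _).
  exact: max_upto_ge (leq_maxl _ _).
Unshelve. all: by end_near. Qed.

End CountableMaximum.

(** * Quasi-continuous representatives *)

Section RelativeTopology.
Context {R : realType} {N : nat}.
Notation E := 'rV[R]_N.
Context (Om : set E).

Lemma rel_openU (O1 O2 : set E) : rel_open Om O1 -> rel_open Om O2 ->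
  rel_open Om (O1 `|` O2).
Proof.
move=> [U1 [oU1 ->]] [U2 [oU2 ->]]; exists (U1 `|` U2); split; first exact: openU.
by rewrite setIUl.
Qed.

Lemma rel_openI (O1 O2 : set E) : rel_open Om O1 -> rel_open Om O2 ->
  rel_open Om (O1 `&` O2).
Proof.
move=> [U1 [oU1 ->]] [U2 [oU2 ->]]; exists (U1 `&` U2); split; first exact: openI.
by rewrite setIACA setIid.
Qed.

Lemma rel_open_bigcup (O : nat -> set E) (P : nat -> Prop) : (forall n, rel_open Om (O n)) ->
  rel_open Om [set x | exists2 n, P n & O n x].
Proof.
move=> /choice[U HU]; exists (\bigcup_(n in P) U n); split.
  by apply: bigcup_open => n _; case: (HU n).
apply/seteqP; split=> [x [n Pn]|x [[n Pn Ux] Ox]].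
  by have [_ ->] := HU n => -[Ux Ox]; split=> //; exists n.
by exists n => //; have [_ ->] := HU n; split.
Qed.

Lemma rel_open_gt (f : E -> R) (c : R) : {within closure Om, continuous f} ->
  rel_open Om [set x | closure Om x /\ c < f x].
Proof.
move=> /continuousP/(_ _ (@open_gt _ c))/open_subspaceP[U oU E]; exists U; split=> //.
by rewrite E; apply/seteqP; split=> x [].
Qed.

(** The superlevel set is open only relative to the closure minus [V]; adding the relatively open
    [V] restores openness in the closure. *)
Lemma rel_open_setU_gt (f : E -> R) (c : R) (V : set E) : rel_open Om V ->
  {within closure Om `\` V, continuous f} ->
  rel_open Om ([set x | closure Om x /\ c < f x] `|` V).
Proof.
move=> [W [oW VE]] /continuousP/(_ _ (@open_gt _ c))/open_subspaceP[U oU UE].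
exists (U `|` W); split; first exact: openU.
apply/seteqP; split=> [x [[Ox fx]|]|x [[Ux|Wx] Ox]].
- have [Vx|nV] := pselect (V x); first by move: Vx; rewrite VE => -[Wx _]; split=> //; right.
  have : (U `&` (closure Om `\` V)) x by rewrite UE; split.
  by move=> [Ux _]; split=> //; left.
- by rewrite VE => -[Wx Ox]; split=> //; right.
- have [Vx|nV] := pselect (V x); [by right|left].
  have : (U `&` (closure Om `\` V)) x by split.
  by rewrite UE => -[].
- by right; rewrite VE.
Qed.

End RelativeTopology.

(** * Geometric rates and uniform limits *)

Section GeometricConvergence.
Context {R : realType}.
Implicit Types (a : R ^nat).

Lemma cvg_half_geometric (C : R) : C * 2^-1 ^+ n @[n --> \oo] --> (0 : R).
Proof. by apply: cvg_geometric; rewrite ger0_norm ?invr_ge0// invf_lt1// ltr1n. Qed.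

(** With r n the geometric tail, a + r decreases and a - r increases, so the limit exists and is
    squeezed between them at every index. *)
Let cvg_telescope0 a (C : R) : (forall k, `|a k.+1 - a k| <= C * 2^-1 ^+ k) ->
  cvgn a /\ forall n, `|a n - limn a| <= 2 * C * 2^-1 ^+ n.
Proof.
move=> H; pose r n : R := 2 * C * 2^-1 ^+ n.
have rS n : r n - r n.+1 = C * 2^-1 ^+ n.
  by rewrite /r exprS; field.
have r0 n : 0 <= r n.
  by have := le_trans (normr_ge0 _) (H n); rewrite /r -mulrA => ?; rewrite mulr_ge0.
have cr : r n @[n --> \oo] --> (0 : R) := cvg_half_geometric _.
pose b n := a n + r n; pose c n := a n - r n.
have nb : {homo b : n m / (n <= m)%N >-> m <= n}.
  apply/nonincreasing_seqP => n; rewrite /b.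
  by have := H n; rewrite -rS ler_norml => /andP[_]; lra.
have nc : {homo c : n m / (n <= m)%N >-> n <= m}.
  apply/nondecreasing_seqP => n; rewrite /c.
  by have := H n; rewrite -rS ler_norml => /andP[+ _]; lra.
have cb : cvgn b.
  apply: nonincreasing_is_cvgn => //; exists (c 0%N) => _ [n _ <-].
  apply: le_trans (nc 0%N n (leq0n n)) _.
  by rewrite /b /c; have := r0 n; lra.
have ca : a n @[n --> \oo] --> limn b.
  rewrite -[X in _ --> X]subr0.
  rewrite (_ : a = fun n => b n - r n); last by apply/funext => n; rewrite /b addrK.
  exact: cvgB.
have cc : c n @[n --> \oo] --> limn b.
  by rewrite -[X in _ --> X]subr0; exact: cvgB.
split; first exact: cvgP ca.
move=> n; rewrite (cvg_lim _ ca)//.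
have h1 := nonincreasing_cvgn_ge nb cb n.
have h2 : c n <= limn b.
  have cc' : cvgn c by exact: cvgP cc.
  by have := nondecreasing_cvgn_le nc cc' n; rewrite (cvg_lim _ cc).
by move: h1 h2; rewrite /b /c -/(r n) ler_norml => h1 h2; apply/andP; split; lra.
Qed.

Lemma cvg_telescope a m : (forall k, (m <= k)%N -> `|a k.+1 - a k| <= 2^-1 ^+ k) ->
  cvgn a /\ forall n, (m <= n)%N -> `|a n - limn a| <= 2 * 2^-1 ^+ n.
Proof.
move=> H; pose b n := a (n + m)%N.
have [cb Hb] : cvgn b /\ forall n, `|b n - limn b| <= 2 * 2^-1 ^+ m * 2^-1 ^+ n.
  apply: cvg_telescope0 => k; rewrite /b addSn mulrC -exprD.
  by apply: H; rewrite leq_addl.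
have ca : a n @[n --> \oo] --> limn b by rewrite -(cvg_shiftn m).
split; first exact: cvgP ca.
move=> n mn; rewrite (cvg_lim _ ca)//; have := Hb (n - m)%N.
by rewrite /b subnK// -mulrA -exprD subnKC.
Qed.

End GeometricConvergence.

Lemma uniform_limit_within {R : realType} (T : topologicalType) (D : set T) (v : nat -> T -> R)
    (f : T -> R) (r : nat -> R) (m : nat) :
  (forall n, {within D, continuous (v n)}) -> r n @[n --> \oo] --> (0 : R) ->
  (forall n x, (m <= n)%N -> D x -> `|v n x - f x| <= r n) ->
  {within D, continuous f}.
Proof.
move=> cv cr vf; apply/subspace_continuousP => x Dx; apply/cvgrPdist_lt => e e0.
have e3 : 0 < e / 3 by rewrite divr_gt0.
have [n [mn rn]] : exists n, (m <= n)%N /\ r n < e / 3.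
  have [k _ Hk] := cvgr_lt _ cr _ e3.
  by exists (maxn m k); split; [exact: leq_maxl|apply: Hk; exact: leq_maxr].
have /subspace_continuousP/(_ x Dx)/cvgrPdist_lt/(_ _ e3) := cv n.
rewrite !near_withinE; apply: filterS => y H Dy; have {}H := H Dy.
have h1 := vf n x mn Dx; have h2 := vf n y mn Dy.
rewrite (_ : f x - f y = - (v n x - f x) + (v n x - v n y) + (v n y - f y)); last by ring.
apply: le_lt_trans (ler_normD _ _) _; apply: le_lt_trans (lerD (ler_normD _ _) (lexx _)) _.
rewrite normrN; lra.
Qed.

Section QuasiContinuousRepresentative.
Context {R : realType} {N : nat}.
Notation E := 'rV[R]_N.
Notation B := (Borel R N).
Context (mu : {measure set B -> \bar R}) (Hmu : is_lebesgue mu).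
Context (Om : set E) (oOm : open Om) (p : R) (p1 : 1 < p).
Implicit Types (u v : E -> R) (g : 'I_N -> E -> R) (A : set E).

Let mOm : measurable (Om : set B). Proof. exact: open_measurableB. Qed.

Notation WG := (is_weak_grad mu Om p).
Notation Wn := (Wnormp mu Om p).
Notation Wt := (inWtilde mu Om p).
Notation Y := (Yset mu Om p).
Notation cap := (Cap mu Om p).

Lemma Cap_le A u g : Y A u -> WG u g -> (cap A <= Wn u g)%E.
Proof. by move=> Yu Wu; apply: ereal_inf_lbound; exists u, g. Qed.

Lemma Cap_lt A (c : \bar R) : (cap A < c)%E -> exists u g, [/\ Y A u, WG u g & (Wn u g < c)%E].
Proof. by move=> /ereal_inf_lt[_ [u [g [Yu [Wu ->]]]] lt]; exists u, g. Qed.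

(** From |u| = max(u, -u), at the cost of a factor 2 in the energy. *)
Lemma weak_grad_norm u g : Cc_closure Om u -> WG u g -> exists h,
  [/\ Cc_closure Om (fun x => `|u x|), WG (fun x => `|u x|) h &
      (Wn (fun x => `|u x|)%R h <= 2%:E * Wn u g)%E].
Proof.
move=> Cu Wu; have WN := weak_gradZ Hmu oOm p1 (-1) Wu.
have nE : (fun x => Num.max (u x) (-1 * u x)) = (fun x => `|u x|).
  apply/funext => x; rewrite mulN1r; have [h|h] := leP 0 (u x).
    by rewrite max_l ?ger0_norm//; lra.
  by rewrite max_r ?ltr0_norm//; lra.
have := Wnormp_max Hmu oOm p1 Wu WN; have := weak_grad_max Hmu oOm p1 Wu WN.
have := Cc_max Cu (CcZ (-1) Cu).
rewrite nE => Cn Wnn le; eexists; split; [exact: Cn|exact: Wnn|].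
apply: le_trans le _; rewrite (WnormpZ oOm p1 (-1) Wu) normrN1 powR1 mul1e.
by rewrite -[2%:E]/(1%:E + 1%:E)%E ge0_muleDl ?lee_fin// mul1e.
Qed.

Lemma Wnormp_triangle u g v h (w : E -> R) k : WG v h -> WG u g -> WG w k ->
  (Wn (fun x => v x - w x)%R (fun i x => h i x - k i x)%R <=
   (2 `^ p)%:E * (Wn (fun x => u x - v x)%R (fun i x => g i x - h i x)%R +
                  Wn (fun x => u x - w x)%R (fun i x => g i x - k i x)%R))%E.
Proof.
move=> Wv Wu Ww; have W1 := weak_gradZ Hmu oOm p1 (-1) (weak_gradB Hmu oOm p1 Wu Wv).
have W2 := weak_gradB Hmu oOm p1 Wu Ww.
have := WnormpD Hmu oOm p1 W1 W2.
rewrite (WnormpZ oOm p1 (-1) (weak_gradB Hmu oOm p1 Wu Wv)) normrN1 powR1 mul1e.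
have E1 : (fun x => -1 * (u x - v x) + (u x - w x)) = (fun x => v x - w x).
  by apply/funext => x; ring.
have E2 : (fun i x => -1 * (g i x - h i x) + (g i x - k i x)) = (fun i x => h i x - k i x).
  by apply/funext => i; apply/funext => x; ring.
by rewrite E1 E2.
Qed.

(** The factor 2^n makes {w_n > 1} the set where consecutive approximants differ by more than
    2^(-n). The rate 4^(-n-1) leaves, after the summable 2^(-n-1) used by [Cap_superlevel], a
    further geometric factor that makes the capacity of tails small. *)
Lemma Wtilde_quasi_cauchy u : Wt u -> exists (v w : nat -> E -> R) (h : nat -> 'I_N -> E -> R),
  [/\ forall n, Cc_closure Om (v n),
      {ae mu, forall x : B, Om x -> v n x @[n --> \oo] --> u x},
      forall n x, w n x = `|2 ^+ n * (v n.+1 x - v n x)| &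
      forall n, [/\ Cc_closure Om (w n), WG (w n) (h n) &
        (Wn (w n) (h n) <= (1 / 4 ^+ n.+1)%:E)%E]].
Proof.
move=> Wtu; have [[g Wu] _] := Wtu.
(* The cost of passing from u - v_n to w_n: 2 for the absolute value, (2^n)^p for the scaling, 2^p
   for the triangle inequality, and 2 for the errors of two consecutive approximants. *)
pose K n : R := 4 * 2 `^ p * (2 ^+ n) `^ p.
have P1 (a : R) : 1 <= a -> 1 <= a `^ p.
  by move=> a1; have := powR_le p1 (@ler01 R) a1; rewrite powR1.
have K1 n : 1 <= K n.
  have h1 := P1 2 (ler1n R 2); have h2 : 1 <= (2 ^+ n : R) `^ p by apply: P1; rewrite exprn_ege1// ler1n.
  by rewrite /K; apply: mulr_ege1 => //; apply: mulr_ege1 => //; rewrite ler1n.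
have KS n : K n <= K n.+1.
  rewrite /K ler_wpM2l ?mulr_ge0 ?powR_ge0//.
  by apply: powR_le; rewrite ?exprn_ge0 ?ler_eXn2l ?ltr1n.
pose e n : R := (K n * 4 ^+ n.+1)^-1.
have e0 n : 0 < e n by rewrite invr_gt0 mulr_gt0 ?exprn_gt0// (lt_le_trans _ (K1 n)).
have Kp n : 0 < K n * 4 ^+ n.+1 by rewrite mulr_gt0 ?exprn_gt0// (lt_le_trans _ (K1 n)).
have eS n : e n.+1 <= e n.
  rewrite /e lef_pV2 ?posrE// ler_pM// ?exprn_ge0//; last by rewrite ler_eXn2l ?ltr1n.
  by rewrite (le_trans _ (K1 n)).
have e2 n : e n <= 1 / 2 ^+ n.+1.
  rewrite div1r lef_pV2 ?posrE// ?exprn_gt0//.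
  apply: (@le_trans _ _ (4 ^+ n.+1)); first by apply: lerXn2r; rewrite ?nnegrE ?ler_nat.
  by rewrite ler_peMl ?exprn_ge0.
have /choice[vh Hvh] (n : nat) :=
  let: ex_intro v (ex_intro h H) := Wtilde_approx Hmu oOm p1 Wtu Wu (e0 n) in ex_intro (fun vh : (E -> R) * ('I_N -> E -> R) => [/\ Cc_closure Om vh.1, WG vh.1 vh.2 &
     (Wn (fun x => u x - vh.1 x)%R (fun i x => g i x - vh.2 i x)%R < (e n)%:E)%E]) (v, h) H.
pose v n := (vh n).1; pose h n := (vh n).2.
have Cv n : Cc_closure Om (v n) by case: (Hvh n).
have Wv n : WG (v n) (h n) by case: (Hvh n).
have vlt n : (Wn (fun x => u x - v n x)%R (fun i x => g i x - h n i x)%R < (e n)%:E)%E by case: (Hvh n).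
have WB n := weak_gradB Hmu oOm p1 Wu (Wv n).
have Wd n := weak_gradD Hmu oOm p1 (WB n) (weak_gradZ Hmu oOm p1 (-1) (WB n.+1)).
have Cd n : Cc_closure Om (fun x => 2 ^+ n * (v n.+1 x - v n x)).
  have := CcZ (2 ^+ n) (CcD (Cv n.+1) (CcZ (-1) (Cv n))).
  by congr Cc_closure; apply/funext => x; rewrite mulN1r.
have WD n := weak_gradZ Hmu oOm p1 (2 ^+ n) (weak_gradB Hmu oOm p1 (Wv n.+1) (Wv n)).
have /choice[k Hk] n := weak_grad_norm (Cd n) (WD n).
exists v, (fun n x => `|2 ^+ n * (v n.+1 x - v n x)|), k; split.
- exact: Cv.
- pose T n x := energy p (fun x => u x - v n x) (fun i x => g i x - h n i x) x.
  have mT n : measurable_fun (Om : set B) (T n : B -> R).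
    have [m1 m2] := weak_grad_measurable (WB n).
    exact: measurable_energy.
  have T0 n x : 0 <= T n x by exact: energy_ge0.
  have IT n : (\int[mu]_(x in (Om : set B)) (T n x)%:E <= (1 / 2 ^+ n.+1)%:E)%E.
    apply: le_trans (ltW (vlt n)) _; rewrite lee_fin; exact: e2.
  have [S [_ _ _ HS]] := ae_summable oOm mT T0 IT.
  apply: ae_imp HS _ => x HS Omx; have [_ cT] := HS Omx.
  have [cu _] := @energy_cvg0 _ _ p p1 (fun n x => u x - v n x) (fun n i x => g i x - h n i x) x cT.
  have : u x - (u x - v n x) @[n --> \oo] --> u x - 0 by apply: cvgB cu; exact: cvg_cst.
  by rewrite subr0; under eq_fun do rewrite subKr.
- by [].
move=> n; have [C1 W1 le] := Hk n; split; [exact: C1|exact: W1|].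
apply: le_trans le _; rewrite (WnormpZ oOm p1 (2 ^+ n) (weak_gradB Hmu oOm p1 (Wv n.+1) (Wv n))).
have le : (Wn (fun x => v n.+1 x - v n x)%R (fun i x => h n.+1 i x - h n i x)%R <=
   (2 `^ p * (e n + e n))%:E)%E.
  apply: le_trans (Wnormp_triangle (Wv n.+1) Wu (Wv n)) _.
  rewrite EFinM; apply: lee_wpmul2l; first by rewrite lee_fin powR_ge0.
  rewrite addeC EFinD; apply: leeD (ltW (vlt n)) _; apply: le_trans (ltW (vlt n.+1)) _.
  by rewrite lee_fin; exact: eS.
apply: (@le_trans _ _ (2%:E * ((`|2 ^+ n| `^ p)%:E * (2 `^ p * (e n + e n))%:E))%E).
  apply: lee_wpmul2l; first by rewrite lee_fin.
  by apply: lee_wpmul2l le; rewrite lee_fin powR_ge0.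
rewrite -!EFinM lee_fin ger0_norm ?exprn_ge0// le_eqVlt; apply/orP; left; apply/eqP.
transitivity (K n * e n); first by rewrite /K; ring.
rewrite /e invfM mulrA divff ?mul1r ?div1r// gt_eqF//.
exact: lt_le_trans (K1 n).
Qed.

End QuasiContinuousRepresentative.

Section ExistenceOfRepresentative.
Context {R : realType} {N : nat}.
Notation E := 'rV[R]_N.
Notation B := (Borel R N).
Context (mu : {measure set B -> \bar R}) (Hmu : is_lebesgue mu).
Context (Om : set E) (oOm : open Om) (p : R) (p1 : 1 < p).
Implicit Types (u v : E -> R) (g : 'I_N -> E -> R) (A : set E).

Notation WG := (is_weak_grad mu Om p).
Notation Wn := (Wnormp mu Om p).
Notation Wt := (inWtilde mu Om p).
Notation Y := (Yset mu Om p).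
Notation cap := (Cap mu Om p).

(** The superlevel set is relatively open, the [w n] being continuous up to the boundary, and their
    supremum is at least 1 almost everywhere on it, so the supremum is itself a competitor. *)
Lemma Cap_superlevel (w : nat -> E -> R) (h : nat -> 'I_N -> E -> R) (d : R) :
  (forall n x, 0 <= w n x) -> (forall n, Cc_closure Om (w n)) ->
  (forall n, WG (w n) (h n)) -> (forall n, (Wn (w n) (h n) <= (d / 2 ^+ n.+1)%:E)%E) ->
  (cap [set x | closure Om x /\ exists n, (1 < w n x)%R] <= d%:E)%E.
Proof.
move=> w0 Cw Ww Iw; have [z [G [Wz WzG le_d wz]]] := countable_max Hmu oOm p1 w0 Cw Ww Iw.
apply: le_trans le_d; apply: Cap_le WzG; split; first exact: Wz.
exists [set x | closure Om x /\ exists n, 1 < w n x]; split; last split=> [x //|].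
  have := @rel_open_bigcup _ _ Om (fun n => [set x | closure Om x /\ 1 < w n x]) (fun=> True).
  move=> /(_ (fun n => rel_open_gt 1 (proj1 (Cw n)))); congr rel_open.
  by apply/seteqP; split=> [x [n _ []]|x [Ox [n wn]]]; [split=> //; exists n|exists n].
apply: ae_imp wz _ => x wz [[_ [n wn]] Omx].
exact: le_trans (ltW wn) (wz Omx n).
Qed.

Lemma exists_qc_rep u : Wt u -> exists f, qc_rep mu Om p u f.
Proof.
move=> Wtu; have [v [w [h [Cv cv wE Hw]]]] := Wtilde_quasi_cauchy Hmu oOm p1 Wtu.
have w0 n x : 0 <= w n x by rewrite wE.
have Cw n : Cc_closure Om (w n) by case: (Hw n).
have Ww n : WG (w n) (h n) by case: (Hw n).
(* The limit is taken at every point; where the sequence diverges its default value does no harm,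
   such points lying in every [V] below or outside the closure. *)
exists (fun x => limn (fun n => v n x)); split; last first.
  by apply: ae_imp cv _ => x c Omx; apply: cvg_lim => //; exact: c.
move=> eps e0.
have [m lt_eps] : exists m, 2^-1 ^+ m < eps.
  have [m _ /(_ m (leqnn m))] := cvgr_lt _ (cvg_half_geometric 1) _ e0.
  by rewrite mul1r; exists m.
pose V := [set x | closure Om x /\ exists n, 1 < w (m + n)%N x].
exists V; split; [|split].
- have := @rel_open_bigcup _ _ Om (fun n => [set x | closure Om x /\ 1 < w (m + n)%N x]) (fun=> True).
  move=> /(_ (fun n => rel_open_gt 1 (proj1 (Cw (m + n)%N)))); congr rel_open.
  by apply/seteqP; split=> [x [n _ []]|x [Ox [n wn]]]; [split=> //; exists n|exists n].
- apply: (@le_lt_trans _ _ (2^-1 ^+ m)%:E); last by rewrite lte_fin.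
  apply: (Cap_superlevel (w := fun n => w (m + n)%N) (h := fun n => h (m + n)%N)).
  + by move=> n x; exact: w0.
  + by move=> n; exact: Cw.
  + by move=> n; exact: Ww.
  (* Uses 4^(-(m+n+1)) <= 2^(-(m+n+1)) = 2^(-m) / 2^(n+1), so the tail from m has capacity at most
     2^(-m). *)
  + move=> n; have [_ _ le] := Hw (m + n)%N; apply: le_trans le _; rewrite lee_fin div1r.
    rewrite exprVn -invfM -exprD addnS lef_pV2 ?posrE ?exprn_gt0//.
    by apply: lerXn2r; rewrite ?nnegrE ?ler_nat.
have bnd x : (closure Om `\` V) x -> cvgn (fun n => v n x) /\
    forall n, (m <= n)%N -> `|v n x - limn (fun n => v n x)| <= 2 * 2^-1 ^+ n.
  move=> [Ox nV]; apply: cvg_telescope => k mk.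
  have : w k x <= 1.
    rewrite leNgt; apply/negP => wk; apply: nV; split; first exact: Ox.
    by exists (k - m)%N; rewrite subnKC.
  by rewrite wE normrM ger0_norm ?exprn_ge0// mulrC -ler_pdivlMr ?exprn_gt0// div1r exprVn.
apply: (@uniform_limit_within R E _ v _ (fun n => 2 * 2^-1 ^+ n) m).
- move=> n; apply: (continuous_subspaceW (@subDsetl _ _ _)); exact: (proj1 (Cv n)).
- exact: cvg_half_geometric.
- by move=> n x mn Dx; have [_ ] := bnd x Dx; exact.
Qed.

End ExistenceOfRepresentative.

(** * The capacity formula *)

Section CapacityFormula.
Context {R : realType} {N : nat}.
Notation E := 'rV[R]_N.
Notation B := (Borel R N).
Context (mu : {measure set B -> \bar R}) (Hmu : is_lebesgue mu).
Context (Om : set E) (oOm : open Om) (p : R) (p1 : 1 < p).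
Implicit Types (u v : E -> R) (g : 'I_N -> E -> R) (A : set E).

Let pgt0 : 0 < p. Proof. exact: lt_trans p1. Qed.

Notation WG := (is_weak_grad mu Om p).
Notation Wn := (Wnormp mu Om p).
Notation Wt := (inWtilde mu Om p).
Notation Y := (Yset mu Om p).
Notation cap := (Cap mu Om p).

Lemma Cap_ge0 A : (0 <= cap A)%E.
Proof. by apply: le_ereal_inf_tmp => _ [u [g [_ [_ ->]]]]; exact: Wnormp_ge0. Qed.

Lemma Cap_eq0 A : (forall eps : R, 0 < eps -> (cap A <= eps%:E)%E) -> cap A = 0%E.
Proof.
move=> H; apply/eqP; rewrite eq_le Cap_ge0 andbT.
by apply/lee_addgt0Pr => e e0; rewrite add0e; exact: H.
Qed.

(* A function competing for the exceptional set V of f also competes for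
   {f < 1} inside O, because f = u >= 1 almost everywhere on O. *)
Lemma qe_ge1_of_ae A (O : set E) u f : rel_open Om O -> A `<=` O ->
  {ae mu, forall x : B, (O `&` Om) x -> 1 <= u x} -> qc_rep mu Om p u f ->
  qe_ge1 mu Om p A f.
Proof.
move=> oO AO u1 [cf fu]; exists (O `&` [set x | f x < 1]); split; last split.
- by case: oO => U [_ ->] x [[]].
- apply: Cap_eq0 => eps e0; have [V [oV [Vlt cfV]]] := cf eps e0.
  have [w [h [[Ww [W [oW [VW w1]]]] WGw lt]]] := Cap_lt Vlt.
  apply: le_trans (ltW lt); apply: Cap_le WGw; split; first exact: Ww.
  (* The openness lemma deals with strict superlevel sets, so {f < 1} is written as {-f > -1}. *)
  have cNf : {within closure Om `\` V, continuous (fun x => - f x)}.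
    by move=> x; apply: (@continuousN _ _ _ (f : subspace (closure Om `\` V) -> R)); exact: cfV.
  exists (O `&` ([set x | closure Om x /\ -1 < - f x] `|` V)); split; last split.
  + by apply: rel_openI => //; exact: rel_open_setU_gt.
  + move=> x [Ox fx]; split=> //; left; split; last by rewrite ltrN2.
    by case: oO Ox => U [_ ->] [].
  + apply: ae_imp2 (ae_imp2 w1 u1 (fun x a b => conj a b)) fu _ => x [w1x u1x] fux.
    move=> [[Ox [[_ fx]|Vx]] Omx].
      have := u1x (conj Ox Omx); rewrite -(fux Omx) => f1.
      by move: fx; rewrite ltrN2 ltNge f1.
    by apply: w1x; split; [exact: VW|exact: Omx].
- move=> x Ax nP; rewrite leNgt; apply/negP => fx; apply: nP; split=> //; exact: AO.
Qed.

(** One eps pays for the set off which f is continuous, the other for the polar set: a polar set has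
    capacity 0 but its competitors may have positive energy. *)
Lemma Cap_le_qe A u g f (k eps : R) : A `<=` closure Om -> Wt u -> WG u g ->
  qc_rep mu Om p u f -> qe_ge1 mu Om p A f -> 1 < k -> 0 < eps ->
  (cap A <= (k `^ p)%:E * Wn u g + eps%:E + eps%:E)%E.
Proof.
move=> AOm Wu WGu [cf fu] [P [POm [P0 f1]]] k1 e0.
have k0 : 0 < k by exact: lt_trans k1.
have [V [oV [Vlt cfV]]] := cf eps e0.
have Plt : (cap P < eps%:E)%E by rewrite P0 lte_fin.
have [w1 [h1 [[Ww1 [ O1 [oO1 [VO1 w1ge]]]] WG1 lt1]]] := Cap_lt Vlt.
have [w2 [h2 [[Ww2 [ O2 [oO2 [PO2 w2ge]]]] WG2 lt2]]] := Cap_lt Plt.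
have WGk := weak_gradZ Hmu oOm p1 k WGu.
have WG3 := weak_grad_max Hmu oOm p1 WGk WG1.
have WG4 := weak_grad_max Hmu oOm p1 WG3 WG2.
apply: le_trans (Cap_le _ WG4) _; last first.
  apply: le_trans (Wnormp_max Hmu oOm p1 WG3 WG2) _; apply: leeD (ltW lt2).
  apply: le_trans (Wnormp_max Hmu oOm p1 WGk WG1) _; apply: leeD (ltW lt1).
  by rewrite (WnormpZ oOm p1 k WGu) gtr0_norm.
split.
  apply: (Wtilde_max Hmu oOm p1 _ Ww2); apply: (Wtilde_max Hmu oOm p1 _ Ww1).
  exact: (WtildeZ Hmu oOm p1 k Wu).
(* The strict inequality gives a relatively open set, k > 1 makes it contain the points where f >=
   1, and on it k u >= 1 almost everywhere in [Om]. *)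
exists (([set x | closure Om x /\ k^-1 < f x] `|` V) `|` O2); split; last split.
- by apply: rel_openU => //; exact: rel_open_setU_gt.
- move=> x Ax; have [Px|nP] := pselect (P x); first by right; exact: PO2.
  left; left; split; first exact: AOm.
  by apply: lt_le_trans (f1 x Ax nP); rewrite invf_lt1.
apply: ae_imp2 (ae_imp2 w1ge w2ge (fun x a b => conj a b)) fu _ => x [w1x w2x] fux.
move=> [[[[_ fx]|Vx]|O2x] Omx]; rewrite !le_max.
- rewrite (_ : 1 <= k * u x) // -(fux Omx) mulrC -ler_pdivrMr// div1r; exact: ltW.
- by rewrite w1x ?orbT//; split=> //; exact: VO1.
- by rewrite w2x ?orbT.
Qed.

Lemma Cap_le_Wnormp A u g f : A `<=` closure Om -> Wt u -> WG u g ->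
  qc_rep mu Om p u f -> qe_ge1 mu Om p A f -> (cap A <= Wn u g)%E.
Proof.
move=> AOm Wu WGu fu f1; apply/lee_addgt0Pr => e e0.
have fW : (Wn u g \is a fin_num)%E.
  by rewrite ge0_fin_numE; [exact: (Wnormp_lty oOm p1 WGu)|exact: Wnormp_ge0].
pose M := fine (Wn u g).
have M0 : 0 <= M by rewrite fine_ge0// Wnormp_ge0.
have M1 : 0 < M + 1 by rewrite ltr_wpDl.
(* [k] is chosen so that k^p = 1 + t, hence the excess t M is at most e / 2; the 1 in the
   denominator covers M = 0, and the two exceptional sets cost e / 4 each. *)
pose t := e / 2 / (M + 1).
have t0 : 0 < t by rewrite !divr_gt0.
pose k := (1 + t) `^ p^-1.
have kp : k `^ p = 1 + t by rewrite /k -powRrM mulVf ?gt_eqF// powRr1// addr_ge0// ltW.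
have k1 : 1 < k.
  rewrite ltNge; apply/negP => k1; have := powR_le p1 (powR_ge0 _ _) k1.
  by rewrite powR1 kp gerDl leNgt t0.
have e4 : 0 < e / 4 by rewrite divr_gt0.
apply: le_trans (Cap_le_qe AOm Wu WGu fu f1 k1 e4) _.
rewrite -(fineK fW) -/M kp -EFinM -!EFinD lee_fin.
have : t * M <= e / 2.
  rewrite /t -mulrA ler_piMr//; first by rewrite divr_ge0// ltW.
  by rewrite mulrC ler_pdivrMr// mul1r lerDl.
by rewrite mulrDl mul1r; lra.
Qed.

End CapacityFormula.

Theorem mainTheorem15 (R : realType) (N : nat)
  (mu : {measure set (Borel R N) -> \bar R}) (Om : set 'rV[R]_N) (p : R) :
  is_lebesgue mu -> open Om -> Om !=set0 -> 1 < p ->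
  forall A : set 'rV[R]_N, A `<=` closure Om ->
    Cap mu Om p A =
    ereal_inf [set y | exists u g f,
                 inWtilde mu Om p u /\ is_weak_grad mu Om p u g /\
                 qc_rep mu Om p u f /\ qe_ge1 mu Om p A f /\
                 y = Wnormp mu Om p u g].
Proof.
move=> Hmu oOm _ p1 A AOm; apply/eqP; rewrite eq_le; apply/andP; split.
  apply: le_ereal_inf_tmp => _ [u [g [f [Wu [WGu [fu [f1 ->]]]]]]].
  exact: (Cap_le_Wnormp Hmu oOm p1 AOm Wu WGu fu f1).
apply: le_ereal_inf_tmp => _ [u [g [[Wu [ O [oO [AO u1]]]] [WGu ->]]]].
(* A competitor u comes without a representative, yet the right-hand infimum ranges over triples
   with one, so it has to be constructed. *)
have [f fu] := exists_qc_rep Hmu oOm p1 Wu.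
apply: ereal_inf_lbound; exists u, g, f; split; first exact: Wu.
split; first exact: WGu.
split; first exact: fu.
split; [exact: (qe_ge1_of_ae oO AO u1 fu)|exact: erefl].
Qed.
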